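(* Let $w$ be a strictly positive analytic weight on the unit circle $\mathbb T_1$, and let $\rho<1$ be the associated constant. Then $$\lim_{n\to\infty}\frac{\Phi_n(z)}{z^n}=\frac{D_{\rm e}(z)}{\tau}$$ locally uniformly for $|z|>\rho$, and the convergence takes place with a geometric rate (that is, for every compact $K\subset\{|z|>\rho\}$ there are $C<\infty$ and $0<q<1$ with $\sup_{z\in K}|\Phi_n(z)z^{-n}-D_{\rm e}(z)/\tau|\le Cq^n$ for all $n$). In particular, for any compact set $K\subset\{z\in\mathbb C:|z|>\rho\text{ and }D_{\rm e}(z)\ne0\}$ there exists $m=m(K)\in\mathbb N$ such that $\Phi_n(z)\neq0$ for all $z\in K$ and all $n\ge m$. Furthermore, each zero $\zeta$ of $D_{\rm e}$ in $\rho<|z|<1$ attracts as many zeros of $\Phi_n$ (counted with multiplicity) as its multiplicity, and these zeros tend to $\zeta$ with a geometric rate as $n\to\infty$.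
   Context: Notation: $\mathbb T_1=\{z\in\mathbb C:|z|=1\}$. A strictly positive analytic weight on $\mathbb T_1$ is a function $w$ that is strictly positive on $\mathbb T_1$ and extends to a nowhere vanishing holomorphic function on an open set containing $\mathbb T_1$. The orthonormal polynomials $\varphi_n(z)=\kappa_nz^n+\dots$, $\kappa_n>0$, satisfy $\oint_{\mathbb T_1}\varphi_n\overline{\varphi_m}\,w\,|dz|=\delta_{mn}$, and $\Phi_n=\varphi_n/\kappa_n$ is monic. Exterior Szegő function: $D_{\rm e}(z)=\exp\left(\frac1{4\pi}\int_0^{2\pi}\log w(e^{i\theta})\frac{e^{i\theta}+z}{e^{i\theta}-z}\,d\theta\right)$ for $|z|>1$; it extends holomorphically across $\mathbb T_1$ (same notation for the continuation). Put $\rho=\inf\{0<s<1: D_{\rm e}\text{ is (extends) holomorphic in }|z|>s\}$; one has $\rho<1$. Put $\tau=\exp\left(-\frac1{4\pi}\int_0^{2\pi}\log w(e^{i\theta})\,d\theta\right)>0$. *)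

(* Defs.v *)
From Stdlib Require Import Reals List ClassicalEpsilon.
From Coquelicot Require Import Coquelicot.

Open Scope R_scope.

Definition cis (t : R) : C := (cos t, sin t).

Definition Cexp (z : C) : C := (RtoC (exp (Re z)) * cis (Im z))%C.

Definition holomorphic_on (U : C -> Prop) (f : C -> C) : Prop :=
  forall z : C, U z -> @ex_derive C_AbsRing C_NormedModule f z.

(* Open-cover compactness; Coquelicot only treats products of segments. *)
Definition Ccompact (K : C -> Prop) : Prop :=
  forall F : (C -> Prop) -> Prop,
    (forall U, F U -> open (T := C_UniformSpace) U) ->
    (forall z, K z -> exists U, F U /\ U z) ->
    exists l : list (C -> Prop),
      List.Forall F l /\ forall z, K z -> List.Exists (fun U => U z) l.

(* Only the values of [w] on the unit circle are ever used. *)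
Definition positive_analytic_weight (w : C -> R) : Prop :=
  (forall z, Cmod z = 1 -> 0 < w z) /\
  exists (U : C -> Prop) (W : C -> C),
    open (T := C_UniformSpace) U /\
    (forall z, Cmod z = 1 -> U z) /\
    holomorphic_on U W /\
    (forall z, U z -> W z <> RtoC 0) /\
    (forall z, Cmod z = 1 -> W z = RtoC (w z)).

Definition poly_with_leading (f : C -> C) (n : nat) (a : C) : Prop :=
  exists c : nat -> C,
    c n = a /\
    forall z, f z = sum_n (G := C_AbelianMonoid) (fun k => (c k * z ^ k)%C) n.

(* On the unit circle |dz| is d theta for z = cis theta. *)
Definition orthonormal_polynomials (w : C -> R) (kappa : nat -> R)
    (phi : nat -> C -> C) : Prop :=
  (forall n, 0 < kappa n /\ poly_with_leading (phi n) n (RtoC (kappa n))) /\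
  forall n m,
    is_RInt (V := C_R_NormedModule)
      (fun t => (phi n (cis t) * Cconj (phi m (cis t)) * RtoC (w (cis t)))%C)
      0 (2 * PI) (RtoC (if Nat.eqb n m then 1 else 0)).

Definition monic_poly (kappa : nat -> R) (phi : nat -> C -> C)
    (n : nat) (z : C) : C := (phi n z / RtoC (kappa n))%C.

(* The Szego integral; meaningful for 1 < |z|. *)
Definition szego_ext_integral (w : C -> R) (z : C) : C :=
  Cexp (RtoC (/ (4 * PI)) *
        RInt (V := C_R_CompleteNormedModule)
          (fun t => (RtoC (ln (w (cis t))) * ((cis t + z) / (cis t - z)))%C)
          0 (2 * PI))%C.

Definition szego_continuation (w : C -> R) (s : R) (F : C -> C) : Prop :=
  holomorphic_on (fun z => s < Cmod z) F /\
  forall z, 1 < Cmod z -> F z = szego_ext_integral w z.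

Definition szego_rho (w : C -> R) : R :=
  real (Glb_Rbar (fun s => 0 < s < 1 /\ exists F, szego_continuation w s F)).

(* The exterior Szego function with its continuation to szego_rho w < |z|,
   where it is unique by the identity theorem; arbitrary elsewhere. *)
Definition szego_De (w : C -> R) : C -> C :=
  epsilon (inhabits (fun _ : C => RtoC 0)) (szego_continuation w (szego_rho w)).

Definition szego_tau (w : C -> R) : R :=
  exp (- (/ (4 * PI) * RInt (fun t => ln (w (cis t))) 0 (2 * PI))).

(* Order 0 means f zeta <> 0. *)
Definition zero_of_order (f : C -> C) (zeta : C) (k : nat) : Prop :=
  exists (U : C -> Prop) (g : C -> C),
    open (T := C_UniformSpace) U /\ U zeta /\
    holomorphic_on U g /\ g zeta <> RtoC 0 /\
    forall z, U z -> f z = ((z - zeta) ^ k * g z)%C.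

(* [l] lists the zeros of [f] in [A], each repeated according to its
   multiplicity. *)
Definition zeros_in (f : C -> C) (A : C -> Prop) (l : list C) : Prop :=
  (forall z, In z l -> A z) /\
  forall z, A z -> zero_of_order f z (count_occ Ceq_dec l z).

Definition locally_uniform_limit (D : C -> Prop) (f : nat -> C -> C)
    (g : C -> C) : Prop :=
  forall z0, D z0 ->
    exists U : C -> Prop,
      open (T := C_UniformSpace) U /\ U z0 /\
      forall eps, 0 < eps ->
        exists N : nat, forall n, (N <= n)%nat ->
          forall z, U z -> D z -> Cmod (f n z - g z) < eps.

Definition geometric_limit_on (K : C -> Prop) (f : nat -> C -> C)
    (g : C -> C) : Prop :=
  exists M q : R, 0 < q < 1 /\
    forall (n : nat) (z : C), K z -> Cmod (f n z - g z) <= M * q ^ n.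

(* Main.v *)
(** In the variable [u = 1 / z] the function [e = D_e / tau] is holomorphic near the closed
    unit disc, nonvanishing there, [e 0 = 1], and [w = 1 / (tau^2 |e|^2)] on the circle.
    Its Taylor coefficients [c k] are [O(q^k)] for every [q > rho], because a continuation of
    [D_e] to [|z| > s] has Laurent coefficients that do not depend on the circle.  Let
    [Q_n = z^n (c 0 + c 1 / z + ... + c n / z^n)] and [X = Q_n - Phi_n], of degree less than
    [n].  As [X] is orthogonal to [Phi_n], and the integral of [X conj (z^n e) w] is a multiple
    of the circle mean of a holomorphic function of [u] vanishing at [0], only the tail of [e]
    contributes to [int |X|^2 w], which is therefore [O(q^(2n))].  So all coefficients of [X] are
    [O(q^n)], and [X / z^n] tends to [0] geometrically on [|z| >= r > rho].

    A zero of [Phi_n] close to [zeta] is within [O(q^(n/k))] of [zeta], since [|D_e|] is bounded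
    below by a multiple of [|z - zeta|^k]; that there are exactly [k] of them follows from the
    maximum principle applied to the quotient of [Phi_n / z^n] by the product of its root
    factors near [zeta], and to the inverse of that quotient. *)

Require Import Defs.
From Stdlib Require Import Reals ZArith List Lra Lia Psatz ClassicalEpsilon.
From Coquelicot Require Import Coquelicot.

Open Scope R_scope.

(** * Continuity and complex differentiability *)

(** The analysis rests on one integral theorem: the circle mean of a function holomorphic on an
    annulus does not depend on the radius. It is Goursat's theorem on a rectangle, read through the
    exponential. Applied to [f u / u^k] it makes Taylor and Laurent coefficients computable on any
    circle; the expansion itself is then the pointwise convergence of a Fourier series. The function
    [e] is an exponential by construction: if [P] is the series in [u] whose coefficients are the
    Fourier coefficients of [ln w] of index at most 0, and [a0] is the mean of [ln w], the Szego
    integral gives [D_e = exp (a0 / 2 - P)] and [tau = exp (- a0 / 2)], so [e = exp (a0 - P)]. As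
    [ln w = 2 Re P - a0] on the circle, [w] times the conjugate of [e] is [1 / (tau^2 e)]: the
    weight trades a conjugate for a function holomorphic in [u], and this makes the orthogonality
    argument work. Errors of size [q^n] in the coefficients meet powers [|u|^k] with
    [|u| <= U < 1 / rho]; choosing [q] with [q U < 1] is possible exactly because [q] may be taken
    as close to [rho] as desired. *)

Definition Ccontinuous {T : UniformSpace} (f : T -> C) (x : T) : Prop :=
  forall eps, 0 < eps -> locally x (fun y => Cmod (f y - f x) < eps).

(* Caratheodory's form, in which the product, quotient and chain rules are statements
   about continuity. *)
Definition Cdiffable (f : C -> C) (z : C) : Prop :=
  exists phi : C -> C,
    Ccontinuous (T := C_UniformSpace) phi z /\
    locally (T := C_UniformSpace) z (fun y => f y = (f z + phi y * (y - z))%C).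

(* [ring] does not recognise [C] under its canonical-structure names. *)
Ltac cring := match goal with |- @eq _ ?a ?b => change (@eq C a b) end; ring.

Definition Csum (a : nat -> C) (n : nat) : C := sum_n (G := C_AbelianMonoid) a n.

Ltac fold_Csum := change (sum_n (G := C_AbelianMonoid) ?a ?n) with (Csum a n).

Lemma Csum_O (a : nat -> C) : Csum a 0 = a O.
Proof. apply (sum_O (G := C_AbelianMonoid)). Qed.

Lemma Csum_S (a : nat -> C) (n : nat) : Csum a (S n) = (Csum a n + a (S n))%C.
Proof. apply (sum_Sn (G := C_AbelianMonoid)). Qed.

Lemma Csum_ext (a b : nat -> C) (n : nat) :
  (forall k, (k <= n)%nat -> a k = b k) -> Csum a n = Csum b n.
Proof. apply (sum_n_ext_loc (G := C_AbelianMonoid)). Qed.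

Lemma Cmult_eq_0 (x y : C) : (x * y)%C = RtoC 0 -> x = RtoC 0 \/ y = RtoC 0.
Proof.
  intros H. destruct (Ceq_dec x 0) as [Hx|Hx]; [now left|right].
  destruct (Ceq_dec y 0) as [Hy|Hy]; trivial. now elim (Cmult_neq_0 x y Hx Hy).
Qed.

Lemma Csub_eq_0 (x y : C) : (x - y)%C = RtoC 0 -> x = y.
Proof. intros H. replace x with ((x - y) + y)%C by ring. rewrite H. ring. Qed.

Definition Ccontinuous_on (f : R -> C) (a b : R) : Prop :=
  forall t, a <= t <= b -> Ccontinuous (T := R_UniformSpace) f t.

Lemma Cmod_sub_triangle (x y z : C) : Cmod (x - z) <= Cmod (x - y) + Cmod (y - z).
Proof.
  replace (x - z)%C with ((x - y) + (y - z))%C by ring. apply Cmod_triangle.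
Qed.

Lemma Cmod_sub_sym (x y : C) : Cmod (x - y) = Cmod (y - x).
Proof. rewrite <- Cmod_opp. f_equal. ring. Qed.

Lemma Cmod_sub_le (x y : C) : Cmod (x - y) <= Cmod x + Cmod y.
Proof. rewrite <- (Cmod_opp y). apply Cmod_triangle. Qed.

Lemma Cmod_sub_ge (x y : C) : Cmod x - Cmod y <= Cmod (x - y).
Proof.
  replace x with ((x - y) + y)%C at 1 by ring.
  generalize (Cmod_triangle (x - y) y). lra.
Qed.

Lemma Cmod_im_le (c : C) : Rabs (Im c) <= Cmod c.
Proof.
  apply Rle_trans with (2 := Rmax_Cmod c). apply Rmax_r.
Qed.

Lemma exterior_inv (s : R) (z : C) : 0 <= s -> s < Cmod z -> (/ z)%C <> RtoC 0 /\ s * Cmod (/ z) < 1.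
Proof.
  intros Hs Hz. assert (Hz0 : z <> RtoC 0) by (apply Cmod_gt_0; lra).
  rewrite Cmod_inv by trivial. split.
  - apply Cmod_gt_0. rewrite Cmod_inv by trivial. apply Rinv_0_lt_compat. lra.
  - apply Rmult_lt_reg_r with (Cmod z). lra. rewrite Rmult_assoc, Rinv_l; lra.
Qed.

Lemma interior_inv (s : R) (u : C) : u <> RtoC 0 -> s * Cmod u < 1 -> s < Cmod (/ u).
Proof.
  intros Hu Hs. rewrite Cmod_inv by trivial. apply Cmod_gt_0 in Hu.
  apply Rmult_lt_reg_r with (Cmod u); trivial. rewrite Rinv_l; lra.
Qed.

(** The uniform balls of [C] are those of a product, hence squares; they are compared with discs at
    the cost of a factor [sqrt 2]. *)
Lemma locally_Cmod (z : C) (P : C -> Prop) :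
  locally (T := C_UniformSpace) z P <->
  exists d, 0 < d /\ forall y, Cmod (y - z) < d -> P y.
Proof.
  split.
  - intros [d H]. exists d. split; [apply cond_pos|].
    intros y Hy. apply H. apply C_NormedModule_mixin_compat1. exact Hy.
  - intros [d [Hd H]].
    assert (Hs : 0 < d / sqrt 2).
    { apply Rdiv_lt_0_compat; trivial. apply sqrt_lt_R0; lra. }
    exists (mkposreal _ Hs). intros y Hy. apply H.
    apply Rlt_le_trans with (1 := C_NormedModule_mixin_compat2 z y _ Hy).
    simpl. right. field. apply Rgt_not_eq, sqrt_lt_R0; lra.
Qed.

Lemma locally_Cmod_intro (z : C) (P : C -> Prop) (d : R) : 0 < d ->
  (forall y, Cmod (y - z) < d -> P y) -> locally (T := C_UniformSpace) z P.
Proof. intros Hd H. apply locally_Cmod. exists d; auto. Qed.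

Lemma locally_Cmod_ball (z : C) (d : R) : 0 < d ->
  locally (T := C_UniformSpace) z (fun y => Cmod (y - z) < d).
Proof. intros Hd. apply locally_Cmod. exists d; auto. Qed.

Lemma open_locally_C (U : C -> Prop) (z : C) :
  open (T := C_UniformSpace) U -> U z -> locally (T := C_UniformSpace) z U.
Proof. intros HU Hz. apply HU, Hz. Qed.

(** The slope function is the difference quotient, completed at [z] by the derivative. *)
Lemma ex_derive_Cdiffable (f : C -> C) (z : C) :
  @ex_derive C_AbsRing C_NormedModule f z -> Cdiffable f z.
Proof.
  intros [l [_ H]].
  assert (H' := H z (fun P HP => HP)). clear H.
  exists (fun y => if Ceq_dec y z then l else ((f y - f z) / (y - z))%C).
  split.
  - intros eps He.
    assert (He2 : 0 < eps / 2) by lra.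
    destruct (H' (mkposreal _ He2)) as [d Hd].
    apply locally_Cmod_intro with d; [apply cond_pos|].
    intros y Hy.
    destruct (Ceq_dec z z) as [_|E]; [|now elim E].
    destruct (Ceq_dec y z) as [E|E].
    + replace (l - l)%C with (RtoC 0) by ring. now rewrite Cmod_0.
    + assert (Hn : (y - z)%C <> RtoC 0).
      { intros E'. apply E. replace y with ((y - z) + z)%C by ring. rewrite E'. ring. }
      assert (K := Hd y Hy). simpl in K.
      change (Cmod ((f y - f z) - ((y - z) * l)) <= eps / 2 * Cmod (y - z)) in K.
      replace ((f y - f z) / (y - z) - l)%C with (((f y - f z) - ((y - z) * l)) / (y - z))%C
        by (field; trivial).
      rewrite Cmod_div by trivial.
      apply Cmod_gt_0 in Hn.
      apply Rle_lt_trans with (eps / 2); [|lra].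
      apply Rmult_le_reg_r with (Cmod (y - z)); trivial.
      unfold Rdiv at 1. rewrite Rmult_assoc, Rinv_l, Rmult_1_r; lra.
  - apply filter_forall. intros y.
    destruct (Ceq_dec y z) as [E|E].
    + rewrite E. ring.
    + field. intros E'. apply E. replace y with ((y - z) + z)%C by ring. rewrite E'. ring.
Qed.

Lemma Cdiffable_ex_derive (f : C -> C) (z : C) :
  Cdiffable f z -> @ex_derive C_AbsRing C_NormedModule f z.
Proof.
  intros [phi [Hc Hf]]. exists (phi z). split.
  { apply is_linear_scal_l. }
  intros x Hx eps.
  assert (E : z = x).
  { apply (is_filter_lim_locally_unique (K := C_AbsRing) (V := AbsRing_NormedModule C_AbsRing)).
    exact Hx. }
  subst x. clear Hx.
  specialize (Hc eps (cond_pos eps)).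
  generalize (filter_and _ _ Hc Hf). intros K.
  apply locally_Cmod in K. destruct K as [d [Hd K]].
  exists (mkposreal _ Hd). intros y Hy.
  destruct (K y Hy) as [K1 K2].
  change (Cmod ((f y - f z) - ((y - z) * phi z)) <= eps * Cmod (y - z)).
  rewrite K2. replace (_ - _)%C with ((phi y - phi z) * (y - z))%C by ring.
  rewrite Cmod_mult. apply Rmult_le_compat_r. apply Cmod_ge_0. lra.
Qed.

Section ContinuousAlgebra.
Context {T : UniformSpace}.
Implicit Types (f g : T -> C) (x : T).

Lemma Ccontinuous_ext_loc f g x :
  locally x (fun y => f y = g y) -> Ccontinuous f x -> Ccontinuous g x.
Proof.
  intros E Hf eps He. generalize (filter_and _ _ E (Hf eps He)).
  apply filter_imp. intros y [E1 H]. rewrite <- E1, <- (locally_singleton _ _ E). exact H.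
Qed.

Lemma Ccontinuous_const (c : C) x : Ccontinuous (fun _ : T => c) x.
Proof.
  intros eps He. apply filter_forall. intros y.
  replace (c - c)%C with (RtoC 0) by ring. now rewrite Cmod_0.
Qed.

Lemma Ccontinuous_plus f g x :
  Ccontinuous f x -> Ccontinuous g x -> Ccontinuous (fun y => f y + g y)%C x.
Proof.
  intros Hf Hg eps He.
  assert (He2 : 0 < eps / 2) by lra.
  generalize (filter_and _ _ (Hf _ He2) (Hg _ He2)). apply filter_imp.
  intros y [H1 H2].
  replace (_ - _)%C with ((f y - f x) + (g y - g x))%C by ring.
  generalize (Cmod_triangle (f y - f x) (g y - g x)). lra.
Qed.

Lemma Ccontinuous_opp f x : Ccontinuous f x -> Ccontinuous (fun y => - f y)%C x.
Proof.
  intros Hf eps He. generalize (Hf _ He). apply filter_imp. intros y H.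
  replace (_ - _)%C with (- (f y - f x))%C by ring. now rewrite Cmod_opp.
Qed.

Lemma Ccontinuous_minus f g x :
  Ccontinuous f x -> Ccontinuous g x -> Ccontinuous (fun y => f y - g y)%C x.
Proof. intros Hf Hg. apply (Ccontinuous_plus f (fun y => - g y)%C); trivial. now apply Ccontinuous_opp. Qed.

Lemma Ccontinuous_bounded f x :
  Ccontinuous f x -> locally x (fun y => Cmod (f y) < Cmod (f x) + 1).
Proof.
  intros Hf. generalize (Hf 1 Rlt_0_1). apply filter_imp. intros y H.
  generalize (Cmod_sub_ge (f y) (f x)). lra.
Qed.

Lemma Ccontinuous_mult f g x :
  Ccontinuous f x -> Ccontinuous g x -> Ccontinuous (fun y => f y * g y)%C x.
Proof.
  intros Hf Hg eps He.
  set (A := Cmod (f x) + 1). set (B := Cmod (g x) + 1).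
  assert (HA : 0 < A) by (generalize (Cmod_ge_0 (f x)); unfold A; lra).
  assert (HB : 0 < B) by (generalize (Cmod_ge_0 (g x)); unfold B; lra).
  assert (He1 : 0 < eps / 2 / B) by (apply Rdiv_lt_0_compat; lra).
  assert (He2 : 0 < eps / 2 / A) by (apply Rdiv_lt_0_compat; lra).
  generalize (filter_and _ _ (Ccontinuous_bounded _ _ Hf) (filter_and _ _ (Hf _ He1) (Hg _ He2))).
  apply filter_imp. intros y [H0 [H1 H2]].
  replace (_ - _)%C with (f y * (g y - g x) + (f y - f x) * g x)%C by ring.
  eapply Rle_lt_trans; [apply Cmod_triangle|]. rewrite 2!Cmod_mult.
  assert (K1 : Cmod (f y) * Cmod (g y - g x) <= A * (eps / 2 / A)).
  { apply Rmult_le_compat; try apply Cmod_ge_0; unfold A in *; lra. }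
  assert (K2 : Cmod (f y - f x) * Cmod (g x) < (eps / 2 / B) * B).
  { apply Rle_lt_trans with ((eps / 2 / B) * Cmod (g x)).
    - apply Rmult_le_compat_r; [apply Cmod_ge_0|lra].
    - apply Rmult_lt_compat_l; unfold B in *; lra. }
  replace (A * (eps / 2 / A)) with (eps / 2) in K1 by (field; lra).
  replace ((eps / 2 / B) * B) with (eps / 2) in K2 by (field; lra). lra.
Qed.

Lemma Ccontinuous_inv f x :
  f x <> RtoC 0 -> Ccontinuous f x -> Ccontinuous (fun y => / f y)%C x.
Proof.
  intros Hx Hf eps He.
  assert (Hm := Hx). apply Cmod_gt_0 in Hm. set (m := Cmod (f x)) in *.
  assert (He1 : 0 < Rmin (m / 2) (eps * (m / 2 * m))).
  { apply Rmin_glb_lt. lra. apply Rmult_lt_0_compat. lra. apply Rmult_lt_0_compat; lra. }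
  generalize (Hf _ He1). apply filter_imp. intros y H.
  assert (H1 := Rlt_le_trans _ _ _ H (Rmin_l _ _)).
  assert (H2 := Rlt_le_trans _ _ _ H (Rmin_r _ _)).
  assert (H3 : m / 2 < Cmod (f y)).
  { generalize (Cmod_sub_ge (f x) (f y)). rewrite Cmod_sub_sym. fold m. lra. }
  assert (Hy : f y <> RtoC 0) by (apply Cmod_gt_0; lra).
  replace (/ f y - / f x)%C with (- (f y - f x) / (f y * f x))%C by (field; split; trivial).
  rewrite Cmod_div, Cmod_opp, Cmod_mult.
  2: { apply Cmod_gt_0. rewrite Cmod_mult. apply Rmult_lt_0_compat; fold m; lra. }
  fold m. apply Rmult_lt_reg_r with (Cmod (f y) * m).
  { apply Rmult_lt_0_compat; lra. }
  unfold Rdiv. rewrite Rmult_assoc, Rinv_l, Rmult_1_r.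
  2: { apply Rgt_not_eq, Rmult_lt_0_compat; lra. }
  apply Rlt_trans with (1 := H2). apply Rmult_lt_compat_l; trivial.
  apply Rmult_lt_compat_r; lra.
Qed.

Lemma Ccontinuous_div f g x :
  g x <> RtoC 0 -> Ccontinuous f x -> Ccontinuous g x -> Ccontinuous (fun y => f y / g y)%C x.
Proof. intros H Hf Hg. apply Ccontinuous_mult; trivial. now apply Ccontinuous_inv. Qed.

Lemma Ccontinuous_pow f n x : Ccontinuous f x -> Ccontinuous (fun y => f y ^ n)%C x.
Proof.
  intros Hf. induction n; simpl. apply Ccontinuous_const. now apply Ccontinuous_mult.
Qed.

Lemma Ccontinuous_conj f x : Ccontinuous f x -> Ccontinuous (fun y => Cconj (f y)) x.
Proof.
  intros Hf eps He. generalize (Hf _ He). apply filter_imp. intros y H.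
  now rewrite <- Cminus_conj, Cmod_conj.
Qed.

Lemma Ccontinuous_mod f x : Ccontinuous f x -> Ccontinuous (fun y => RtoC (Cmod (f y))) x.
Proof.
  intros Hf eps He. generalize (Hf _ He). apply filter_imp. intros y H.
  rewrite <- RtoC_minus, Cmod_R. apply Rle_lt_trans with (2 := H).
  apply Rabs_le. generalize (Cmod_sub_ge (f y) (f x)) (Cmod_sub_ge (f x) (f y)).
  rewrite (Cmod_sub_sym (f x)). lra.
Qed.

Lemma Ccontinuous_comp (h : C -> C) f x :
  Ccontinuous (T := C_UniformSpace) h (f x) -> Ccontinuous f x -> Ccontinuous (fun y => h (f y)) x.
Proof.
  intros Hh Hf eps He. generalize (Hh eps He). intros K. apply locally_Cmod in K.
  destruct K as [d [Hd K]]. generalize (Hf d Hd). apply filter_imp. intros y. apply K.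
Qed.

Lemma Ccontinuous_sum (f : nat -> T -> C) (n : nat) x :
  (forall k, Ccontinuous (f k) x) ->
  Ccontinuous (fun y => Csum (fun k => f k y) n) x.
Proof.
  intros Hf. induction n.
  - apply Ccontinuous_ext_loc with (2 := Hf O). apply filter_forall. intros y. now rewrite Csum_O.
  - apply Ccontinuous_ext_loc with (2 := Ccontinuous_plus _ _ _ IHn (Hf (S n))).
    apply filter_forall. intros y. now rewrite Csum_S.
Qed.

End ContinuousAlgebra.

Lemma Ccontinuous_id (z : C) : Ccontinuous (T := C_UniformSpace) (fun y => y) z.
Proof. intros eps He. now apply locally_Cmod_ball. Qed.

Lemma continuous_pair_Ccontinuous {T : UniformSpace} (f g : T -> R) (x : T) :
  continuous f x -> continuous g x -> Ccontinuous (fun t => (f t, g t) : C) x.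
Proof.
  intros Hf Hg eps He.
  assert (He2 : 0 < eps / 2) by lra.
  assert (Kf : locally x (fun y => Rabs (f y - f x) < eps / 2)).
  { apply (Hf (fun v => Rabs (v - f x) < eps / 2)). exists (mkposreal _ He2). now intros v Hv. }
  assert (Kg : locally x (fun y => Rabs (g y - g x) < eps / 2)).
  { apply (Hg (fun v => Rabs (v - g x) < eps / 2)). exists (mkposreal _ He2). now intros v Hv. }
  generalize (filter_and _ _ Kf Kg). apply filter_imp. intros y [H1 H2].
  replace ((f y, g y) - (f x, g x))%C with (RtoC (f y - f x) + Ci * RtoC (g y - g x))%C.
  2: { apply injective_projections; simpl; ring. }
  eapply Rle_lt_trans; [apply Cmod_triangle|].
  rewrite Cmod_mult, Cmod_Ci, 2!Cmod_R. lra.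
Qed.

Lemma Ccontinuous_continuous {T : UniformSpace} (f : T -> C) (x : T) :
  Ccontinuous f x -> continuous (U := C_R_NormedModule) f x.
Proof.
  intros Hf P HP. apply (locally_Cmod (f x)) in HP. destruct HP as [d [Hd HP]].
  unfold filtermap. generalize (Hf d Hd). apply filter_imp. intros y. apply HP.
Qed.

Lemma Ccontinuous_Re {T : UniformSpace} (f : T -> C) (x : T) :
  Ccontinuous f x -> continuous (fun y => Re (f y)) x.
Proof.
  intros Hf P [d HP]. unfold filtermap. generalize (Hf d (cond_pos d)). apply filter_imp. intros y H.
  apply HP. apply Rle_lt_trans with (2 := H).
  change (Rabs (Re (f y) - Re (f x)) <= Cmod (f y - f x)).
  apply Rle_trans with (2 := re_le_Cmod _). right. f_equal.
Qed.

Lemma Cdiffable_continuous (f : C -> C) (z : C) :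
  Cdiffable f z -> Ccontinuous (T := C_UniformSpace) f z.
Proof.
  intros [phi [Hc Hf]].
  apply Ccontinuous_ext_loc with (fun y => f z + phi y * (y - z))%C.
  { apply filter_imp with (2 := Hf). now intros y ->. }
  apply Ccontinuous_plus. apply Ccontinuous_const.
  apply Ccontinuous_mult; trivial. apply Ccontinuous_minus. apply Ccontinuous_id. apply Ccontinuous_const.
Qed.

Lemma Cdiffable_ext_loc (f g : C -> C) (z : C) :
  locally (T := C_UniformSpace) z (fun y => f y = g y) -> Cdiffable f z -> Cdiffable g z.
Proof.
  intros E [phi [Hc Hf]]. exists phi. split; trivial.
  generalize (filter_and _ _ E Hf). apply filter_imp.
  intros y [<- ->]. now rewrite (locally_singleton _ _ E).
Qed.

Lemma Cdiffable_ext (f g : C -> C) (z : C) :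
  (forall y, f y = g y) -> Cdiffable f z -> Cdiffable g z.
Proof. intros E. apply Cdiffable_ext_loc. now apply filter_forall. Qed.

Lemma Cdiffable_const (c z : C) : Cdiffable (fun _ => c) z.
Proof.
  exists (fun _ => RtoC 0). split. apply Ccontinuous_const.
  apply filter_forall. intros y. cring.
Qed.

Lemma Cdiffable_id (z : C) : Cdiffable (fun y => y) z.
Proof.
  exists (fun _ => RtoC 1). split. apply Ccontinuous_const.
  refine (filter_forall _ (fun y : C => _)). ring.
Qed.

Lemma Cdiffable_plus (f g : C -> C) (z : C) :
  Cdiffable f z -> Cdiffable g z -> Cdiffable (fun y => f y + g y)%C z.
Proof.
  intros [p [Hp Hf]] [q [Hq Hg]]. exists (fun y => p y + q y)%C. split.
  now apply Ccontinuous_plus.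
  generalize (filter_and _ _ Hf Hg). apply filter_imp. intros y [-> ->]. cring.
Qed.

Lemma Cdiffable_mult (f g : C -> C) (z : C) :
  Cdiffable f z -> Cdiffable g z -> Cdiffable (fun y => f y * g y)%C z.
Proof.
  intros Df Dg. assert (Cg := Cdiffable_continuous _ _ Dg).
  destruct Df as [p [Hp Hf]]. destruct Dg as [q [Hq Hg]].
  exists (fun y => p y * g y + f z * q y)%C. split.
  - apply Ccontinuous_plus; apply Ccontinuous_mult; trivial. apply Ccontinuous_const.
  - generalize (filter_and _ _ Hf Hg). apply filter_imp. intros y [-> ->]. cring.
Qed.

Lemma Cdiffable_opp (f : C -> C) (z : C) : Cdiffable f z -> Cdiffable (fun y => - f y)%C z.
Proof.
  intros Hf. apply Cdiffable_ext with (fun y => (RtoC (-1)) * f y)%C.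
  { intros y. replace (RtoC (-1)) with (- RtoC 1)%C by (rewrite <- RtoC_opp; f_equal; cring). cring. }
  apply Cdiffable_mult; trivial. apply Cdiffable_const.
Qed.

Lemma Cdiffable_minus (f g : C -> C) (z : C) :
  Cdiffable f z -> Cdiffable g z -> Cdiffable (fun y => f y - g y)%C z.
Proof. intros Hf Hg. apply Cdiffable_plus; trivial. now apply Cdiffable_opp. Qed.

Lemma Cdiffable_comp (f g : C -> C) (z : C) :
  Cdiffable f (g z) -> Cdiffable g z -> Cdiffable (fun y => f (g y)) z.
Proof.
  intros [p [Hp Hf]] Dg. assert (Cg := Cdiffable_continuous _ _ Dg).
  destruct Dg as [q [Hq Hg]]. exists (fun y => p (g y) * q y)%C. split.
  - apply Ccontinuous_mult; trivial. now apply Ccontinuous_comp.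
  - apply locally_Cmod in Hf. destruct Hf as [d [Hd Hf]].
    generalize (filter_and _ _ (Cg d Hd) Hg). apply filter_imp.
    intros y [H1 H2]. rewrite (Hf _ H1). replace (g y - g z)%C with (q y * (y - z))%C. cring.
    rewrite H2. cring.
Qed.

Lemma Cdiffable_inv (f : C -> C) (z : C) :
  f z <> RtoC 0 -> Cdiffable f z -> Cdiffable (fun y => / f y)%C z.
Proof.
  intros Hz Df. assert (Cf := Cdiffable_continuous _ _ Df).
  destruct Df as [p [Hp Hf]]. exists (fun y => - p y / (f y * f z))%C. split.
  - apply Ccontinuous_div.
    + intros E. apply (Cmult_neq_0 (f z) (f z)); trivial.
    + now apply Ccontinuous_opp.
    + apply Ccontinuous_mult; trivial. apply Ccontinuous_const.
  - assert (Hn := Hz). apply Cmod_gt_0 in Hn.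
    generalize (filter_and _ _ (Cf _ Hn) Hf). apply filter_imp. intros y [H1 H2].
    assert (Hy : f y <> RtoC 0).
    { intros E. rewrite E in H1. replace (0 - f z)%C with (- f z)%C in H1 by cring.
      rewrite Cmod_opp in H1. lra. }
    replace (- p y / (f y * f z) * (y - z))%C with (- (p y * (y - z)) / (f y * f z))%C
      by (field; split; trivial).
    replace (p y * (y - z))%C with (f y - f z)%C by (rewrite H2; cring).
    field; split; trivial.
Qed.

Lemma Cdiffable_div (f g : C -> C) (z : C) :
  g z <> RtoC 0 -> Cdiffable f z -> Cdiffable g z -> Cdiffable (fun y => f y / g y)%C z.
Proof. intros H Hf Hg. apply Cdiffable_mult; trivial. now apply Cdiffable_inv. Qed.

Lemma Cdiffable_pow (f : C -> C) (n : nat) (z : C) :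
  Cdiffable f z -> Cdiffable (fun y => f y ^ n)%C z.
Proof. intros Hf. induction n; simpl. apply Cdiffable_const. now apply Cdiffable_mult. Qed.

Lemma Cdiffable_sum (f : nat -> C -> C) (n : nat) (z : C) :
  (forall k, Cdiffable (f k) z) ->
  Cdiffable (fun y => Csum (fun k => f k y) n) z.
Proof.
  intros Hf. induction n.
  - apply Cdiffable_ext with (2 := Hf O). intros y. now rewrite Csum_O.
  - apply Cdiffable_ext with (2 := Cdiffable_plus _ _ _ IHn (Hf (S n))).
    intros y. now rewrite Csum_S.
Qed.

Create HintDb smooth.

(** Follows the arithmetic structure of the term only. Leaves and nonvanishing denominators go to
    the hint base and the local context; what these do not settle is returned to the caller. *)
Ltac smooth_step := lazymatch goal with
  | |- Ccontinuous_on _ _ _ => intros ? ?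
  | |- Ccontinuous (fun _ => ?c) _ => apply Ccontinuous_const
  | |- Ccontinuous (fun y => y) _ => apply Ccontinuous_id
  | |- Ccontinuous (fun y => Cplus (@?f y) (@?g y)) _ => apply (Ccontinuous_plus f g)
  | |- Ccontinuous (fun y => Cminus (@?f y) (@?g y)) _ => apply (Ccontinuous_minus f g)
  | |- Ccontinuous (fun y => Cmult (@?f y) (@?g y)) _ => apply (Ccontinuous_mult f g)
  | |- Ccontinuous (fun y => Cdiv (@?f y) (@?g y)) _ => apply (Ccontinuous_div f g)
  | |- Ccontinuous (fun y => Copp (@?f y)) _ => apply (Ccontinuous_opp f)
  | |- Ccontinuous (fun y => Cinv (@?f y)) _ => apply (Ccontinuous_inv f)
  | |- Ccontinuous (fun y => Cpow (@?f y) ?n) _ => apply (Ccontinuous_pow f n)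
  | |- Ccontinuous (fun y => Cconj (@?f y)) _ => apply (Ccontinuous_conj f)
  | |- Cdiffable (fun _ => ?c) _ => apply Cdiffable_const
  | |- Cdiffable (fun y => y) _ => apply Cdiffable_id
  | |- Cdiffable (fun y => Cplus (@?f y) (@?g y)) _ => apply (Cdiffable_plus f g)
  | |- Cdiffable (fun y => Cminus (@?f y) (@?g y)) _ => apply (Cdiffable_minus f g)
  | |- Cdiffable (fun y => Cmult (@?f y) (@?g y)) _ => apply (Cdiffable_mult f g)
  | |- Cdiffable (fun y => Cdiv (@?f y) (@?g y)) _ => apply (Cdiffable_div f g)
  | |- Cdiffable (fun y => Copp (@?f y)) _ => apply (Cdiffable_opp f)
  | |- Cdiffable (fun y => Cinv (@?f y)) _ => apply (Cdiffable_inv f)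
  | |- Cdiffable (fun y => Cpow (@?f y) ?n) _ => apply (Cdiffable_pow f n)
  | |- _ => solve [auto with smooth]
  end.

Ltac smooth := repeat smooth_step.

(** * Complex integrals and the exponential *)

Definition CInt (f : R -> C) (a b : R) : C := RInt (V := C_R_CompleteNormedModule) f a b.

Section ComplexIntegral.
Context (a b : R) (Hab : a <= b).
Implicit Types f g : R -> C.

Lemma Ccontinuous_on_ex_RInt f : Ccontinuous_on f a b ->
  ex_RInt (V := C_R_NormedModule) f a b.
Proof.
  intros Hf. apply (ex_RInt_continuous (V := C_R_CompleteNormedModule)).
  intros t. rewrite Rmin_left, Rmax_right by trivial. intros Ht.
  now apply Ccontinuous_continuous, Hf.
Qed.

Lemma is_RInt_CInt f : Ccontinuous_on f a b ->
  is_RInt (V := C_R_NormedModule) f a b (CInt f a b).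
Proof.
  intros Hf. apply (RInt_correct (V := C_R_CompleteNormedModule)).
  now apply Ccontinuous_on_ex_RInt.
Qed.

Lemma CInt_unique f l : is_RInt (V := C_R_NormedModule) f a b l -> CInt f a b = l.
Proof. apply (is_RInt_unique (V := C_R_CompleteNormedModule)). Qed.

Lemma CInt_ext f g : (forall t, a <= t <= b -> f t = g t) -> CInt f a b = CInt g a b.
Proof.
  intros E. apply (RInt_ext (V := C_R_CompleteNormedModule)). intros t. rewrite Rmin_left, Rmax_right by trivial.
  intros Ht. apply E. lra.
Qed.

Lemma CInt_plus f g : Ccontinuous_on f a b -> Ccontinuous_on g a b ->
  CInt (fun t => f t + g t)%C a b = (CInt f a b + CInt g a b)%C.
Proof.
  intros Hf Hg. apply CInt_unique.
  apply (is_RInt_plus (V := C_R_NormedModule)); now apply is_RInt_CInt.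
Qed.

(** A complex factor is not a scalar of the real module [C_R_NormedModule], so real and imaginary
    parts are integrated separately. *)
Lemma is_RInt_Cscal f l (c : C) : is_RInt (V := C_R_NormedModule) f a b l ->
  is_RInt (V := C_R_NormedModule) (fun t => c * f t)%C a b (c * l)%C.
Proof.
  intros H.
  assert (H1 := is_RInt_fct_extend_fst (U := R_NormedModule) (V := R_NormedModule) _ _ _ _ H).
  assert (H2 := is_RInt_fct_extend_snd (U := R_NormedModule) (V := R_NormedModule) _ _ _ _ H).
  apply (is_RInt_fct_extend_pair (U := R_NormedModule) (V := R_NormedModule)
    (fun t => c * f t)%C a b (fst c * fst l - snd c * snd l) (fst c * snd l + snd c * fst l)).
  - apply (is_RInt_minus (V := R_NormedModule)); now apply (is_RInt_scal (V := R_NormedModule)).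
  - apply (is_RInt_plus (V := R_NormedModule)); now apply (is_RInt_scal (V := R_NormedModule)).
Qed.

Lemma CInt_scal f (c : C) : Ccontinuous_on f a b ->
  CInt (fun t => c * f t)%C a b = (c * CInt f a b)%C.
Proof. intros Hf. apply CInt_unique, is_RInt_Cscal. now apply is_RInt_CInt. Qed.

Lemma CInt_minus f g : Ccontinuous_on f a b -> Ccontinuous_on g a b ->
  CInt (fun t => f t - g t)%C a b = (CInt f a b - CInt g a b)%C.
Proof.
  intros Hf Hg. apply CInt_unique.
  apply (is_RInt_minus (V := C_R_NormedModule)); now apply is_RInt_CInt.
Qed.

Lemma CInt_const (c : C) : CInt (fun _ => c) a b = (RtoC (b - a) * c)%C.
Proof.
  apply CInt_unique.
  replace (RtoC (b - a) * c)%C with (scal (V := C_R_NormedModule) (b - a) c).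
  apply is_RInt_const.
  apply injective_projections; simpl; unfold scal; simpl; unfold mult; simpl; ring.
Qed.

Lemma CInt_conj f : Ccontinuous_on f a b ->
  CInt (fun t => Cconj (f t)) a b = Cconj (CInt f a b).
Proof.
  intros Hf. apply CInt_unique. assert (H := is_RInt_CInt f Hf).
  assert (H1 := is_RInt_fct_extend_fst (U := R_NormedModule) (V := R_NormedModule) _ _ _ _ H).
  assert (H2 := is_RInt_fct_extend_snd (U := R_NormedModule) (V := R_NormedModule) _ _ _ _ H).
  apply (is_RInt_fct_extend_pair (U := R_NormedModule) (V := R_NormedModule)); simpl.
  exact H1. now apply (is_RInt_opp (V := R_NormedModule)).
Qed.

Lemma CInt_RtoC (f : R -> R) : ex_RInt f a b ->
  CInt (fun t => RtoC (f t)) a b = RtoC (RInt f a b).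
Proof.
  intros Hf. apply CInt_unique.
  apply (is_RInt_fct_extend_pair (U := R_NormedModule) (V := R_NormedModule)); simpl.
  now apply (RInt_correct f).
  assert (K := is_RInt_const (V := R_NormedModule) a b 0).
  unfold scal in K; simpl in K; unfold mult in K; simpl in K. now rewrite Rmult_0_r in K.
Qed.

Lemma ex_RInt_Cmod f : Ccontinuous_on f a b -> ex_RInt (fun t => Cmod (f t)) a b.
Proof.
  intros Hf. apply (ex_RInt_continuous (V := R_CompleteNormedModule)).
  intros t. rewrite Rmin_left, Rmax_right by trivial. intros Ht.
  exact (Ccontinuous_Re _ _ (Ccontinuous_mod _ _ (Hf t Ht))).
Qed.

Lemma Cmod_CInt_le f : Ccontinuous_on f a b ->
  Cmod (CInt f a b) <= RInt (fun t => Cmod (f t)) a b.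
Proof.
  intros Hf.
  assert (K := norm_RInt_le (V := C_R_NormedModule) f (fun t => Cmod (f t)) a b
    (CInt f a b) (RInt (fun t => Cmod (f t)) a b) Hab).
  rewrite Cmod_norm. apply K.
  - intros t _. rewrite Cmod_norm. apply Rle_refl.
  - now apply is_RInt_CInt.
  - apply (RInt_correct (fun t => Cmod (f t))). now apply ex_RInt_Cmod.
Qed.

Lemma Cmod_CInt_le_const f (M : R) : Ccontinuous_on f a b ->
  (forall t, a <= t <= b -> Cmod (f t) <= M) -> Cmod (CInt f a b) <= M * (b - a).
Proof.
  intros Hf HM. apply Rle_trans with (1 := Cmod_CInt_le f Hf).
  rewrite Rmult_comm.
  apply Rle_trans with (RInt (fun _ => M) a b).
  - apply RInt_le; trivial. now apply ex_RInt_Cmod. apply ex_RInt_const.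
    intros t Ht. apply HM. lra.
  - rewrite RInt_const. apply Rle_refl.
Qed.

Lemma CInt_sum (f : nat -> R -> C) (n : nat) : (forall k, Ccontinuous_on (f k) a b) ->
  CInt (fun t => Csum (fun k => f k t) n) a b
  = Csum (fun k => CInt (f k) a b) n.
Proof.
  intros Hf. induction n.
  - rewrite Csum_O. apply CInt_ext. intros t _. now rewrite Csum_O.
  - rewrite Csum_S, <- IHn.
    rewrite (CInt_ext _ (fun t => Csum (fun k => f k t) n + f (S n) t)%C).
    2: { intros t _. now rewrite Csum_S. }
    apply CInt_plus; trivial. intros t Ht. apply Ccontinuous_sum. intros k. now apply Hf.
Qed.

End ComplexIntegral.

Lemma CInt_Chasles (f : R -> C) (a b c : R) : a <= b <= c -> Ccontinuous_on f a c ->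
  (CInt f a b + CInt f b c)%C = CInt f a c.
Proof.
  intros Hb Hf.
  apply (RInt_Chasles (V := C_R_CompleteNormedModule)); apply Ccontinuous_on_ex_RInt; try lra;
    intros t Ht; apply Hf; lra.
Qed.

(** * The unit circle and the complex exponential *)

Lemma cis_add (s t : R) : cis (s + t) = (cis s * cis t)%C.
Proof. apply injective_projections; simpl. apply cos_plus. rewrite sin_plus. ring. Qed.

Lemma cis_0 : cis 0 = RtoC 1.
Proof. unfold cis. now rewrite cos_0, sin_0. Qed.

Lemma Cmod_cis (t : R) : Cmod (cis t) = 1.
Proof.
  unfold Cmod, cis; simpl fst; simpl snd. rewrite <- sqrt_1. f_equal.
  generalize (sin2_cos2 t). unfold Rsqr. simpl. lra.
Qed.

Lemma cis_neq_0 (t : R) : cis t <> RtoC 0.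
Proof. apply Cmod_gt_0. rewrite Cmod_cis. lra. Qed.

Lemma cis_opp (t : R) : cis (- t) = (/ cis t)%C.
Proof.
  assert (E : (cis t * cis (- t))%C = RtoC 1).
  { rewrite <- cis_add, Rplus_opp_r. apply cis_0. }
  replace (/ cis t)%C with (/ cis t * (cis t * cis (- t)))%C by (rewrite E; ring).
  field. apply cis_neq_0.
Qed.

Lemma Cconj_cis (t : R) : Cconj (cis t) = cis (- t).
Proof. unfold cis, Cconj. simpl. now rewrite cos_neg, sin_neg. Qed.

Lemma cis_pow (t : R) (n : nat) : (cis t ^ n)%C = cis (INR n * t).
Proof.
  induction n.
  - simpl. now rewrite Rmult_0_l, cis_0.
  - rewrite Cpow_S, IHn, S_INR, <- cis_add. f_equal. ring.
Qed.

Lemma cis_2PI (t : R) : cis (t + 2 * PI) = cis t.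
Proof. unfold cis. now rewrite cos_plus, sin_plus, cos_2PI, sin_2PI, !Rmult_0_r, !Rmult_1_r, Rminus_0_r, Rplus_0_r. Qed.

Lemma Ccontinuous_cis (t : R) : Ccontinuous (T := R_UniformSpace) cis t.
Proof.
  apply continuous_pair_Ccontinuous.
  - apply continuity_pt_filterlim, continuity_cos.
  - apply continuity_pt_filterlim, continuity_sin.
Qed.

#[global] Hint Resolve Ccontinuous_cis Ccontinuous_id : smooth.

(** [acos] serves the upper half plane and its opposite the lower one. The angle is confined to a
    compact interval so that circles can be treated by compactness on the real line. *)
Lemma polar (z : C) : exists t, - PI <= t <= PI /\ z = (RtoC (Cmod z) * cis t)%C.
Proof.
  destruct (Ceq_dec z 0) as [->|Hz].
  { exists 0. split. generalize PI_RGT_0; lra. rewrite Cmod_0. ring. }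
  assert (Hm := proj1 (Cmod_gt_0 z) Hz). set (m := Cmod z) in *.
  assert (E : (Re z / m) * (Re z / m) + (Im z / m) * (Im z / m) = 1).
  { assert (K := Cmod2_alt z). fold m in K. apply Rmult_eq_reg_r with (m ^ 2).
    2: apply pow_nonzero; lra. rewrite K at 2. field. lra. }
  set (x := Re z / m) in *. set (y := Im z / m) in *.
  assert (Hx : -1 <= x <= 1) by nra.
  assert (Hs : forall s, cos s = x -> sin s = y -> z = (RtoC m * cis s)%C).
  { intros s Hc Hs. apply injective_projections; simpl.
    - rewrite Hc. unfold x, Re. field. lra.
    - rewrite Hs. unfold y, Im. field. lra. }
  destruct (Rle_dec 0 y) as [Hy|Hy].
  - exists (acos x). split. generalize (acos_bound x) PI_RGT_0; lra. apply Hs. apply cos_acos; trivial.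
    rewrite sin_acos by trivial. rewrite <- (sqrt_Rsqr y) by trivial. f_equal. unfold Rsqr. lra.
  - exists (- acos x). split. generalize (acos_bound x) PI_RGT_0; lra. apply Hs. rewrite cos_neg. apply cos_acos; trivial.
    rewrite sin_neg, sin_acos by trivial. rewrite <- (Ropp_involutive y). f_equal.
    rewrite <- (sqrt_Rsqr (- y)) by lra. f_equal. unfold Rsqr. lra.
Qed.

Lemma Cexp_add (x y : C) : Cexp (x + y) = (Cexp x * Cexp y)%C.
Proof.
  unfold Cexp. change (Re (x + y)) with (Re x + Re y). change (Im (x + y)) with (Im x + Im y).
  rewrite exp_plus, cis_add, RtoC_mult. ring.
Qed.

Lemma Cexp_RtoC (x : R) : Cexp (RtoC x) = RtoC (exp x).
Proof. unfold Cexp. change (Im (RtoC x)) with 0. rewrite cis_0. change (Re (RtoC x)) with x. ring. Qed.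

Lemma Cexp_0 : Cexp (RtoC 0) = RtoC 1.
Proof. now rewrite Cexp_RtoC, exp_0. Qed.

Lemma Cmod_Cexp (z : C) : Cmod (Cexp z) = exp (Re z).
Proof.
  unfold Cexp. rewrite Cmod_mult, Cmod_cis, Cmod_R, Rabs_pos_eq. ring.
  apply Rlt_le, exp_pos.
Qed.

Lemma Cexp_neq_0 (z : C) : Cexp z <> RtoC 0.
Proof. apply Cmod_gt_0. rewrite Cmod_Cexp. apply exp_pos. Qed.

Lemma derive_0_bound (f : R -> R) (l : R) : is_derive f 0 l ->
  forall eps, 0 < eps -> exists d, 0 < d /\
    forall x, Rabs x < d -> Rabs (f x - f 0 - l * x) <= eps * Rabs x.
Proof.
  intros [_ H] eps He.
  destruct (H 0 (fun P HP => HP) (mkposreal _ He)) as [d Hd].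
  exists d. split; [apply cond_pos|]. intros x Hx.
  assert (K := Hd x). unfold norm, minus, plus, opp, scal, ball in K; simpl in K.
  unfold AbsRing_ball, mult, minus, plus, opp, abs in K; simpl in K.
  replace (f x - f 0 - l * x) with (f x + - f 0 + - ((x + - 0) * l)) by ring.
  replace x with (x + - 0) at 3 by ring. apply K.
  now replace (x + - 0) with x by ring.
Qed.

Lemma Cexp_remainder (eps : R) : 0 < eps -> exists d, 0 < d /\
  forall h, Cmod h < d -> Cmod (Cexp h - 1 - h) <= eps * Cmod h.
Proof.
  intros He.
  (* The estimates below add up to [6 * e * Cmod h], which [eps / 8] accommodates; [e <= 1] keeps
     [|1 + x|] at most 2. *)
  set (e := Rmin 1 (eps / 8)).
  assert (He0 : 0 < e) by (apply Rmin_glb_lt; lra).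
  assert (He1 : e <= 1) by apply Rmin_l.
  assert (He8 : e <= eps / 8) by apply Rmin_r.
  destruct (derive_0_bound exp 1) with (eps := e) as [d1 [Hd1 K1]]; trivial.
  { apply is_derive_Reals. rewrite <- exp_0. apply derivable_pt_lim_exp. }
  destruct (derive_0_bound cos 0) with (eps := e) as [d2 [Hd2 K2]]; trivial.
  { apply is_derive_Reals. generalize (derivable_pt_lim_cos 0). now rewrite sin_0, Ropp_0. }
  destruct (derive_0_bound sin 1) with (eps := e) as [d3 [Hd3 K3]]; trivial.
  { apply is_derive_Reals. rewrite <- cos_0. apply derivable_pt_lim_sin. }
  set (d := Rmin (Rmin d1 e) (Rmin d2 d3)).
  assert (Hd : 0 < d) by (repeat apply Rmin_glb_lt; lra).
  exists d. split; trivial. intros h Hh.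
  assert (L1 : d <= d1) by (eapply Rle_trans; apply Rmin_l).
  assert (L4 : d <= e) by (eapply Rle_trans; [apply Rmin_l|apply Rmin_r]).
  assert (L2 : d <= d2) by (eapply Rle_trans; [apply Rmin_r|apply Rmin_l]).
  assert (L3 : d <= d3) by (eapply Rle_trans; [apply Rmin_r|apply Rmin_r]).
  assert (Hx := re_le_Cmod h). assert (Hy := Cmod_im_le h).
  specialize (K1 (Re h)). specialize (K2 (Im h)). specialize (K3 (Im h)).
  rewrite exp_0 in K1. rewrite cos_0 in K2. rewrite sin_0 in K3.
  assert (M1 := K1 ltac:(lra)). assert (M2 := K2 ltac:(lra)). assert (M3 := K3 ltac:(lra)).
  set (m := Cmod h) in *.
  assert (Hm : 0 <= m) by apply Cmod_ge_0.
  set (x := Re h) in *. set (y := Im h) in *.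
  set (E := exp x - 1 - 1 * x) in *. set (G := cos y - 1 - 0 * y) in *.
  set (S := sin y - 0 - 1 * y) in *.
  assert (e * Rabs x <= e * m) by (apply Rmult_le_compat_l; lra).
  assert (e * Rabs y <= e * m) by (apply Rmult_le_compat_l; lra).
  (* Every term of this exact identity carries one of the three real remainders or the second-order
     product [x * y]. *)
  assert (Q : (Cexp h - 1 - h)%C = (RtoC E * cis y + RtoC (1 + x) * (RtoC G + Ci * RtoC S) + Ci * RtoC (x * y))%C).
  { unfold Cexp. apply injective_projections; simpl; fold x y; unfold E, G, S.
    - change (fst h) with x. change (snd h) with y. ring.
    - change (fst h) with x. change (snd h) with y. ring. }
  rewrite Q. eapply Rle_trans; [apply Cmod_triangle|].
  eapply Rle_trans; [apply Rplus_le_compat_r, Cmod_triangle|].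
  rewrite !Cmod_mult, !Cmod_R, Cmod_cis, Cmod_Ci.
  assert (N1 : Cmod (RtoC G + Ci * RtoC S) <= 2 * (e * m)).
  { eapply Rle_trans; [apply Cmod_triangle|]. rewrite Cmod_mult, !Cmod_R, Cmod_Ci. lra. }
  assert (N2 : Rabs (1 + x) <= 2).
  { eapply Rle_trans; [apply Rabs_triang|]. rewrite Rabs_R1. lra. }
  assert (N3 : Rabs (x * y) <= e * m).
  { rewrite Rabs_mult. apply Rmult_le_compat; try apply Rabs_pos; lra. }
  assert (N4 : Rabs (1 + x) * Cmod (RtoC G + Ci * RtoC S) <= 2 * (2 * (e * m))).
  { apply Rmult_le_compat; trivial. apply Rabs_pos. apply Cmod_ge_0. }
  assert (e * m <= eps / 8 * m) by (apply Rmult_le_compat_r; lra).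
  assert (0 <= eps * m) by (apply Rmult_le_pos; lra).
  lra.
Qed.

Lemma Cdiffable_Cexp (z : C) : Cdiffable Cexp z.
Proof.
  exists (fun y => if Ceq_dec y z then Cexp z else ((Cexp y - Cexp z) / (y - z))%C).
  split.
  - intros eps He.
    assert (He' : 0 < eps / (2 * exp (Re z))).
    { apply Rdiv_lt_0_compat; trivial. generalize (exp_pos (Re z)). lra. }
    destruct (Cexp_remainder _ He') as [d [Hd K]].
    apply locally_Cmod_intro with d; trivial. intros y Hy.
    destruct (Ceq_dec z z) as [_|E]; [|now elim E].
    destruct (Ceq_dec y z) as [E|E].
    + replace (Cexp z - Cexp z)%C with (RtoC 0) by ring. now rewrite Cmod_0.
    + assert (Hn : (y - z)%C <> RtoC 0).
      { intros E'. apply E. replace y with ((y - z) + z)%C by ring. rewrite E'. ring. }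
      specialize (K _ Hy). set (h := (y - z)%C) in *.
      replace y with (z + h)%C by (unfold h; ring).
      rewrite Cexp_add.
      replace ((Cexp z * Cexp h - Cexp z) / h - Cexp z)%C with (Cexp z * (Cexp h - 1 - h) / h)%C
        by (field; trivial).
      rewrite Cmod_div, Cmod_mult, Cmod_Cexp by trivial.
      apply Cmod_gt_0 in Hn.
      apply Rle_lt_trans with (eps / 2); [|lra].
      apply Rmult_le_reg_r with (Cmod h); trivial.
      unfold Rdiv at 1. rewrite Rmult_assoc, Rinv_l, Rmult_1_r by lra.
      replace (eps / 2 * Cmod h) with (exp (Re z) * (eps / (2 * exp (Re z)) * Cmod h)).
      apply Rmult_le_compat_l; trivial. apply Rlt_le, exp_pos.
      field. apply Rgt_not_eq, exp_pos.
  - refine (filter_forall _ (fun y : C => _)).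
    destruct (Ceq_dec y z) as [E|E].
    + rewrite E. ring.
    + field. intros E'. apply E. replace y with ((y - z) + z)%C by ring. rewrite E'. ring.
Qed.

#[global] Hint Resolve Cdiffable_Cexp : smooth.

(** * Goursat's theorem and the mean value property *)

Lemma exp_le_compat (x y : R) : x <= y -> exp x <= exp y.
Proof. intros [H| ->]. now apply Rlt_le, exp_increasing. apply Rle_refl. Qed.

Lemma geometric_small (M q eps : R) : 0 < q < 1 -> 0 < eps ->
  exists N : nat, forall n, (N <= n)%nat -> M * q ^ n < eps.
Proof.
  intros Hq He.
  destruct (pow_lt_1_zero q) with (y := eps / (Rabs M + 1)) as [N HN].
  - rewrite Rabs_pos_eq; lra.
  - apply Rdiv_lt_0_compat; trivial. generalize (Rabs_pos M). lra.
  - exists N. intros n Hn. specialize (HN n Hn).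
    assert (Hp : 0 < q ^ n) by (apply pow_lt; lra).
    rewrite Rabs_pos_eq in HN by lra.
    assert (HM := Rabs_pos M). assert (HM' := Rle_abs M).
    apply Rle_lt_trans with ((Rabs M + 1) * q ^ n). apply Rmult_le_compat_r; lra.
    apply Rmult_lt_compat_l with (r := Rabs M + 1) in HN; [|lra].
    replace ((Rabs M + 1) * (eps / (Rabs M + 1))) with eps in HN by (field; lra). exact HN.
Qed.

Lemma nested_segments_point (a b : nat -> R) :
  (forall n, a n <= a (S n)) -> (forall n, b (S n) <= b n) -> (forall n, a n <= b n) ->
  exists x, forall n, a n <= x <= b n.
Proof.
  intros Ha Hb Hab.
  assert (Ma : forall n k, a n <= a (k + n)%nat).
  { intros n k. induction k; simpl. lra. generalize (Ha (k + n)%nat). lra. }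
  assert (Mb : forall n k, b (k + n)%nat <= b n).
  { intros n k. induction k; simpl. lra. generalize (Hb (k + n)%nat). lra. }
  assert (Hmn : forall m n, a m <= b n).
  { intros m n. generalize (Ma m n) (Mb n m) (Hab (n + m)%nat).
    rewrite (Nat.add_comm m n). lra. }
  destruct (completeness (fun x => exists n, x = a n)) as [x [Hx1 Hx2]].
  - exists (b O). intros y [n ->]. apply Hmn.
  - exists (a O). now exists O.
  - exists x. intros n. split.
    + apply Hx1. now exists n.
    + apply Hx2. intros y [m ->]. apply Hmn.
Qed.

Section Bisection.
Context (P : R -> R -> R -> R -> Prop) (a0 b0 c0 d0 : R).
Context (Hsplit : forall a b c d, a0 <= a <= b -> b <= b0 -> c0 <= c <= d -> d <= d0 ->
  P a ((a + b) / 2) c ((c + d) / 2) -> P ((a + b) / 2) b c ((c + d) / 2) ->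
  P a ((a + b) / 2) ((c + d) / 2) d -> P ((a + b) / 2) b ((c + d) / 2) d -> P a b c d).
Context (Hlocal : forall x y, a0 <= x <= b0 -> c0 <= y <= d0 ->
  exists delta, 0 < delta /\ forall a b c d, a0 <= a <= x -> x <= b <= b0 ->
    c0 <= c <= y -> y <= d <= d0 -> (b - a) + (d - c) < delta -> P a b c d).

Let step (q : (R * R) * (R * R)) : (R * R) * (R * R) :=
  let '((a, b), (c, d)) := q in
  let m := (a + b) / 2 in let k := (c + d) / 2 in
  if excluded_middle_informative (~ P a m c k) then ((a, m), (c, k)) else
  if excluded_middle_informative (~ P m b c k) then ((m, b), (c, k)) else
  if excluded_middle_informative (~ P a m k d) then ((a, m), (k, d)) else
  ((m, b), (k, d)).

Let q (n : nat) := Nat.iter n step ((a0, b0), (c0, d0)).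

(** If [P] fails on a rectangle, [Hsplit] yields a quarter on which it fails; [step] picks such a
    quarter, the last one by default. The nested quarters shrink to a point, around which [Hlocal]
    contradicts the failure. *)
Lemma bisection_principle : a0 <= b0 -> c0 <= d0 -> P a0 b0 c0 d0.
Proof.
  intros Hab Hcd. apply NNPP. intros HnP.
  set (a n := fst (fst (q n))). set (b n := snd (fst (q n))).
  set (c n := fst (snd (q n))). set (d n := snd (snd (q n))).
  assert (Inv : forall n, a0 <= a n <= b n /\ b n <= b0 /\ c0 <= c n <= d n /\ d n <= d0 /\
     ~ P (a n) (b n) (c n) (d n) /\
     b n - a n = (b0 - a0) * (/ 2) ^ n /\ d n - c n = (d0 - c0) * (/ 2) ^ n).
  { induction n.
    - unfold a, b, c, d, q; simpl. repeat split; trivial; lra.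
    - destruct IHn as (I1 & I2 & I3 & I4 & I5 & I6 & I7).
      generalize (Hsplit (a n) (b n) (c n) (d n)).
      revert I1 I2 I3 I4 I5 I6 I7. unfold a, b, c, d. simpl.
      destruct (q n) as [[an bn] [cn dn]]. simpl.
      intros I1 I2 I3 I4 I5 I6 I7 HS.
      unfold step.
      destruct (excluded_middle_informative _) as [E1|E1];
      [|destruct (excluded_middle_informative _) as [E2|E2];
      [|destruct (excluded_middle_informative _) as [E3|E3]]]; simpl;
      repeat split; trivial; try lra.
      apply NNPP in E1. apply NNPP in E2. apply NNPP in E3.
      intros E4. apply I5, HS; trivial. }
  assert (Mon : forall n, a n <= a (S n) /\ b (S n) <= b n /\ c n <= c (S n) /\ d (S n) <= d n).
  { intros n. destruct (Inv n) as (I1 & I2 & I3 & I4 & I5 & I6 & I7).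
    revert I1 I2 I3 I4. unfold a, b, c, d. simpl.
    destruct (q n) as [[an bn] [cn dn]]. simpl. intros.
    unfold step.
    destruct (excluded_middle_informative _) as [E1|E1];
    [|destruct (excluded_middle_informative _) as [E2|E2];
    [|destruct (excluded_middle_informative _) as [E3|E3]]]; simpl; lra. }
  destruct (nested_segments_point a b) as [x Hx]; try (intros n; apply Mon || apply Inv).
  destruct (nested_segments_point c d) as [y Hy]; try (intros n; apply Mon || apply Inv).
  destruct (Hlocal x y) as [delta [Hd HP]].
  { apply (Hx O). } { apply (Hy O). }
  destruct (geometric_small ((b0 - a0) + (d0 - c0)) (/ 2) delta ltac:(lra) Hd) as [n Hn].
  specialize (Hn n (le_n n)).
  destruct (Inv n) as (I1 & I2 & I3 & I4 & I5 & I6 & I7).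
  specialize (Hx n). specialize (Hy n).
  apply I5, HP; lra.
Qed.

End Bisection.

(** The counterclockwise contour integral of [g z dz]; on vertical sides [dz = i dy]. *)
Definition boundary_integral (g : C -> C) (a b c d : R) : C :=
  (CInt (fun x => g (x, c)) a b - CInt (fun x => g (x, d)) a b
   + Ci * (CInt (fun y => g (b, y)) c d - CInt (fun y => g (a, y)) c d))%C.

Lemma Ccontinuous_horizontal (g : C -> C) (x y : R) :
  Ccontinuous (T := C_UniformSpace) g (x, y) ->
  Ccontinuous (T := R_UniformSpace) (fun t => g (t, y)) x.
Proof.
  intros Hg. apply (Ccontinuous_comp g (fun t : R => (t, y) : C)); trivial.
  apply continuous_pair_Ccontinuous. apply continuous_id. apply continuous_const.
Qed.

Lemma Ccontinuous_vertical (g : C -> C) (x y : R) :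
  Ccontinuous (T := C_UniformSpace) g (x, y) ->
  Ccontinuous (T := R_UniformSpace) (fun t => g (x, t)) y.
Proof.
  intros Hg. apply (Ccontinuous_comp g (fun t : R => (x, t) : C)); trivial.
  apply continuous_pair_Ccontinuous. apply continuous_const. apply continuous_id.
Qed.

Definition Ccontinuous_rect (g : C -> C) (a b c d : R) : Prop :=
  forall x y, a <= x <= b -> c <= y <= d -> Ccontinuous (T := C_UniformSpace) g (x, y).

Lemma boundary_integral_ext (f g : C -> C) (a b c d : R) : a <= b -> c <= d ->
  (forall z, f z = g z) -> boundary_integral f a b c d = boundary_integral g a b c d.
Proof.
  intros Hab Hcd E. unfold boundary_integral.
  rewrite (CInt_ext _ _ Hab (fun x => f (x, c)) (fun x => g (x, c)) (fun x _ => E _)).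
  rewrite (CInt_ext _ _ Hab (fun x => f (x, d)) (fun x => g (x, d)) (fun x _ => E _)).
  rewrite (CInt_ext _ _ Hcd (fun y => f (a, y)) (fun y => g (a, y)) (fun y _ => E _)).
  rewrite (CInt_ext _ _ Hcd (fun y => f (b, y)) (fun y => g (b, y)) (fun y _ => E _)).
  reflexivity.
Qed.

Lemma boundary_integral_plus (f g : C -> C) (a b c d : R) : a <= b -> c <= d ->
  Ccontinuous_rect f a b c d -> Ccontinuous_rect g a b c d ->
  boundary_integral (fun z => f z + g z)%C a b c d
  = (boundary_integral f a b c d + boundary_integral g a b c d)%C.
Proof.
  intros Hab Hcd Hf Hg. unfold boundary_integral.
  rewrite !(CInt_plus _ _ Hab), !(CInt_plus _ _ Hcd); try ring;
    intros t Ht; (apply Ccontinuous_horizontal || apply Ccontinuous_vertical);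
    (apply Hf || apply Hg); lra.
Qed.

(** Each inner side is traversed twice, in opposite directions. *)
Lemma boundary_integral_split (g : C -> C) (a m b c k d : R) : a <= m <= b -> c <= k <= d ->
  Ccontinuous_rect g a b c d ->
  boundary_integral g a b c d
  = (boundary_integral g a m c k + boundary_integral g m b c k
     + (boundary_integral g a m k d + boundary_integral g m b k d))%C.
Proof.
  intros Hm Hk Hg. unfold boundary_integral.
  assert (Kh : forall y, c <= y <= d -> Ccontinuous_on (fun x => g (x, y)) a b).
  { intros y Hy t Ht. now apply Ccontinuous_horizontal, Hg. }
  assert (Kv : forall x, a <= x <= b -> Ccontinuous_on (fun y => g (x, y)) c d).
  { intros x Hx t Ht. now apply Ccontinuous_vertical, Hg. }
  rewrite <- (CInt_Chasles _ a m b Hm (Kh c ltac:(lra))).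
  rewrite <- (CInt_Chasles _ a m b Hm (Kh d ltac:(lra))).
  rewrite <- (CInt_Chasles _ c k d Hk (Kv a ltac:(lra))).
  rewrite <- (CInt_Chasles _ c k d Hk (Kv b ltac:(lra))).
  ring.
Qed.

Lemma Cmod_boundary_integral (g : C -> C) (a b c d M : R) : a <= b -> c <= d ->
  Ccontinuous_rect g a b c d ->
  (forall x y, a <= x <= b -> c <= y <= d -> Cmod (g (x, y)) <= M) ->
  Cmod (boundary_integral g a b c d) <= M * (2 * ((b - a) + (d - c))).
Proof.
  intros Hab Hcd Hg HM. unfold boundary_integral.
  assert (Kh : forall y, c <= y <= d -> Cmod (CInt (fun x => g (x, y)) a b) <= M * (b - a)).
  { intros y Hy. apply Cmod_CInt_le_const; trivial.
    - intros t Ht. now apply Ccontinuous_horizontal, Hg.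
    - intros t Ht. now apply HM. }
  assert (Kv : forall x, a <= x <= b -> Cmod (CInt (fun y => g (x, y)) c d) <= M * (d - c)).
  { intros x Hx. apply Cmod_CInt_le_const; trivial.
    - intros t Ht. now apply Ccontinuous_vertical, Hg.
    - intros t Ht. now apply HM. }
  eapply Rle_trans; [apply Cmod_triangle|]. rewrite Cmod_mult, Cmod_Ci.
  generalize (Cmod_sub_le (CInt (fun x => g (x, c)) a b) (CInt (fun x => g (x, d)) a b))
    (Cmod_sub_le (CInt (fun y => g (b, y)) c d) (CInt (fun y => g (a, y)) c d)).
  generalize (Kh c ltac:(lra)) (Kh d ltac:(lra)) (Kv a ltac:(lra)) (Kv b ltac:(lra)). lra.
Qed.

Lemma is_RInt_id (a b : R) : is_RInt (fun x => x) a b ((b * b - a * a) / 2).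
Proof.
  replace ((b * b - a * a) / 2) with (minus (b * b / 2) (a * a / 2)).
  2: { unfold minus, plus, opp; simpl. field. }
  apply (is_RInt_derive (fun x => x * x / 2) (fun x => x)).
  - intros x _. auto_derive; trivial. field.
  - intros x _. apply continuous_id.
Qed.

Lemma boundary_integral_affine (A B : C) (a b c d : R) : a <= b -> c <= d ->
  boundary_integral (fun z => A + B * z)%C a b c d = RtoC 0.
Proof.
  intros Hab Hcd.
  assert (Kh : forall y, CInt (fun x => A + B * (x, y))%C a b
    = (RtoC (b - a) * A + B * ((b * b - a * a) / 2, (b - a) * y)%R)%C).
  { intros y. rewrite (CInt_plus _ _ Hab (fun _ => A)), CInt_const, CInt_scal; trivial.
    - f_equal. f_equal. apply CInt_unique.
      apply (is_RInt_fct_extend_pair (U := R_NormedModule) (V := R_NormedModule)); simpl.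
      apply is_RInt_id. apply (is_RInt_const (V := R_NormedModule)).
    - intros t _. apply continuous_pair_Ccontinuous. apply continuous_id. apply continuous_const.
    - smooth.
    - smooth.
      apply continuous_pair_Ccontinuous. apply continuous_id. apply continuous_const. }
  assert (Kv : forall x, CInt (fun y => A + B * (x, y))%C c d
    = (RtoC (d - c) * A + B * ((d - c) * x, (d * d - c * c) / 2)%R)%C).
  { intros x. rewrite (CInt_plus _ _ Hcd (fun _ => A)), CInt_const, CInt_scal; trivial.
    - f_equal. f_equal. apply CInt_unique.
      apply (is_RInt_fct_extend_pair (U := R_NormedModule) (V := R_NormedModule)); simpl.
      apply (is_RInt_const (V := R_NormedModule)). apply is_RInt_id.
    - intros t _. apply continuous_pair_Ccontinuous. apply continuous_const. apply continuous_id.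
    - smooth.
    - smooth.
      apply continuous_pair_Ccontinuous. apply continuous_const. apply continuous_id. }
  unfold boundary_integral. rewrite !Kh, !Kv.
  apply injective_projections; simpl; field.
Qed.

(** The bound [eps * (half-perimeter)^2] is proved by bisection. The half-perimeter halves with the
    sides, so its square quarters and the bounds on four quarters add up to the bound on the
    whole. *)
Theorem goursat_rectangle (g : C -> C) (a b c d : R) : a <= b -> c <= d ->
  (forall x y, a <= x <= b -> c <= y <= d -> Cdiffable g (x, y)) ->
  boundary_integral g a b c d = RtoC 0.
Proof.
  intros Hab Hcd Hg.
  assert (Cg : Ccontinuous_rect g a b c d).
  { intros x y Hx Hy. now apply Cdiffable_continuous, Hg. }
  assert (K : forall eps, 0 < eps ->
    Cmod (boundary_integral g a b c d) <= eps * ((b - a) + (d - c)) ^ 2).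
  { intros eps He.
    apply (bisection_principle (fun a b c d =>
      Cmod (boundary_integral g a b c d) <= eps * ((b - a) + (d - c)) ^ 2)); trivial.
    - intros a' b' c' d' Ha Hb Hc Hd H1 H2 H3 H4.
      rewrite (boundary_integral_split g a' ((a' + b') / 2) b' c' ((c' + d') / 2) d'); try lra.
      2: { intros x y Hx Hy. apply Cg; lra. }
      eapply Rle_trans; [apply Cmod_triangle|].
      eapply Rle_trans; [apply Rplus_le_compat; apply Cmod_triangle|].
      eapply Rle_trans.
      { exact (Rplus_le_compat _ _ _ _ (Rplus_le_compat _ _ _ _ H1 H2)
          (Rplus_le_compat _ _ _ _ H3 H4)). }
      right. field.
    - intros x y Hx Hy. destruct (Hg x y Hx Hy) as [phi [Hphi Hloc]].
      assert (He2 : 0 < eps / 2) by lra.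
      generalize (filter_and _ _ (Hphi _ He2) Hloc). intros K.
      apply locally_Cmod in K. destruct K as [delta [Hdelta K]].
      exists delta. split; trivial. intros a' b' c' d' Ha Hb Hc Hd Hsmall.
      set (z := (x, y) : C) in *. set (s := (b' - a') + (d' - c')) in *.
      (* The affine part of [g] at [z] has boundary integral zero, and what is left is at most
         [eps / 2 * s] on a contour of length [2 * s]. *)
      set (lin := fun w : C => ((g z - phi z * z) + phi z * w)%C).
      assert (Clin : Ccontinuous_rect lin a' b' c' d').
      { intros u v _ _. apply Ccontinuous_plus. apply Ccontinuous_const.
        apply Ccontinuous_mult. apply Ccontinuous_const. apply Ccontinuous_id. }
      assert (Cr : Ccontinuous_rect (fun w => g w - lin w)%C a' b' c' d').
      { intros u v Hu Hv. apply Ccontinuous_minus. apply Cg; lra. now apply Clin. }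
      assert (E : boundary_integral g a' b' c' d'
                  = boundary_integral (fun w => g w - lin w)%C a' b' c' d').
      { transitivity (boundary_integral (fun w => lin w + (g w - lin w))%C a' b' c' d').
        - apply boundary_integral_ext; try lra. intros w. ring.
        - rewrite boundary_integral_plus; trivial; try lra.
          unfold lin at 1. rewrite boundary_integral_affine by lra. ring. }
      rewrite E.
      replace (eps * s ^ 2) with ((eps / 2 * s) * (2 * s)) by field.
      apply Cmod_boundary_integral; trivial; try lra.
      intros u v Hu Hv.
      assert (Hd' : Cmod ((u, v) - z) <= s).
      { replace ((u, v) - z)%C with (RtoC (u - x) + Ci * RtoC (v - y))%C.
        2: { apply injective_projections; simpl; ring. }
        eapply Rle_trans; [apply Cmod_triangle|].
        rewrite Cmod_mult, Cmod_Ci, 2!Cmod_R, Rmult_1_l.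
        apply Rplus_le_compat; apply Rabs_le; lra. }
      destruct (K (u, v)) as [K1 K2]; [lra|]. unfold lin. rewrite K2.
      replace (_ - _)%C with ((phi (u, v) - phi z) * ((u, v) - z))%C by ring.
      rewrite Cmod_mult. apply Rmult_le_compat; try apply Cmod_ge_0; lra. }
  apply Cmod_eq_0. apply Rle_antisym; [|apply Cmod_ge_0].
  apply le_epsilon. intros eps He. rewrite Rplus_0_l.
  set (s := ((b - a) + (d - c)) ^ 2) in *.
  assert (Hs : 0 <= s) by apply pow2_ge_0.
  (* Dividing by [s + 1] instead of [s] covers degenerate rectangles. *)
  apply Rle_trans with (1 := K (eps / (s + 1)) ltac:(apply Rdiv_lt_0_compat; lra)).
  replace eps with (eps / (s + 1) * (s + 1)) at 2 by (field; lra).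
  apply Rmult_le_compat_l; [|lra]. apply Rlt_le, Rdiv_lt_0_compat; lra.
Qed.

(** * Circle means and their independence of the radius *)

Definition circle_mean (f : C -> C) (c : C) (r : R) : C :=
  (CInt (fun t => f (c + RtoC r * cis t)%C) 0 (2 * PI) / RtoC (2 * PI))%C.

Lemma two_PI_pos : 0 < 2 * PI.
Proof. generalize PI_RGT_0. lra. Qed.

Lemma two_PI_neq_0 : RtoC (2 * PI) <> RtoC 0.
Proof. intros E. apply RtoC_inj in E. generalize two_PI_pos. lra. Qed.

Lemma Cmod_RtoC_cis (r t : R) : 0 <= r -> Cmod (RtoC r * cis t) = r.
Proof. intros Hr. rewrite Cmod_mult, Cmod_cis, Cmod_R, Rabs_pos_eq; lra. Qed.

Lemma Cmod_circle_point (c : C) (r t : R) : 0 <= r -> Cmod (c + RtoC r * cis t - c) = r.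
Proof.
  intros Hr. replace (c + RtoC r * cis t - c)%C with (RtoC r * cis t)%C by ring. now apply Cmod_RtoC_cis.
Qed.

(* In the coordinate [log z] the annulus is a rectangle, whose horizontal sides
   contribute opposite integrals by periodicity. *)
Lemma circle_mean_annulus_aux (f : C -> C) (r1 r2 : R) : 0 < r1 <= r2 ->
  (forall z, r1 <= Cmod z <= r2 -> Cdiffable f z) ->
  circle_mean f 0 r1 = circle_mean f 0 r2.
Proof.
  intros Hr Hf.
  assert (Hln : ln r1 <= ln r2) by (apply ln_le; lra).
  assert (HP := two_PI_pos).
  assert (K := goursat_rectangle (fun z => f (Cexp z)) (ln r1) (ln r2) 0 (2 * PI) Hln ltac:(lra)).
  unfold boundary_integral in K.
  rewrite (CInt_ext _ _ Hln (fun x => f (Cexp (x, 2 * PI))) (fun x => f (Cexp (x, 0)))) in K.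
  2: { intros x _. unfold Cexp. simpl. rewrite <- (Rplus_0_l (2 * PI)), cis_2PI. reflexivity. }
  assert (E : forall r, 0 < r ->
    CInt (fun y => f (Cexp (ln r, y))) 0 (2 * PI) = (circle_mean f 0 r * RtoC (2 * PI))%C).
  { intros r Hr0. unfold circle_mean. unfold Cdiv. rewrite <- Cmult_assoc, Cinv_l, Cmult_1_r.
    2: apply two_PI_neq_0.
    apply CInt_ext; [lra|]. intros t _.
    change (Cexp (ln r, t)) with (RtoC (exp (ln r)) * cis t)%C. rewrite exp_ln by trivial.
    f_equal. ring. }
  rewrite 2!E in K by lra.
  assert (K' : (Ci * RtoC (2 * PI) * (circle_mean f 0 r2 - circle_mean f 0 r1))%C = RtoC 0).
  { etransitivity; [|apply K].
    - ring.
    - intros x y Hx _. apply (Cdiffable_comp f Cexp); [|apply Cdiffable_Cexp].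
      apply Hf. rewrite Cmod_Cexp. simpl.
      rewrite <- (exp_ln r1), <- (exp_ln r2) by lra.
      split; apply exp_le_compat; lra. }
  apply Cmult_eq_0 in K'. destruct K' as [K'|K'].
  - exfalso. apply Cmult_eq_0 in K'. destruct K' as [K'|K'].
    + apply (f_equal Cmod) in K'. rewrite Cmod_Ci, Cmod_0 in K'. lra.
    + now apply two_PI_neq_0.
  - symmetry. now apply Csub_eq_0.
Qed.

Lemma circle_mean_translate (f : C -> C) (c : C) (r : R) :
  circle_mean f c r = circle_mean (fun z => f (c + z)%C) 0 r.
Proof.
  unfold circle_mean. f_equal. apply CInt_ext; [generalize two_PI_pos; lra|].
  intros t _. f_equal. ring.
Qed.

Lemma circle_mean_annulus (f : C -> C) (c : C) (r1 r2 : R) : 0 < r1 -> 0 < r2 ->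
  (forall z, Rmin r1 r2 <= Cmod (z - c) <= Rmax r1 r2 -> Cdiffable f z) ->
  circle_mean f c r1 = circle_mean f c r2.
Proof.
  intros H1 H2 Hf. rewrite (circle_mean_translate f c r1), (circle_mean_translate f c r2).
  assert (Hd : forall z, Rmin r1 r2 <= Cmod z <= Rmax r1 r2 -> Cdiffable (fun z => f (c + z)%C) z).
  { intros z Hz. apply (Cdiffable_comp f (fun z => c + z)%C).
    - apply Hf. now replace (c + z - c)%C with z by ring.
    - smooth. }
  destruct (Rle_dec r1 r2) as [H|H].
  - rewrite Rmin_left, Rmax_right in Hd by lra.
    exact (circle_mean_annulus_aux _ r1 r2 (conj H1 H) Hd).
  - rewrite Rmin_right, Rmax_left in Hd by lra. symmetry.
    apply (circle_mean_annulus_aux _ r2 r1); [lra|exact Hd].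
Qed.

Lemma Ccontinuous_circle (f : C -> C) (c : C) (r t : R) :
  Ccontinuous (T := C_UniformSpace) f (c + RtoC r * cis t)%C ->
  Ccontinuous (T := R_UniformSpace) (fun t => f (c + RtoC r * cis t)%C) t.
Proof.
  intros Hf. apply (Ccontinuous_comp f (fun t => c + RtoC r * cis t)%C); trivial.
  smooth.
Qed.

Lemma circle_mean_bound (f : C -> C) (c : C) (r M : R) : 0 <= r ->
  (forall z, Cmod (z - c) = r -> Ccontinuous (T := C_UniformSpace) f z) ->
  (forall z, Cmod (z - c) = r -> Cmod (f z) <= M) ->
  Cmod (circle_mean f c r) <= M.
Proof.
  intros Hr Hc HM. assert (HP := two_PI_pos).
  assert (Hz := fun t => Cmod_circle_point c r t Hr).
  unfold circle_mean. rewrite Cmod_div, Cmod_R, (Rabs_pos_eq (2 * PI)) by (try apply two_PI_neq_0; lra).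
  apply Rmult_le_reg_r with (2 * PI); trivial.
  unfold Rdiv. rewrite Rmult_assoc, Rinv_l, Rmult_1_r by lra.
  replace (2 * PI) with (2 * PI - 0) at 2 by ring.
  apply Cmod_CInt_le_const; [lra| |].
  - intros t _. apply Ccontinuous_circle, Hc, Hz.
  - intros t _. apply HM, Hz.
Qed.

Lemma circle_mean_const (k c : C) (r : R) : circle_mean (fun _ => k) c r = k.
Proof.
  unfold circle_mean. rewrite CInt_const, Rminus_0_r.
  field. apply two_PI_neq_0.
Qed.

Lemma circle_mean_ext (f g : C -> C) (c : C) (r : R) : 0 <= r ->
  (forall z, Cmod (z - c) = r -> f z = g z) -> circle_mean f c r = circle_mean g c r.
Proof.
  intros Hr E. unfold circle_mean. f_equal. apply CInt_ext; [generalize two_PI_pos; lra|].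
  intros t _. now apply E, Cmod_circle_point.
Qed.

Lemma circle_mean_plus (f g : C -> C) (c : C) (r : R) : 0 <= r ->
  (forall z, Cmod (z - c) = r -> Ccontinuous (T := C_UniformSpace) f z) ->
  (forall z, Cmod (z - c) = r -> Ccontinuous (T := C_UniformSpace) g z) ->
  circle_mean (fun z => f z + g z)%C c r = (circle_mean f c r + circle_mean g c r)%C.
Proof.
  intros Hr Hf Hg. unfold circle_mean.
  assert (Hz := fun t => Cmod_circle_point c r t Hr).
  rewrite (CInt_plus 0 (2 * PI) ltac:(generalize two_PI_pos; lra)
    (fun t => f (c + RtoC r * cis t)%C) (fun t => g (c + RtoC r * cis t)%C)).
  - field. apply two_PI_neq_0.
  - intros t _. apply Ccontinuous_circle, Hf, Hz.
  - intros t _. apply Ccontinuous_circle, Hg, Hz.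
Qed.

(** All smaller circles about [c] have the same mean, and continuity at [c] brings the mean over
    small circles within [eps] of [f c]. *)
Theorem mean_value_property (f : C -> C) (c : C) (r : R) : 0 < r ->
  (forall z, Cmod (z - c) <= r -> Cdiffable f z) -> circle_mean f c r = f c.
Proof.
  intros Hr Hf.
  assert (K : forall eps, 0 < eps -> Cmod (circle_mean f c r - f c) <= eps).
  { intros eps He.
    assert (Hc : Ccontinuous (T := C_UniformSpace) f c).
    { apply Cdiffable_continuous, Hf. replace (c - c)%C with (RtoC 0) by ring. rewrite Cmod_0. lra. }
    generalize (Hc eps He). intros K. apply locally_Cmod in K. destruct K as [d [Hd K]].
    set (s := Rmin (d / 2) r).
    assert (Hs : 0 < s) by (apply Rmin_glb_lt; lra).
    assert (Hsr : s <= r) by apply Rmin_r.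
    assert (Hsd : s <= d / 2) by apply Rmin_l.
    rewrite (circle_mean_annulus f c r s); trivial.
    2: { intros z. rewrite Rmax_left by lra. intros Hz. apply Hf. lra. }
    assert (Ks : forall z, Cmod (z - c) = s -> Ccontinuous (T := C_UniformSpace) f z).
    { intros z Hz. apply Cdiffable_continuous, Hf. lra. }
    replace (circle_mean f c s - f c)%C with (circle_mean (fun z => f z + - f c)%C c s).
    2: { rewrite (circle_mean_plus f (fun _ => - f c)%C); trivial; try lra.
         now rewrite circle_mean_const. intros z _. smooth. }
    apply circle_mean_bound; try lra.
    - intros z Hz. apply Ccontinuous_plus. now apply Ks. smooth.
    - intros z Hz. apply Rlt_le, K. lra. }
  apply Csub_eq_0, Cmod_eq_0, Rle_antisym; [|apply Cmod_ge_0].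
  apply le_epsilon. intros eps He. rewrite Rplus_0_l. now apply K.
Qed.

(** * Fourier series *)

Definition Clim (u : nat -> C) (l : C) : Prop :=
  forall eps, 0 < eps -> exists N : nat, forall n, (N <= n)%nat -> Cmod (u n - l) < eps.

Lemma Cmod_small_eq_0 (z : C) : (forall eps, 0 < eps -> Cmod z <= eps) -> z = RtoC 0.
Proof.
  intros H. apply Cmod_eq_0, Rle_antisym; [|apply Cmod_ge_0].
  apply le_epsilon. intros eps He. rewrite Rplus_0_l. now apply H.
Qed.

Lemma Clim_unique (u : nat -> C) (l m : C) : Clim u l -> Clim u m -> l = m.
Proof.
  intros Hl Hm. apply Csub_eq_0, Cmod_small_eq_0. intros eps He.
  destruct (Hl (eps / 2)) as [N1 H1]; [lra|]. destruct (Hm (eps / 2)) as [N2 H2]; [lra|].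
  specialize (H1 (N1 + N2)%nat ltac:(lia)). specialize (H2 (N1 + N2)%nat ltac:(lia)).
  generalize (Cmod_sub_triangle l (u (N1 + N2)%nat) m).
  rewrite (Cmod_sub_sym l (u _)). lra.
Qed.

Lemma Clim_ext (u v : nat -> C) (l : C) : (forall n, u n = v n) -> Clim u l -> Clim v l.
Proof. intros E H eps He. destruct (H eps He) as [N HN]. exists N. intros n Hn. rewrite <- E. auto. Qed.

Lemma Clim_const (l : C) : Clim (fun _ => l) l.
Proof.
  intros eps He. exists O. intros n _. replace (l - l)%C with (RtoC 0) by ring. now rewrite Cmod_0.
Qed.

Lemma Clim_plus (u v : nat -> C) (l m : C) :
  Clim u l -> Clim v m -> Clim (fun n => u n + v n)%C (l + m)%C.
Proof.
  intros Hl Hm eps He.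
  destruct (Hl (eps / 2)) as [N1 H1]; [lra|]. destruct (Hm (eps / 2)) as [N2 H2]; [lra|].
  exists (N1 + N2)%nat. intros n Hn.
  specialize (H1 n ltac:(lia)). specialize (H2 n ltac:(lia)).
  replace (u n + v n - (l + m))%C with ((u n - l) + (v n - m))%C by ring.
  generalize (Cmod_triangle (u n - l) (v n - m)). lra.
Qed.

Lemma Clim_scal (u : nat -> C) (k l : C) : Clim u l -> Clim (fun n => k * u n)%C (k * l)%C.
Proof.
  intros Hl eps He.
  assert (Hk := Cmod_ge_0 k).
  destruct (Hl (eps / (Cmod k + 1))) as [N H]; [apply Rdiv_lt_0_compat; lra|].
  exists N. intros n Hn. specialize (H n Hn).
  replace (k * u n - k * l)%C with (k * (u n - l))%C by ring. rewrite Cmod_mult.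
  apply Rle_lt_trans with (Cmod k * (eps / (Cmod k + 1))).
  - apply Rmult_le_compat_l; lra.
  - apply Rmult_lt_reg_r with (Cmod k + 1); [lra|].
    replace (Cmod k * (eps / (Cmod k + 1)) * (Cmod k + 1)) with (Cmod k * eps) by (field; lra).
    nra.
Qed.

Lemma Clim_minus (u v : nat -> C) (l m : C) :
  Clim u l -> Clim v m -> Clim (fun n => u n - v n)%C (l - m)%C.
Proof.
  intros Hl Hm. apply Clim_ext with (fun n => u n + (RtoC (-1)) * v n)%C.
  { intros n. replace (RtoC (-1)) with (- RtoC 1)%C by (rewrite <- RtoC_opp; f_equal; ring). ring. }
  replace (l - m)%C with (l + RtoC (-1) * m)%C.
  2: { replace (RtoC (-1)) with (- RtoC 1)%C by (rewrite <- RtoC_opp; f_equal; ring). ring. }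
  apply Clim_plus; trivial. now apply Clim_scal.
Qed.

Lemma Clim_conj (u : nat -> C) (l : C) : Clim u l -> Clim (fun n => Cconj (u n)) (Cconj l).
Proof.
  intros Hl eps He. destruct (Hl eps He) as [N H]. exists N. intros n Hn.
  rewrite <- Cminus_conj, Cmod_conj. auto.
Qed.

Lemma Clim_bound (u : nat -> C) (l : C) (M : R) : Clim u l -> (forall n, Cmod (u n) <= M) -> Cmod l <= M.
Proof.
  intros Hl HM. apply le_epsilon. intros eps He. destruct (Hl eps He) as [N H].
  specialize (H N (le_n N)). specialize (HM N).
  generalize (Cmod_sub_ge l (u N)). rewrite Cmod_sub_sym. lra.
Qed.

Lemma Clim_le_0 (u : nat -> C) (l : C) (v : nat -> R) :
  (forall n, Cmod (u n - l) <= v n) -> is_lim_seq v 0 -> Clim u l.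
Proof.
  intros H Hv eps He. apply is_lim_seq_spec in Hv. destruct (Hv (mkposreal _ He)) as [N HN].
  exists N. intros n Hn. specialize (HN n Hn). simpl in HN. rewrite Rminus_0_r in HN.
  generalize (Rle_abs (v n)) (H n). lra.
Qed.

Definition fourier_coef (h : R -> C) (k : Z) : C :=
  (CInt (fun t => h t * cis (- (IZR k * t)))%C 0 (2 * PI) / RtoC (2 * PI))%C.

Lemma Ccontinuous_cis_lin (a t : R) : Ccontinuous (T := R_UniformSpace) (fun t => cis (a * t)) t.
Proof.
  apply continuous_pair_Ccontinuous.
  - apply (ex_derive_continuous (V := R_NormedModule) (fun t => cos (a * t))). auto_derive; trivial.
  - apply (ex_derive_continuous (V := R_NormedModule) (fun t => sin (a * t))). auto_derive; trivial.
Qed.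

Lemma Ccontinuous_cis_opp_lin (a t : R) : Ccontinuous (T := R_UniformSpace) (fun t => cis (- (a * t))) t.
Proof.
  apply Ccontinuous_ext_loc with (fun t => cis (- a * t)).
  - apply filter_forall. intros s. f_equal. ring.
  - apply Ccontinuous_cis_lin.
Qed.

#[global] Hint Resolve Ccontinuous_cis_lin Ccontinuous_cis_opp_lin : smooth.

(** Mean value property of [z^n], which vanishes at the centre 0. *)
Lemma CInt_cis_nat (n : nat) : (0 < n)%nat -> CInt (fun t => cis (INR n * t)) 0 (2 * PI) = RtoC 0.
Proof.
  intros Hn.
  assert (K : circle_mean (fun z => z ^ n)%C 0 1 = (RtoC 0 ^ n)%C).
  { apply (mean_value_property (fun z => z ^ n)%C 0 1). lra.
    intros z _. smooth. }
  unfold circle_mean in K.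
  rewrite (CInt_ext _ _ (Rlt_le _ _ two_PI_pos) _ (fun t => cis (INR n * t))) in K.
  2: { intros t _. rewrite <- cis_pow. now replace (0 + 1 * cis t)%C with (cis t) by ring. }
  set (I := CInt (fun t => cis (INR n * t)) 0 (2 * PI)) in *.
  replace I with (I / RtoC (2 * PI) * RtoC (2 * PI))%C by (field; apply two_PI_neq_0).
  rewrite K. destruct n; [lia|]. simpl. ring.
Qed.

Lemma CInt_cis_Z (k : Z) : CInt (fun t => cis (IZR k * t)) 0 (2 * PI) =
  if Z.eq_dec k 0 then RtoC (2 * PI) else RtoC 0.
Proof.
  assert (HP := Rlt_le _ _ two_PI_pos).
  destruct (Z.eq_dec k 0) as [->|Hk].
  - rewrite (CInt_ext _ _ HP _ (fun _ => RtoC 1)).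
    + rewrite CInt_const. rewrite Rminus_0_r. cring.
    + intros t _. now rewrite Rmult_0_l, cis_0.
  - destruct (Z_lt_dec 0 k) as [H|H].
    + rewrite <- (Z2Nat.id k), <- INR_IZR_INZ by lia. apply CInt_cis_nat. lia.
    + rewrite (CInt_ext _ _ HP _ (fun t => Cconj (cis (INR (Z.to_nat (- k)) * t)))).
      * rewrite CInt_conj by (trivial; intros t _; apply Ccontinuous_cis_lin).
        rewrite CInt_cis_nat by lia. apply injective_projections; simpl; ring.
      * intros t _. rewrite Cconj_cis, INR_IZR_INZ, Z2Nat.id by lia. rewrite opp_IZR. f_equal. ring.
Qed.

Section Bessel.

Let CC (h : R -> C) := Ccontinuous_on h 0 (2 * PI).
Let HP : 0 <= 2 * PI := Rlt_le _ _ two_PI_pos.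

Let CInt_fourier (h : R -> C) (k : Z) :
  CInt (fun t => h t * cis (- (IZR k * t)))%C 0 (2 * PI) = (RtoC (2 * PI) * fourier_coef h k)%C.
Proof. unfold fourier_coef. field. apply two_PI_neq_0. Qed.

Lemma fourier_coef_minus_character (h : R -> C) (d : C) (j k : Z) : CC h ->
  fourier_coef (fun t => h t - d * cis (IZR k * t))%C j
  = (fourier_coef h j - if Z.eq_dec j k then d else RtoC 0)%C.
Proof.
  intros Hh. unfold fourier_coef.
  rewrite (CInt_ext _ _ HP _ (fun t => h t * cis (- (IZR j * t)) - d * cis (IZR (k - j) * t))%C).
  - rewrite (CInt_minus _ _ HP).
    + rewrite (CInt_scal _ _ HP), CInt_cis_Z.
      * destruct (Z.eq_dec (k - j) 0); destruct (Z.eq_dec j k); try lia; field; apply two_PI_neq_0.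
      * smooth.
    + intros t Ht. apply Ccontinuous_mult. now apply Hh. smooth.
    + smooth.
  - intros t _. rewrite minus_IZR.
    replace ((IZR k - IZR j) * t) with (IZR k * t + - (IZR j * t)) by ring.
    rewrite cis_add. ring.
Qed.

(** Pythagoras: [h] minus its component along a character is orthogonal to that component. *)
Lemma L2_minus_projection (h : R -> C) (k : Z) : CC h ->
  let d := fourier_coef h k in
  CInt (fun t => (h t - d * cis (IZR k * t)) * Cconj (h t - d * cis (IZR k * t)))%C 0 (2 * PI)
  = (CInt (fun t => h t * Cconj (h t)) 0 (2 * PI) - RtoC (2 * PI) * RtoC (Cmod d ^ 2))%C.
Proof.
  intros Hh d.
  assert (C1 : CC (fun t => h t * Cconj (h t))%C).
  { intros t Ht. apply Ccontinuous_mult. now apply Hh. smooth. }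
  assert (C2 : CC (fun t => h t * cis (- (IZR k * t)))%C).
  { intros t Ht. apply Ccontinuous_mult. now apply Hh. smooth. }
  assert (C3 : CC (fun t => Cconj (h t * cis (- (IZR k * t))))%C).
  { intros t Ht. smooth. }
  assert (C4 : forall c : C, CC (fun t => c * (h t * cis (- (IZR k * t))))%C).
  { intros c t Ht. apply Ccontinuous_mult. smooth. now apply C2. }
  assert (C5 : forall c : C, CC (fun t => c * Cconj (h t * cis (- (IZR k * t))))%C).
  { intros c t Ht. apply Ccontinuous_mult. smooth. now apply C3. }
  assert (C6 : CC (fun t => h t * Cconj (h t) - Cconj d * (h t * cis (- (IZR k * t))))%C).
  { intros t Ht. apply Ccontinuous_minus. now apply C1. now apply C4. }
  assert (C7 : CC (fun _ => d * Cconj d)%C).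
  { intros t Ht. smooth. }
  assert (C8 : CC (fun t => d * Cconj (h t * cis (- (IZR k * t))) - d * Cconj d)%C).
  { intros t Ht. apply Ccontinuous_minus. now apply C5. now apply C7. }
  rewrite (CInt_ext _ _ HP _ (fun t => (h t * Cconj (h t) - Cconj d * (h t * cis (- (IZR k * t))))
      - (d * Cconj (h t * cis (- (IZR k * t))) - d * Cconj d))%C).
  - rewrite (CInt_minus _ _ HP), 2!(CInt_minus _ _ HP), 2!(CInt_scal _ _ HP), (CInt_conj _ _ HP),
      CInt_fourier, CInt_const; try apply C4; try apply C5; trivial.
    fold d. rewrite Cmult_conj, Rminus_0_r, Cmod2_conj.
    replace (Cconj (RtoC (2 * PI))) with (RtoC (2 * PI)).
    2: { apply injective_projections; simpl; ring. }
    ring.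
  - intros t _. rewrite Cminus_conj, !Cmult_conj, !Cconj_cis, Ropp_involutive.
    assert (E : (cis (IZR k * t) * cis (- (IZR k * t)))%C = RtoC 1).
    { rewrite <- cis_add, Rplus_opp_r. apply cis_0. }
    transitivity (h t * Cconj (h t) - Cconj d * (h t * cis (- (IZR k * t)))
      - (d * (Cconj (h t) * cis (IZR k * t)) - d * Cconj d * (cis (IZR k * t) * cis (- (IZR k * t)))))%C.
    ring. rewrite E. ring.
Qed.

Lemma L2_real_nonneg (h : R -> C) : CC h ->
  exists E, 0 <= E /\ CInt (fun t => h t * Cconj (h t))%C 0 (2 * PI) = RtoC E.
Proof.
  intros Hh.
  assert (Hex : ex_RInt (fun t => Cmod (h t) ^ 2) 0 (2 * PI)).
  { apply (ex_RInt_continuous (V := R_CompleteNormedModule)).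
    intros t. rewrite Rmin_left, Rmax_right by trivial. intros Ht.
    assert (K := Ccontinuous_Re _ _ (Ccontinuous_mult _ _ _ (Hh t Ht) (Ccontinuous_conj _ _ (Hh t Ht)))).
    apply continuous_ext with (2 := K). intros s. now rewrite <- Cmod2_conj. }
  exists (RInt (fun t => Cmod (h t) ^ 2) 0 (2 * PI)). split.
  - apply RInt_ge_0; trivial. intros t _. apply pow2_ge_0.
  - rewrite <- CInt_RtoC by trivial. apply CInt_ext; trivial.
    intros t _. now rewrite Cmod2_conj.
Qed.

(** The characters [s 0, ..., s n] are subtracted one after the other. Each step lowers the squared
    norm by [2 * PI] times a squared coefficient and, as [s] is injective, leaves the coefficients
    still to be removed unchanged; the final squared norm is nonnegative. *)
Lemma bessel_inequality (h : R -> C) (s : nat -> Z) :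
  (forall i j, s i = s j -> i = j) -> CC h ->
  exists E, forall n, sum_n (fun i => Cmod (fourier_coef h (s i)) ^ 2) n <= E.
Proof.
  intros Hs Hh. destruct (L2_real_nonneg h Hh) as [E [HE0 HE]].
  exists (E / (2 * PI)). intros n.
  assert (K : exists psi, CC psi /\
    (forall j, (forall i, (i <= n)%nat -> s i <> j) -> fourier_coef psi j = fourier_coef h j) /\
    CInt (fun t => psi t * Cconj (psi t))%C 0 (2 * PI)
    = RtoC (E - 2 * PI * sum_n (fun i => Cmod (fourier_coef h (s i)) ^ 2) n)).
  { assert (Step : forall psi k F, CC psi -> CInt (fun t => psi t * Cconj (psi t))%C 0 (2 * PI) = RtoC F ->
      exists psi', CC psi' /\ (forall j, k <> j -> fourier_coef psi' j = fourier_coef psi j) /\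
      CInt (fun t => psi' t * Cconj (psi' t))%C 0 (2 * PI)
      = RtoC (F - 2 * PI * (Cmod (fourier_coef psi k) ^ 2))).
    { intros psi k F Hpsi HF.
      exists (fun t => psi t - fourier_coef psi k * cis (IZR k * t))%C. split; [|split].
      - intros t Ht. apply Ccontinuous_minus. now apply Hpsi.
        smooth.
      - intros j Hj. rewrite fourier_coef_minus_character by trivial.
        destruct (Z.eq_dec j k) as [->|_]; [now elim Hj|]. ring.
      - rewrite (L2_minus_projection psi k Hpsi), HF. now rewrite RtoC_minus, !RtoC_mult. }
    induction n.
    - destruct (Step h (s O) E Hh HE) as [psi [P1 [P2 P3]]].
      exists psi. split; trivial. split.
      + intros j Hj. apply P2, Hj. lia.
      + now rewrite sum_O.
    - destruct IHn as [psi [P1 [P2 P3]]].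
      destruct (Step psi (s (S n)) _ P1 P3) as [psi' [Q1 [Q2 Q3]]].
      exists psi'. split; trivial. split.
      + intros j Hj. rewrite Q2 by (apply Hj; lia). apply P2. intros i Hi. apply Hj. lia.
      + rewrite Q3, sum_Sn, P2. f_equal. unfold plus; simpl. ring.
        intros i Hi Heq. apply Hs in Heq. lia. }
  destruct K as [psi [P1 [_ P3]]].
  destruct (L2_real_nonneg psi P1) as [F [HF0 HF]].
  rewrite P3 in HF. apply RtoC_inj in HF.
  apply Rmult_le_reg_l with (2 * PI). apply two_PI_pos.
  replace (2 * PI * (E / (2 * PI))) with E by (field; generalize two_PI_pos; lra). lra.
Qed.

(** The squared coefficients form a convergent series by Bessel's inequality. An arbitrary injective
    [s] covers both ends of the integers. *)
Lemma riemann_lebesgue (h : R -> C) (s : nat -> Z) :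
  (forall i j, s i = s j -> i = j) -> CC h ->
  Clim (fun n => fourier_coef h (s n)) 0.
Proof.
  intros Hs Hh. destruct (bessel_inequality h s Hs Hh) as [E HE].
  assert (Hex : ex_series (fun i => Cmod (fourier_coef h (s i)) ^ 2)).
  { apply ex_finite_lim_seq_incr with E; trivial.
    intros n. rewrite sum_Sn. unfold plus; simpl.
    generalize (pow2_ge_0 (Cmod (fourier_coef h (s (S n))))). simpl. lra. }
  apply ex_series_lim_0 in Hex. apply is_lim_seq_spec in Hex.
  intros eps He.
  destruct (Hex (mkposreal (eps ^ 2) ltac:(apply pow_lt; lra))) as [N HN].
  exists N. intros n Hn. specialize (HN n Hn). simpl in HN.
  replace (fourier_coef h (s n) - 0)%C with (fourier_coef h (s n)) by ring.
  set (m := Cmod (fourier_coef h (s n))) in *.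
  assert (Hm : 0 <= m) by apply Cmod_ge_0.
  rewrite Rminus_0_r, Rabs_pos_eq in HN by nra. nra.
Qed.

End Bessel.

(** The slope of Caratheodory made global: Fourier coefficients of [phi] on the entire circle are
    taken below, so the factorization has to hold everywhere and [phi] has to be continuous away
    from [z0] too. *)
Lemma Cdiffable_quotient (h : C -> C) (z0 : C) : Cdiffable h z0 ->
  exists phi : C -> C, Ccontinuous (T := C_UniformSpace) phi z0 /\
    (forall z, h z = (h z0 + phi z * (z - z0))%C) /\
    (forall z, z <> z0 -> Ccontinuous (T := C_UniformSpace) h z ->
       Ccontinuous (T := C_UniformSpace) phi z).
Proof.
  intros [psi [Hc Hloc]].
  assert (Hn : forall z, z <> z0 -> (z - z0)%C <> RtoC 0).
  { intros z Hz E. now apply Hz, Csub_eq_0. }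
  exists (fun z => if Ceq_dec z z0 then psi z0 else ((h z - h z0) / (z - z0))%C).
  split; [|split].
  - apply Ccontinuous_ext_loc with psi; trivial.
    generalize Hloc. apply filter_imp. intros y Hy.
    destruct (Ceq_dec y z0) as [->|Hyz]; trivial.
    rewrite Hy. field. now apply Hn.
  - intros z. destruct (Ceq_dec z z0) as [->|Hz]. ring. field. now apply Hn.
  - intros z Hz Hh.
    apply Ccontinuous_ext_loc with (fun z => (h z - h z0) / (z - z0))%C.
    + apply locally_Cmod_intro with (Cmod (z - z0)). now apply Cmod_gt_0, Hn.
      intros y Hy. destruct (Ceq_dec y z0) as [->|_]; trivial.
      rewrite Cmod_sub_sym in Hy. lra.
    + apply Ccontinuous_div. now apply Hn.
      apply Ccontinuous_minus; trivial. apply Ccontinuous_const.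
      smooth.
Qed.

Lemma Cmod_fourier_term (c : C) (t : R) : Cmod (c * cis t) = Cmod c.
Proof. rewrite Cmod_mult, Cmod_cis. ring. Qed.

(* Chernoff's argument: dividing [h - h z0] by [z - z0] makes the Fourier series at
   [z0] telescope, and the boundary terms vanish by the Riemann-Lebesgue lemma. *)
Theorem fourier_series_converges (h : C -> C) (t0 : R) :
  (forall z, Cmod z = 1 -> Ccontinuous (T := C_UniformSpace) h z) ->
  Cdiffable h (cis t0) ->
  let c := fourier_coef (fun t => h (cis t)) in
  Clim (fun N => Csum (fun j => c (Z.of_nat j) * cis (IZR (Z.of_nat j) * t0))%C N
     + Csum (fun j => c (- Z.of_nat (S j))%Z * cis (IZR (- Z.of_nat (S j)) * t0))%C N)%C
    (h (cis t0)).
Proof.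
  intros Hc Hd c.
  assert (HP : 0 <= 2 * PI) by (apply Rlt_le, two_PI_pos).
  destruct (Cdiffable_quotient h (cis t0) Hd) as [phi [Hphi1 [Hphi2 Hphi3]]].
  assert (Cphi : forall t, Ccontinuous (T := R_UniformSpace) (fun t => phi (cis t)) t).
  { intros t. apply (Ccontinuous_comp phi cis); [|apply Ccontinuous_cis].
    destruct (Ceq_dec (cis t) (cis t0)) as [->|H]; trivial.
    apply Hphi3; trivial. apply Hc, Cmod_cis. }
  set (d := fourier_coef (fun t => phi (cis t))).
  (* Chosen to telescope: for [k <> 0] the factorization of [h] gives
     [c k = d (k - 1) - cis t0 * d k], and [k = 0] adds [h (cis t0)]. *)
  set (p := fun k : Z => (d (k - 1)%Z * cis (IZR k * t0))%C).
  assert (Hck : forall k, (c k * cis (IZR k * t0))%C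
    = ((if Z.eq_dec k 0 then h (cis t0) else RtoC 0) + p k - p (k + 1)%Z)%C).
  { intros k.
    assert (E : c k = ((if Z.eq_dec k 0 then h (cis t0) else RtoC 0) + d (k - 1)%Z - cis t0 * d k)%C).
    { unfold c, d, fourier_coef.
      rewrite (CInt_ext _ _ HP _ (fun t => (h (cis t0) * cis (IZR (- k) * t)
        + phi (cis t) * cis (- (IZR (k - 1) * t))) - cis t0 * (phi (cis t) * cis (- (IZR k * t))))%C).
      - assert (C1 : forall j, Ccontinuous_on (fun t => phi (cis t) * cis (- (IZR j * t)))%C 0 (2 * PI)).
        { intros j t _. apply Ccontinuous_mult. apply Cphi. smooth. }
        assert (C2 : forall j, Ccontinuous_on (fun t => cis (IZR j * t)) 0 (2 * PI)).
        { intros j t _. smooth. }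
        assert (C3 : forall c j, Ccontinuous_on (fun t => c * cis (IZR j * t))%C 0 (2 * PI)).
        { intros c' j t Ht. apply Ccontinuous_mult. smooth. now apply C2. }
        rewrite (CInt_minus _ _ HP), (CInt_plus _ _ HP), 2!(CInt_scal _ _ HP), CInt_cis_Z; trivial.
        + destruct (Z.eq_dec (- k) 0); destruct (Z.eq_dec k 0); try lia; field; apply two_PI_neq_0.
        + intros t Ht. apply Ccontinuous_plus. now apply C3. now apply C1.
        + intros t Ht. apply Ccontinuous_mult. smooth. now apply C1.
      - intros t _. rewrite (Hphi2 (cis t)), opp_IZR, minus_IZR.
        replace (- IZR k * t) with (- (IZR k * t)) by ring.
        replace (- ((IZR k - 1) * t)) with (t + - (IZR k * t)) by ring.
        rewrite (cis_add t). ring. }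
    rewrite E. unfold p. replace (k + 1 - 1)%Z with k by lia. rewrite plus_IZR.
    replace ((IZR k + 1) * t0) with (t0 + IZR k * t0) by ring. rewrite (cis_add t0).
    destruct (Z.eq_dec k 0) as [->|Hk].
    - rewrite Rmult_0_l, cis_0. ring.
    - ring. }
  apply Clim_ext with (fun N => h (cis t0) + (p (- Z.of_nat (S N))%Z - p (Z.of_nat (S N))))%C.
  { intros N.
    assert (E1 : Csum (fun j => c (Z.of_nat j) * cis (IZR (Z.of_nat j) * t0))%C N
      = (h (cis t0) + p 0%Z - p (Z.of_nat (S N)))%C).
    { induction N.
      - rewrite Csum_O, Hck. reflexivity.
      - rewrite Csum_S, IHN, Hck. destruct (Z.eq_dec (Z.of_nat (S N)) 0); [lia|].
        replace (Z.of_nat (S N) + 1)%Z with (Z.of_nat (S (S N))) by lia.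
        ring. }
    assert (E2 : Csum (fun j => c (- Z.of_nat (S j))%Z * cis (IZR (- Z.of_nat (S j)) * t0))%C N
      = (p (- Z.of_nat (S N))%Z - p 0%Z)%C).
    { clear E1. induction N.
      - rewrite Csum_O, Hck. simpl. ring.
      - rewrite Csum_S, IHN, Hck. destruct (Z.eq_dec (- Z.of_nat (S (S N))) 0); [lia|].
        replace (- Z.of_nat (S (S N)) + 1)%Z with (- Z.of_nat (S N))%Z by lia.
        ring. }
    rewrite E1, E2. ring. }
  replace (h (cis t0)) with (h (cis t0) + (0 - 0))%C at 1 by ring.
  apply Clim_plus. apply Clim_const. apply Clim_minus.
  - assert (K := riemann_lebesgue (fun t => phi (cis t)) (fun n => (- Z.of_nat (S n) - 1)%Z)
      ltac:(intros i j Hij; cbv beta in Hij; lia) ltac:(intros t _; apply Cphi)).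
    intros eps He. destruct (K eps He) as [N HN]. exists N. intros n Hn. specialize (HN n Hn).
    unfold p. replace (_ - 0)%C with (d (- Z.of_nat (S n) - 1)%Z * cis (IZR (- Z.of_nat (S n)) * t0))%C by ring.
    rewrite Cmod_fourier_term. replace (d _) with (d (- Z.of_nat (S n) - 1)%Z - 0)%C by ring. exact HN.
  - assert (K := riemann_lebesgue (fun t => phi (cis t)) (fun n => (Z.of_nat (S n) - 1)%Z)
      ltac:(intros i j Hij; cbv beta in Hij; lia) ltac:(intros t _; apply Cphi)).
    intros eps He. destruct (K eps He) as [N HN]. exists N. intros n Hn. specialize (HN n Hn).
    unfold p. replace (_ - 0)%C with (d (Z.of_nat (S n) - 1)%Z * cis (IZR (Z.of_nat (S n)) * t0))%C by ring.
    rewrite Cmod_fourier_term. replace (d _) with (d (Z.of_nat (S n) - 1)%Z - 0)%C by ring. exact HN.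
Qed.

(** * Power series *)

(** Total, like [Series]; the value is the sum whenever the terms have a geometric bound, as in
    [Clim_CSeries]. *)
Definition CSeries (a : nat -> C) : C :=
  (Series (fun k => Re (a k)), Series (fun k => Im (a k))).

Lemma Csum_pair (a : nat -> C) (n : nat) :
  Csum a n = (sum_n (fun k => Re (a k)) n, sum_n (fun k => Im (a k)) n).
Proof.
  induction n.
  - rewrite Csum_O, 2!sum_O. apply injective_projections; reflexivity.
  - rewrite Csum_S, IHn, 2!sum_Sn. apply injective_projections; reflexivity.
Qed.

Lemma Csum_scal (c : C) (a : nat -> C) (n : nat) : Csum (fun k => c * a k)%C n = (c * Csum a n)%C.
Proof.
  induction n.
  - now rewrite 2!Csum_O.
  - rewrite 2!Csum_S, IHn. ring.
Qed.

Lemma Csum_shift (a : nat -> C) (n m : nat) :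
  Csum a (S n + m) = (Csum a n + Csum (fun k => a (S n + k)%nat) m)%C.
Proof.
  induction m.
  - rewrite Nat.add_0_r, Csum_S, Csum_O, Nat.add_0_r. reflexivity.
  - rewrite Nat.add_succ_r, 2!Csum_S, IHm. rewrite Nat.add_succ_r. ring.
Qed.

Section GeometricSeries.
Context (a : nat -> C) (M q : R) (Hq : 0 <= q < 1) (Ha : forall k, Cmod (a k) <= M * q ^ k).

Lemma geometric_bound_nonneg : 0 <= M.
Proof. generalize (Ha O) (Cmod_ge_0 (a O)). simpl. lra. Qed.

Lemma Csum_geometric_bound (n : nat) : Cmod (Csum a n) <= M / (1 - q).
Proof.
  apply Rle_trans with (M * (1 - q ^ S n) / (1 - q)).
  - induction n.
    + rewrite Csum_O. simpl. replace (M * (1 - q * 1) / (1 - q)) with M by (field; lra).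
      generalize (Ha O). simpl. lra.
    + rewrite Csum_S. eapply Rle_trans; [apply Cmod_triangle|].
      replace (M * (1 - q ^ S (S n)) / (1 - q)) with (M * (1 - q ^ S n) / (1 - q) + M * q ^ S n)
        by (simpl; field; lra).
      apply Rplus_le_compat; trivial.
  - apply Rmult_le_compat_r; [apply Rlt_le, Rinv_0_lt_compat; lra|].
    generalize geometric_bound_nonneg (pow_le q (S n) (proj1 Hq)). nra.
Qed.

Lemma Clim_CSeries : Clim (Csum a) (CSeries a).
Proof.
  assert (Hex : ex_series (fun k => M * q ^ k)).
  { apply (ex_series_scal_l M (fun k => q ^ k)). apply ex_series_geom. rewrite Rabs_pos_eq; lra. }
  assert (Hre : ex_series (fun k => Re (a k))).
  { apply (ex_series_le (V := R_CompleteNormedModule)) with (2 := Hex).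
    intros k. apply Rle_trans with (2 := Ha k). apply re_le_Cmod. }
  assert (Him : ex_series (fun k => Im (a k))).
  { apply (ex_series_le (V := R_CompleteNormedModule)) with (2 := Hex).
    intros k. apply Rle_trans with (2 := Ha k). apply Cmod_im_le. }
  apply Series_correct in Hre. apply Series_correct in Him.
  assert (Lre : is_lim_seq (sum_n (fun k => Re (a k))) (Series (fun k => Re (a k)))) by exact Hre.
  assert (Lim' : is_lim_seq (sum_n (fun k => Im (a k))) (Series (fun k => Im (a k)))) by exact Him.
  apply is_lim_seq_spec in Lre. apply is_lim_seq_spec in Lim'.
  intros eps He. assert (He2 : 0 < eps / 2) by lra.
  destruct (Lre (mkposreal _ He2)) as [N1 H1]. destruct (Lim' (mkposreal _ He2)) as [N2 H2].
  exists (N1 + N2)%nat. intros n Hn.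
  specialize (H1 n ltac:(lia)). specialize (H2 n ltac:(lia)). simpl in H1, H2.
  rewrite Csum_pair. unfold CSeries.
  replace (_ - _)%C with (RtoC (sum_n (fun k => Re (a k)) n - Series (fun k => Re (a k)))
    + Ci * RtoC (sum_n (fun k => Im (a k)) n - Series (fun k => Im (a k))))%C.
  2: { apply injective_projections; simpl; ring. }
  eapply Rle_lt_trans; [apply Cmod_triangle|]. rewrite Cmod_mult, Cmod_Ci, 2!Cmod_R. lra.
Qed.

Lemma CSeries_bound : Cmod (CSeries a) <= M / (1 - q).
Proof. apply Clim_bound with (1 := Clim_CSeries). apply Csum_geometric_bound. Qed.

End GeometricSeries.

Lemma CSeries_unique (a : nat -> C) (M q : R) (l : C) : 0 <= q < 1 ->
  (forall k, Cmod (a k) <= M * q ^ k) -> Clim (Csum a) l -> CSeries a = l.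
Proof. intros Hq Ha Hl. apply Clim_unique with (Csum a); trivial. now apply Clim_CSeries with M q. Qed.

Lemma CSeries_shift (a : nat -> C) (M q : R) (n : nat) : 0 <= q < 1 ->
  (forall k, Cmod (a k) <= M * q ^ k) ->
  CSeries a = (Csum a n + CSeries (fun k => a (S n + k)%nat))%C.
Proof.
  intros Hq Ha. apply CSeries_unique with M q; trivial.
  assert (K : Clim (Csum (fun k => a (S n + k)%nat)) (CSeries (fun k => a (S n + k)%nat))).
  { apply Clim_CSeries with (M * q ^ S n) q; trivial.
    intros k. rewrite Rmult_assoc, <- pow_add. apply Ha. }
  intros eps He. destruct (K eps He) as [N HN]. exists (S n + N)%nat. intros m Hm.
  replace m with (S n + (m - S n))%nat by lia. rewrite Csum_shift.
  replace (_ - _)%C with (Csum (fun k => a (S n + k)%nat) (m - S n) - CSeries (fun k => a (S n + k)%nat))%C by ring.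
  apply HN. lia.
Qed.

Lemma CSeries_tail (a : nat -> C) (M q : R) (n : nat) : 0 <= q < 1 ->
  (forall k, Cmod (a k) <= M * q ^ k) ->
  Cmod (CSeries a - Csum a n) <= M * q ^ S n / (1 - q).
Proof.
  intros Hq Ha. rewrite (CSeries_shift a M q n Hq Ha).
  replace (_ - _)%C with (CSeries (fun k => a (S n + k)%nat)) by ring.
  apply CSeries_bound; trivial. intros k. rewrite Rmult_assoc, <- pow_add. apply Ha.
Qed.

Lemma CSeries_ext (a b : nat -> C) : (forall k, a k = b k) -> CSeries a = CSeries b.
Proof. intros E. unfold CSeries. f_equal; apply Series_ext; intros k; now rewrite E. Qed.

Lemma CSeries_scal (c : C) (a : nat -> C) (M q : R) : 0 <= q < 1 ->
  (forall k, Cmod (a k) <= M * q ^ k) -> CSeries (fun k => c * a k)%C = (c * CSeries a)%C.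
Proof.
  intros Hq Ha. apply CSeries_unique with (Cmod c * M) q; trivial.
  - intros k. rewrite Cmod_mult, Rmult_assoc. apply Rmult_le_compat_l; trivial. apply Cmod_ge_0.
  - apply Clim_ext with (fun n => c * Csum a n)%C. intros n. now rewrite Csum_scal.
    apply Clim_scal. now apply Clim_CSeries with M q.
Qed.

Definition CPSeries (a : nat -> C) (u : C) : C := CSeries (fun k => a k * u ^ k)%C.

(** The coefficients of [(CPSeries a y - CPSeries a u) / (y - u)] as a power series in [y]. *)
Definition power_series_quotient (a : nat -> C) (u : C) (j : nat) : C :=
  CSeries (fun i => a (S j + i)%nat * u ^ i)%C.

Section PowerSeries.
Context (a : nat -> C) (M q : R) (Hq : 0 <= q) (Ha : forall k, Cmod (a k) <= M * q ^ k).

Lemma CPSeries_term_bound (u : C) (k : nat) : Cmod (a k * u ^ k) <= M * (q * Cmod u) ^ k.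
Proof.
  rewrite Cmod_mult, Cmod_pow, Rpow_mult_distr, <- Rmult_assoc.
  apply Rmult_le_compat_r; trivial. apply pow_le, Cmod_ge_0.
Qed.

Lemma radius_nonneg (u : C) : q * Cmod u < 1 -> 0 <= q * Cmod u < 1.
Proof. intros H. split; trivial. apply Rmult_le_pos; trivial. apply Cmod_ge_0. Qed.

Lemma Clim_CPSeries (u : C) : q * Cmod u < 1 -> Clim (Csum (fun k => a k * u ^ k)%C) (CPSeries a u).
Proof.
  intros H. apply Clim_CSeries with M (q * Cmod u). now apply radius_nonneg. apply CPSeries_term_bound.
Qed.

Lemma CPSeries_bound (u : C) (s : R) : q * Cmod u <= s -> s < 1 -> Cmod (CPSeries a u) <= M / (1 - s).
Proof.
  intros H Hs. assert (0 <= q * Cmod u) by (apply Rmult_le_pos; trivial; apply Cmod_ge_0).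
  apply CSeries_bound. lra.
  intros k. apply Rle_trans with (1 := CPSeries_term_bound u k).
  apply Rmult_le_compat_l. exact (geometric_bound_nonneg a M q Ha).
  apply pow_incr. lra.
Qed.

Lemma CPSeries_tail (u : C) (s : R) (n : nat) : q * Cmod u <= s -> s < 1 ->
  Cmod (CPSeries a u - Csum (fun k => a k * u ^ k)%C n) <= M * s ^ S n / (1 - s).
Proof.
  intros H Hs. assert (0 <= q * Cmod u) by (apply Rmult_le_pos; trivial; apply Cmod_ge_0).
  apply CSeries_tail. lra.
  intros k. apply Rle_trans with (1 := CPSeries_term_bound u k).
  apply Rmult_le_compat_l. exact (geometric_bound_nonneg a M q Ha).
  apply pow_incr. lra.
Qed.

Lemma quotient_term_bound (u : C) (j i : nat) :
  Cmod (a (S j + i)%nat * u ^ i) <= M * q ^ S j * (q * Cmod u) ^ i.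
Proof.
  rewrite Cmod_mult, Cmod_pow, Rpow_mult_distr, <- Rmult_assoc.
  apply Rmult_le_compat_r. apply pow_le, Cmod_ge_0.
  rewrite Rmult_assoc, <- pow_add. apply Ha.
Qed.

Lemma power_series_quotient_bound (u : C) (j : nat) : q * Cmod u < 1 ->
  Cmod (power_series_quotient a u j) <= M * q / (1 - q * Cmod u) * q ^ j.
Proof.
  intros Hu. replace (M * q / (1 - q * Cmod u) * q ^ j) with (M * q ^ S j / (1 - q * Cmod u)).
  2: { simpl. field. lra. }
  apply CSeries_bound. now apply radius_nonneg. apply quotient_term_bound.
Qed.

Lemma power_series_quotient_rec (u : C) (j : nat) : q * Cmod u < 1 ->
  power_series_quotient a u j = (a (S j) + u * power_series_quotient a u (S j))%C.
Proof.
  intros Hu. unfold power_series_quotient.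
  rewrite (CSeries_shift _ (M * q ^ S j) (q * Cmod u) 0 (radius_nonneg u Hu) (quotient_term_bound u j)).
  rewrite Csum_O, <- (CSeries_scal _ _ (M * q ^ S (S j)) (q * Cmod u) (radius_nonneg u Hu) (quotient_term_bound u (S j))).
  rewrite Nat.add_0_r. simpl (u ^ 0)%C. rewrite Cmult_1_r. f_equal. apply CSeries_ext.
  intros k. replace (S j + (1 + k))%nat with (S (S j) + k)%nat by lia.
  change (1 + k)%nat with (S k). simpl (u ^ S k)%C. ring.
Qed.

Lemma CPSeries_head (u : C) : q * Cmod u < 1 ->
  CPSeries a u = (a O + u * power_series_quotient a u 0)%C.
Proof.
  intros Hu. unfold CPSeries, power_series_quotient.
  rewrite (CSeries_shift _ M (q * Cmod u) 0 (radius_nonneg u Hu) (CPSeries_term_bound u)).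
  rewrite Csum_O, <- (CSeries_scal _ _ (M * q ^ 1) (q * Cmod u) (radius_nonneg u Hu) (quotient_term_bound u 0)).
  simpl (u ^ 0)%C. rewrite Cmult_1_r. f_equal. apply CSeries_ext.
  intros k. change (1 + k)%nat with (S k). simpl (u ^ S k)%C. ring.
Qed.

(** Synthetic division. The recursion [b n = a (S n) + u * b (S n)] makes the partial sums telescope
    up to the boundary term [b n * y^(n+1)], which tends to 0. *)
Lemma CPSeries_division (u y : C) : q * Cmod u < 1 -> q * Cmod y < 1 ->
  CPSeries a y = (CPSeries a u + (y - u) * CPSeries (power_series_quotient a u) y)%C.
Proof.
  intros Hu Hy.
  set (b := power_series_quotient a u).
  set (M' := M * q / (1 - q * Cmod u)).
  assert (Hb : forall k, Cmod (b k) <= M' * q ^ k).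
  { intros k. now apply power_series_quotient_bound. }
  assert (Hby : forall k, Cmod (b k * y ^ k) <= M' * (q * Cmod y) ^ k).
  { intros k. rewrite Cmod_mult, Cmod_pow, Rpow_mult_distr, <- Rmult_assoc.
    apply Rmult_le_compat_r; trivial. apply pow_le, Cmod_ge_0. }
  apply CSeries_unique with M (q * Cmod y). now apply radius_nonneg. apply CPSeries_term_bound.
  assert (E : forall n, Csum (fun k => a k * y ^ k)%C n
    = (CPSeries a u + (y - u) * Csum (fun k => b k * y ^ k)%C n - y * (b n * y ^ n))%C).
  { induction n.
    - rewrite 2!Csum_O, (CPSeries_head u Hu). fold b. simpl. ring.
    - rewrite 2!Csum_S, IHn. unfold b at 4.
      replace (a (S n)) with (b n - u * b (S n))%C.
      2: { unfold b. rewrite (power_series_quotient_rec u n Hu). ring. }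
      fold b. rewrite Cpow_S. ring. }
  apply Clim_ext with (fun n => CPSeries a u + (y - u) * Csum (fun k => b k * y ^ k)%C n - y * (b n * y ^ n))%C.
  { intros n. now rewrite E. }
  replace (CPSeries a u + (y - u) * CPSeries b y)%C
    with (CPSeries a u + (y - u) * CPSeries b y - y * 0)%C by ring.
  apply Clim_minus; [apply Clim_plus|]; [apply Clim_const|apply Clim_scal|apply Clim_scal].
  - apply Clim_CSeries with M' (q * Cmod y); trivial. now apply radius_nonneg.
  - apply Clim_le_0 with (fun n => M' * (q * Cmod y) ^ n).
    + intros n. replace (_ - 0)%C with (b n * y ^ n)%C by ring. apply Hby.
    + replace (Finite 0) with (Rbar_mult (Finite M') (Finite 0)) by (simpl; f_equal; ring).
      apply is_lim_seq_scal_l. apply is_lim_seq_geom.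
      rewrite Rabs_pos_eq; now apply radius_nonneg.
Qed.

Lemma radius_locally (u : C) : q * Cmod u < 1 ->
  exists d s, 0 < d /\ s < 1 /\ forall y, Cmod (y - u) < d -> q * Cmod y <= s.
Proof.
  intros Hu. exists ((1 - q * Cmod u) / (2 * (q + 1))), ((1 + q * Cmod u) / 2).
  split; [|split].
  - apply Rdiv_lt_0_compat; lra.
  - lra.
  - intros y Hy. generalize (Cmod_sub_ge y u). intros H1.
    assert (H2 : Cmod y <= Cmod u + (1 - q * Cmod u) / (2 * (q + 1))) by lra.
    apply Rmult_le_compat_l with (r := q) in H2; trivial.
    apply Rle_trans with (1 := H2).
    assert (H3 : q * ((1 - q * Cmod u) / (2 * (q + 1))) <= (q + 1) * ((1 - q * Cmod u) / (2 * (q + 1)))).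
    { apply Rmult_le_compat_r; [|lra]. apply Rlt_le, Rdiv_lt_0_compat; lra. }
    replace ((q + 1) * ((1 - q * Cmod u) / (2 * (q + 1)))) with ((1 - q * Cmod u) / 2) in H3 by (field; lra).
    lra.
Qed.

End PowerSeries.

Lemma Ccontinuous_CPSeries (a : nat -> C) (M q : R) (u : C) : 0 <= q ->
  (forall k, Cmod (a k) <= M * q ^ k) -> q * Cmod u < 1 ->
  Ccontinuous (T := C_UniformSpace) (CPSeries a) u.
Proof.
  intros Hq Ha Hu eps He.
  destruct (radius_locally q Hq u Hu) as [d [s [Hd [Hs H]]]].
  assert (Hb : forall k, Cmod (power_series_quotient a u k) <= M * q / (1 - q * Cmod u) * q ^ k).
  { intros k. now apply power_series_quotient_bound. }
  set (M' := M * q / (1 - q * Cmod u)) in *.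
  assert (HM' := geometric_bound_nonneg _ _ _ Hb).
  set (B := M' / (1 - s)).
  assert (HB : 0 <= B) by (apply Rmult_le_pos; [trivial|apply Rlt_le, Rinv_0_lt_compat; lra]).
  apply locally_Cmod_intro with (Rmin d (eps / (B + 1))).
  { apply Rmin_glb_lt; trivial. apply Rdiv_lt_0_compat; lra. }
  intros y Hy.
  assert (Hy1 := Rlt_le_trans _ _ _ Hy (Rmin_l _ _)).
  assert (Hy2 := Rlt_le_trans _ _ _ Hy (Rmin_r _ _)).
  specialize (H y Hy1).
  rewrite (CPSeries_division a M q Hq Ha u y) by lra.
  replace (_ - _)%C with ((y - u) * CPSeries (power_series_quotient a u) y)%C by ring.
  rewrite Cmod_mult.
  assert (K := CPSeries_bound _ M' q Hq Hb y s H Hs). fold B in K.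
  apply Rle_lt_trans with (Cmod (y - u) * B).
  - apply Rmult_le_compat_l; trivial. apply Cmod_ge_0.
  - apply Rle_lt_trans with (Cmod (y - u) * (B + 1)).
    + apply Rmult_le_compat_l. apply Cmod_ge_0. lra.
    + replace eps with (eps / (B + 1) * (B + 1)) by (field; lra).
      apply Rmult_lt_compat_r; lra.
Qed.

(** The quotient series is the slope in the sense of Caratheodory, and it is continuous because its
    coefficients obey a bound with the same [q]. *)
Lemma Cdiffable_CPSeries (a : nat -> C) (M q : R) (u : C) : 0 <= q ->
  (forall k, Cmod (a k) <= M * q ^ k) -> q * Cmod u < 1 -> Cdiffable (CPSeries a) u.
Proof.
  intros Hq Ha Hu. exists (CPSeries (power_series_quotient a u)). split.
  - apply Ccontinuous_CPSeries with (M * q / (1 - q * Cmod u)) q; trivial.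
    intros k. now apply power_series_quotient_bound.
  - destruct (radius_locally q Hq u Hu) as [d [s [Hd [Hs H]]]].
    apply locally_Cmod_intro with d; trivial. intros y Hy. specialize (H y Hy).
    rewrite (CPSeries_division a M q Hq Ha u y) by lra. ring.
Qed.

Lemma CPSeries_0 (a : nat -> C) : CPSeries a 0 = a O.
Proof.
  unfold CPSeries. apply CSeries_unique with (Cmod (a O)) 0; [lra| |].
  - intros [|k]; simpl.
    + replace (a O * 1)%C with (a O) by ring. lra.
    + replace (a (S k) * (0 * 0 ^ k))%C with (RtoC 0) by ring. rewrite Cmod_0. lra.
  - apply Clim_ext with (fun _ => a O); [|apply Clim_const].
    intros n. induction n.
    + rewrite Csum_O. simpl. ring.
    + rewrite Csum_S, <- IHn. simpl. ring.
Qed.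

(** The radius of convergence is at least [1 / rho]. No rate is claimed for [q = rho], where the
    coefficients may carry subexponential factors. *)
Definition coef_decay (a : nat -> C) (rho : R) : Prop :=
  forall q, rho < q -> exists M, forall k, Cmod (a k) <= M * q ^ k.

Lemma radius_between (rho x : R) : 0 <= x -> rho * x < 1 -> exists q, rho < q /\ q * x < 1.
Proof.
  intros Hx H. exists (rho + (1 - rho * x) / (2 * (x + 1))).
  assert (Hp : 0 < (1 - rho * x) / (2 * (x + 1))) by (apply Rdiv_lt_0_compat; lra).
  split. lra.
  set (y := (1 - rho * x) / (2 * (x + 1))) in *.
  assert (Ex : y * (x + 1) = (1 - rho * x) / 2) by (unfold y; field; lra). nra.
Qed.

Lemma coef_decay_Cdiffable (a : nat -> C) (rho : R) (u : C) : 0 <= rho -> coef_decay a rho ->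
  rho * Cmod u < 1 -> Cdiffable (CPSeries a) u.
Proof.
  intros Hrho Ha Hu. destruct (radius_between rho (Cmod u) (Cmod_ge_0 u) Hu) as [q [Hq1 Hq2]].
  destruct (Ha q Hq1) as [M HM]. apply Cdiffable_CPSeries with M q; trivial. lra.
Qed.

Lemma coef_decay_quotient (a : nat -> C) (rho : R) (u : C) : 0 <= rho -> coef_decay a rho ->
  rho * Cmod u < 1 -> coef_decay (power_series_quotient a u) rho.
Proof.
  intros Hrho Ha Hu q Hq. destruct (radius_between rho (Cmod u) (Cmod_ge_0 u) Hu) as [q1 [Hq1 Hq2]].
  (* The quotient bound requires a rate [p] with [p * Cmod u < 1]; it is relaxed to [q]
     afterwards. *)
  set (p := Rmin q q1).
  assert (Hp : rho < p) by now apply Rmin_glb_lt.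
  assert (Hpq : p <= q) by apply Rmin_l. assert (Hpq1 : p <= q1) by apply Rmin_r.
  assert (Hpu : p * Cmod u < 1).
  { apply Rle_lt_trans with (2 := Hq2). apply Rmult_le_compat_r; trivial. apply Cmod_ge_0. }
  destruct (Ha p Hp) as [M HM].
  assert (K := fun k => power_series_quotient_bound a M p ltac:(lra) HM u k Hpu).
  exists (M * p / (1 - p * Cmod u)). intros k. apply Rle_trans with (1 := K k).
  apply Rmult_le_compat_l; [|apply pow_incr; lra]. exact (geometric_bound_nonneg _ _ _ K).
Qed.

Lemma coef_decay_division (a : nat -> C) (rho : R) (u y : C) : 0 <= rho -> coef_decay a rho ->
  rho * Cmod u < 1 -> rho * Cmod y < 1 ->
  CPSeries a y = (CPSeries a u + (y - u) * CPSeries (power_series_quotient a u) y)%C.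
Proof.
  intros Hrho Ha Hu Hy.
  destruct (radius_between rho (Cmod u) (Cmod_ge_0 u) Hu) as [q1 [Hq1 Hq1']].
  destruct (radius_between rho (Cmod y) (Cmod_ge_0 y) Hy) as [q2 [Hq2 Hq2']].
  set (p := Rmin q1 q2).
  assert (Hp : rho < p) by now apply Rmin_glb_lt.
  destruct (Ha p Hp) as [M HM].
  apply (CPSeries_division a M p); trivial. lra.
  - apply Rle_lt_trans with (2 := Hq1'). apply Rmult_le_compat_r. apply Cmod_ge_0. apply Rmin_l.
  - apply Rle_lt_trans with (2 := Hq2'). apply Rmult_le_compat_r. apply Cmod_ge_0. apply Rmin_r.
Qed.

(** * Laurent expansions and the logarithm of the weight *)

Lemma circle_bounded (f : C -> C) (c : C) (r : R) : 0 <= r ->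
  (forall z, Cmod (z - c) = r -> Ccontinuous (T := C_UniformSpace) f z) ->
  exists M, forall z, Cmod (z - c) = r -> Cmod (f z) <= M.
Proof.
  intros Hr Hf.
  destruct (continuity_ab_maj (fun t => Cmod (f (c + RtoC r * cis t)%C)) (- PI) PI) as [t0 [H _]].
  - generalize PI_RGT_0. lra.
  - intros t _. apply continuity_pt_filterlim.
    apply (Ccontinuous_Re (T := R_UniformSpace) (fun t => RtoC (Cmod (f (c + RtoC r * cis t)%C)))).
    apply (Ccontinuous_mod (T := R_UniformSpace) (fun t => f (c + RtoC r * cis t)%C)).
    apply Ccontinuous_circle, Hf.
    now apply Cmod_circle_point.
  - exists (Cmod (f (c + RtoC r * cis t0)%C)). intros z Hz.
    destruct (polar (z - c)) as [t [Ht E]]. rewrite Hz in E.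
    replace z with (c + RtoC r * cis t)%C by (rewrite <- E; ring). now apply H.
Qed.

Lemma RtoC_neq_0 (x : R) : x <> 0 -> RtoC x <> RtoC 0.
Proof. intros H E. now apply H, RtoC_inj. Qed.

Lemma fourier_coef_circle_pos (f : C -> C) (r : R) (k : nat) : 0 < r ->
  (forall z, Cmod z = r -> Ccontinuous (T := C_UniformSpace) f z) ->
  fourier_coef (fun t => f (RtoC r * cis t)%C) (Z.of_nat k)
  = (RtoC r ^ k * circle_mean (fun z => f z / z ^ k) 0 r)%C.
Proof.
  intros Hr Hf. unfold fourier_coef, circle_mean.
  rewrite (CInt_ext _ _ (Rlt_le _ _ two_PI_pos) _ (fun t => RtoC r ^ k * (f (0 + RtoC r * cis t) / (0 + RtoC r * cis t) ^ k))%C).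
  - rewrite (CInt_scal _ _ (Rlt_le _ _ two_PI_pos)).
    + field. apply two_PI_neq_0.
    + intros t _.
      apply (Ccontinuous_circle (fun z => f z / z ^ k)%C 0 r t).
      assert (Hz : Cmod (0 + RtoC r * cis t) = r).
      { replace (0 + RtoC r * cis t)%C with (RtoC r * cis t)%C by ring. apply Cmod_RtoC_cis. lra. }
      apply Ccontinuous_div. apply Cpow_nz, Cmod_gt_0. rewrite Hz. trivial.
      now apply Hf. smooth.
  - intros t _. replace (0 + RtoC r * cis t)%C with (RtoC r * cis t)%C by ring.
    rewrite Cpow_mult_l, cis_opp, <- INR_IZR_INZ, <- cis_pow. field.
    split. apply Cpow_nz, cis_neq_0. apply Cpow_nz, RtoC_neq_0. lra.
Qed.

Lemma fourier_coef_circle_neg (f : C -> C) (r : R) (k : nat) : 0 < r ->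
  (forall z, Cmod z = r -> Ccontinuous (T := C_UniformSpace) f z) ->
  fourier_coef (fun t => f (RtoC r * cis t)%C) (- Z.of_nat k)
  = (/ RtoC r ^ k * circle_mean (fun z => f z * z ^ k) 0 r)%C.
Proof.
  intros Hr Hf. unfold fourier_coef, circle_mean.
  rewrite (CInt_ext _ _ (Rlt_le _ _ two_PI_pos) _ (fun t => / RtoC r ^ k * (f (0 + RtoC r * cis t) * (0 + RtoC r * cis t) ^ k))%C).
  - rewrite (CInt_scal _ _ (Rlt_le _ _ two_PI_pos)).
    + field. split. apply two_PI_neq_0. apply Cpow_nz, RtoC_neq_0. lra.
    + intros t _.
      apply (Ccontinuous_circle (fun z => f z * z ^ k)%C 0 r t).
      assert (Hz : Cmod (0 + RtoC r * cis t) = r).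
      { replace (0 + RtoC r * cis t)%C with (RtoC r * cis t)%C by ring. apply Cmod_RtoC_cis. lra. }
      smooth.
  - intros t _. replace (0 + RtoC r * cis t)%C with (RtoC r * cis t)%C by ring.
    rewrite opp_IZR, <- INR_IZR_INZ, Cpow_mult_l, cis_pow.
    replace (- (- INR k * t)) with (INR k * t) by ring. field.
    apply Cpow_nz, RtoC_neq_0. lra.
Qed.

Section LaurentExpansion.
Context (f : C -> C) (c : nat -> C) (q r0 : R).
Context (Hq : 0 <= q) (Hr0 : 0 < r0) (Hqr0 : q * r0 < 1).
Context (Hf : forall u, u <> RtoC 0 -> q * Cmod u < 1 -> Cdiffable f u).
Context (Hpos : forall k, circle_mean (fun u => f u / u ^ k)%C 0 r0 = c k).

Let Hrad (r : R) (z : C) : 0 < r -> q * r < 1 -> Rmin r r0 <= Cmod (z - 0) <= Rmax r r0 ->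
  z <> RtoC 0 /\ q * Cmod z < 1.
Proof.
  intros Hr Hqr. replace (z - 0)%C with z by ring. intros Hz.
  assert (H0 : 0 < Rmin r r0) by now apply Rmin_glb_lt.
  split.
  - apply Cmod_gt_0. lra.
  - apply Rle_lt_trans with (q * Rmax r r0). apply Rmult_le_compat_l; lra.
    unfold Rmax. destruct (Rle_dec r r0); trivial.
Qed.

Lemma laurent_mean_pos (r : R) (k : nat) : 0 < r -> q * r < 1 ->
  circle_mean (fun u => f u / u ^ k)%C 0 r = c k.
Proof.
  intros Hr Hqr. rewrite <- Hpos. apply circle_mean_annulus; trivial.
  intros z Hz. destruct (Hrad r z Hr Hqr Hz) as [H1 H2].
  apply Cdiffable_div. now apply Cpow_nz. now apply Hf. smooth.
Qed.

(** Cauchy's estimate on the circle of radius [r]. *)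
Lemma laurent_coef_bound (r : R) : 0 < r -> q * r < 1 ->
  exists M, forall k, Cmod (c k) <= M * (/ r) ^ k.
Proof.
  intros Hr Hqr.
  assert (Hc : forall z, Cmod (z - 0) = r -> z <> RtoC 0 /\ Ccontinuous (T := C_UniformSpace) f z).
  { intros z. replace (z - 0)%C with z by ring. intros Hz.
    assert (Hz0 : z <> RtoC 0) by (apply Cmod_gt_0; lra).
    split; trivial. apply Cdiffable_continuous, Hf; trivial. now rewrite Hz. }
  destruct (circle_bounded f 0 r) as [M HM]. lra. intros z Hz. now apply Hc.
  exists M. intros k. rewrite <- (laurent_mean_pos r k Hr Hqr).
  apply circle_mean_bound. lra.
  - intros z Hz. destruct (Hc z Hz) as [Hz0 Hfz]. apply Ccontinuous_div; trivial. now apply Cpow_nz.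
    smooth.
  - intros z Hz. destruct (Hc z Hz) as [Hz0 Hfz].
    rewrite Cmod_div by now apply Cpow_nz. rewrite Cmod_pow.
    assert (Hzr : Cmod z = r). { rewrite <- Hz. f_equal. ring. }
    rewrite Hzr, pow_inv. apply Rmult_le_compat_r. apply Rlt_le, Rinv_0_lt_compat, pow_lt, Hr.
    now apply HM.
Qed.

Lemma laurent_coef_decay : coef_decay c q.
Proof.
  intros q' Hq'. destruct (laurent_coef_bound (/ q')) as [M HM].
  - apply Rinv_0_lt_compat. lra.
  - apply Rmult_lt_reg_r with q'; [lra|]. rewrite Rmult_assoc, Rinv_l; lra.
  - exists M. intros k. rewrite <- (Rinv_inv q'). apply HM.
Qed.

Context (Hneg : forall k, circle_mean (fun u => f u * u ^ S k)%C 0 r0 = RtoC 0).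

Lemma laurent_mean_neg (r : R) (k : nat) : 0 < r -> q * r < 1 ->
  circle_mean (fun u => f u * u ^ S k)%C 0 r = RtoC 0.
Proof.
  intros Hr Hqr. etransitivity; [|apply (Hneg k)]. apply circle_mean_annulus; trivial.
  intros z Hz. destruct (Hrad r z Hr Hqr Hz) as [H1 H2].
  smooth.
Qed.

(** On the circle through [u], the Fourier coefficients of [f] of index [k >= 0] are [r^k * c k] and
    those of negative index vanish, whatever the radius; the Fourier series then converges to [f u]
    at the argument of [u]. *)
Theorem laurent_expansion (u : C) : u <> RtoC 0 -> q * Cmod u < 1 ->
  f u = CPSeries c u.
Proof.
  intros Hu Hqu.
  assert (Hr : 0 < Cmod u) by now apply Cmod_gt_0.
  set (r := Cmod u) in *.
  destruct (polar u) as [t0 [_ Et]]. fold r in Et.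
  assert (Hfc : forall z, Cmod z = r -> Ccontinuous (T := C_UniformSpace) f z).
  { intros z Hz. apply Cdiffable_continuous, Hf. apply Cmod_gt_0. lra. now rewrite Hz. }
  assert (K := fourier_series_converges (fun z => f (RtoC r * z)%C) t0).
  assert (E0 : f (RtoC r * cis t0)%C = f u) by now rewrite <- Et. cbv beta zeta in K. rewrite E0 in K.
  symmetry.
  (* Strictly between [q] and [1 / r]: above [q] to have a coefficient bound, below [1 / r] to have
     convergence at [u]. *)
  set (q' := (q + / r) / 2).
  assert (Hir : q < / r).
  { apply Rmult_lt_reg_r with r; trivial. rewrite Rinv_l; lra. }
  destruct (laurent_coef_decay q') as [M HM]. { unfold q'. lra. }
  assert (Hq'r : q' * Cmod u < 1).
  { fold r. unfold q'. apply Rmult_lt_reg_r with (/ r). now apply Rinv_0_lt_compat.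
    rewrite Rmult_assoc, Rinv_r; lra. }
  assert (Hq'0 : 0 <= q') by (unfold q'; lra).
  apply CSeries_unique with M (q' * Cmod u).
  - now apply radius_nonneg.
  - now apply CPSeries_term_bound.
  - apply Clim_ext with (2 := K ltac:(
      intros z Hz; apply (Ccontinuous_comp f (fun z => RtoC r * z)%C);
      [apply Hfc; rewrite Cmod_mult, Cmod_R, Rabs_pos_eq, Hz; lra
      |apply Ccontinuous_mult; [apply Ccontinuous_const|apply Ccontinuous_id]])
      ltac:(apply (Cdiffable_comp f (fun z => RtoC r * z)%C);
      [apply Hf; [rewrite <- Et; exact Hu|rewrite <- Et; exact Hqu]
      |apply Cdiffable_mult; [apply Cdiffable_const|apply Cdiffable_id]])).
    intros n.
    assert (E1 : forall k, fourier_coef (fun t => f (RtoC r * cis t)%C) (Z.of_nat k) = (RtoC r ^ k * c k)%C).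
    { intros k. rewrite fourier_coef_circle_pos, laurent_mean_pos; trivial. }
    assert (E2 : forall k, fourier_coef (fun t => f (RtoC r * cis t)%C) (- Z.of_nat (S k)) = RtoC 0).
    { intros k. rewrite fourier_coef_circle_neg, laurent_mean_neg; trivial. ring. }
    rewrite (Csum_ext (fun j => fourier_coef _ (- Z.of_nat (S j)) * _)%C (fun _ => RtoC 0 * RtoC 0)%C).
    2: { intros k _. rewrite E2. ring. }
    rewrite Csum_scal, Cmult_0_l, Cplus_0_r.
    apply Csum_ext. intros k _. rewrite E1, Et, Cpow_mult_l, cis_pow, INR_IZR_INZ. ring.
Qed.

End LaurentExpansion.

(** In polar coordinates each point of the circle has a product neighbourhood inside [V];
    compactness of the interval of angles gives a common radial width. *)
Lemma circle_neighbourhood (V : C -> Prop) :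
  (forall z, Cmod z = 1 -> locally (T := C_UniformSpace) z V) ->
  exists eta, 0 < eta /\ forall z, Rabs (Cmod z - 1) < eta -> V z.
Proof.
  intros HV.
  assert (Hg : forall t, exists d : posreal, forall x r, Rabs (x - t) < d -> Rabs (r - 1) < d ->
     V (RtoC r * cis x)%C).
  { intros t. assert (K := HV (cis t) (Cmod_cis t)). apply locally_Cmod in K.
    destruct K as [d [Hd K]]. assert (Hd2 : 0 < d / 2) by lra.
    destruct (Ccontinuous_cis t _ Hd2) as [e He].
    assert (Hm : 0 < Rmin (d / 2) e) by (apply Rmin_glb_lt; [lra|apply cond_pos]).
    exists (mkposreal _ Hm). simpl. intros x r Hx Hr. apply K.
    assert (Hx' : Cmod (cis x - cis t) < d / 2).
    { apply He. apply Rlt_le_trans with (1 := Hx). apply Rmin_r. }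
    replace (RtoC r * cis x - cis t)%C with (RtoC (r - 1) * cis x + (cis x - cis t))%C
      by (rewrite RtoC_minus; ring).
    eapply Rle_lt_trans; [apply Cmod_triangle|]. rewrite Cmod_mult, Cmod_cis, Cmod_R.
    generalize (Rmin_l (d / 2) e). lra. }
  set (delta := fun t => proj1_sig (constructive_indefinite_description _ (Hg t))).
  destruct (compactness_value_1d (- PI) PI delta) as [d Hd].
  exists d. split; [apply cond_pos|]. intros z Hz.
  destruct (polar z) as [x [Hx E]]. apply NNPP. intros HnV. apply (Hd x Hx).
  intros [t [Ht [H1 H2]]]. apply HnV. rewrite E.
  unfold delta in *. destruct (constructive_indefinite_description _ (Hg t)) as [dt Hdt].
  simpl in *. apply Hdt; trivial. lra.
Qed.

(** The derivative of the partial sum is the finite geometric sum [(1 - y^n) / (1 - y)], so only one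
    term survives for the remainder. *)
Lemma log_partial_sum_derive (n : nat) (y : R) : y < 1 ->
  is_derive (fun y => sum_n (fun k => / INR k * y ^ k) n + ln (1 - y)) y (- (y ^ n / (1 - y))).
Proof.
  intros Hy. induction n.
  - apply (is_derive_ext (fun y => ln (1 - y))).
    + intros t. rewrite sum_O. simpl. rewrite Rinv_0. ring.
    + auto_derive. lra. simpl. field. lra.
  - apply (is_derive_ext (fun y => (sum_n (fun k => / INR k * y ^ k) n + ln (1 - y)) + / INR (S n) * y ^ S n)).
    + intros t. rewrite sum_Sn. unfold plus; simpl. ring.
    + replace (- (y ^ S n / (1 - y))) with (- (y ^ n / (1 - y)) + y ^ n) by (simpl; field; lra).
      apply (is_derive_plus (V := R_NormedModule) _ (fun y => / INR (S n) * y ^ S n)); trivial.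
      auto_derive; trivial. change (Nat.pred (S n)) with n.
      generalize (not_0_INR (S n) ltac:(lia)). set (x := INR (S n)). intros Hx. field. exact Hx.
Qed.

Lemma log_partial_sum_bound (n : nat) (x : R) : 0 <= x < 1 ->
  Rabs (sum_n (fun k => / INR k * x ^ k) n + ln (1 - x)) <= x ^ n / (1 - x).
Proof.
  intros Hx.
  destruct (MVT_gen (fun y => sum_n (fun k => / INR k * y ^ k) n + ln (1 - y)) 0 x
    (fun y => - (y ^ n / (1 - y)))) as [c [Hc E]].
  - rewrite Rmin_left, Rmax_right by lra. intros y Hy. apply log_partial_sum_derive. lra.
  - rewrite Rmin_left, Rmax_right by lra. intros y Hy.
    apply continuity_pt_filterlim, (ex_derive_continuous (V := R_NormedModule)
      (fun y => sum_n (fun k => / INR k * y ^ k) n + ln (1 - y))).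
    exists (- (y ^ n / (1 - y))). apply log_partial_sum_derive. lra.
  - rewrite Rmin_left, Rmax_right in Hc by lra. cbv beta in E.
    assert (E0 : sum_n (fun k => / INR k * 0 ^ k) n + ln (1 - 0) = 0).
    { rewrite Rminus_0_r, ln_1, Rplus_0_r. clear. induction n.
      - rewrite sum_O. simpl. rewrite Rinv_0. ring.
      - rewrite sum_Sn, IHn. unfold plus; simpl. ring. }
    rewrite E0, 2!Rminus_0_r in E. rewrite E, Rabs_mult, Rabs_Ropp, (Rabs_pos_eq x) by lra.
    rewrite Rabs_pos_eq.
    + apply Rle_trans with (c ^ n / (1 - c) * 1).
      * apply Rmult_le_compat_l; [|lra]. apply Rmult_le_pos. apply pow_le; lra.
        apply Rlt_le, Rinv_0_lt_compat; lra.
      * rewrite Rmult_1_r. apply Rmult_le_compat. apply pow_le; lra.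
        apply Rlt_le, Rinv_0_lt_compat; lra. apply pow_incr; lra.
        apply Rinv_le_contravar; lra.
    + apply Rmult_le_pos. apply pow_le; lra. apply Rlt_le, Rinv_0_lt_compat; lra.
Qed.

(* The constant term is [0], since [/ 0 = 0]. *)
Definition log_series (u : C) : C := CPSeries (fun k => RtoC (/ INR k)) u.

Lemma log_series_coef_bound (k : nat) : Cmod (RtoC (/ INR k)) <= 1 * 1 ^ k.
Proof.
  rewrite pow1, Rmult_1_r, Cmod_R. destruct k.
  - simpl. rewrite Rinv_0, Rabs_R0. lra.
  - rewrite Rabs_pos_eq.
    + rewrite <- Rinv_1. apply Rinv_le_contravar; [lra|]. rewrite S_INR. generalize (pos_INR k). lra.
    + apply Rlt_le, Rinv_0_lt_compat, lt_0_INR. lia.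
Qed.

Lemma log_series_real (x : R) : 0 <= x < 1 -> log_series (RtoC x) = RtoC (- ln (1 - x)).
Proof.
  intros Hx. apply CSeries_unique with 1 (1 * Cmod (RtoC x)).
  - rewrite Cmod_R, Rabs_pos_eq; lra.
  - apply (CPSeries_term_bound _ 1 1). apply log_series_coef_bound.
  - apply Clim_le_0 with (fun n => x ^ n / (1 - x)).
    + intros n. apply Rle_trans with (2 := log_partial_sum_bound n x Hx).
      rewrite <- Cmod_R. right. f_equal. rewrite RtoC_plus, RtoC_opp.
      assert (E : Csum (fun k => RtoC (/ INR k) * RtoC x ^ k)%C n = RtoC (sum_n (fun k => / INR k * x ^ k) n)).
      { clear. induction n.
        - rewrite Csum_O, sum_O. now rewrite RtoC_mult, RtoC_pow.
        - rewrite Csum_S, sum_Sn, IHn. unfold plus; simpl plus. rewrite RtoC_plus, RtoC_mult, RtoC_pow. reflexivity. }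
      rewrite E. ring.
    + unfold Rdiv. replace (Finite 0) with (Rbar_mult (Finite 0) (Finite (/ (1 - x)))) by (simpl; f_equal; ring).
      apply is_lim_seq_scal_r, is_lim_seq_geom. rewrite Rabs_pos_eq; lra.
Qed.

Section WeightLogarithm.
Context (w : C -> R) (hw : positive_analytic_weight w).

(** With [M] an upper bound of [w] on the circle, [W / M] has values in [(0, 1]] there, so
    [1 - W / M] has modulus below 1 on a neighbouring annulus. The logarithm is therefore [ln M]
    minus a convergent power series, and it is single-valued without any choice of branch. *)
Lemma weight_logarithm : exists (q : R) (Lg : C -> C), 0 < q < 1 /\
  (forall z, q < Cmod z -> q * Cmod z < 1 -> Cdiffable Lg z) /\
  (forall z, Cmod z = 1 -> Lg z = RtoC (ln (w z))).
Proof.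
  destruct hw as [Hpos [U [W [HU [HU1 [HW [_ HWw]]]]]]].
  assert (DW : forall z, U z -> Cdiffable W z).
  { intros z Hz. now apply ex_derive_Cdiffable, HW. }
  destruct (circle_bounded W 0 1) as [M HM]. lra.
  { intros z. replace (z - 0)%C with z by ring. intros Hz. now apply Cdiffable_continuous, DW, HU1. }
  assert (HwM : forall z, Cmod z = 1 -> 0 < w z <= M).
  { intros z Hz. split. now apply Hpos. rewrite <- (Rabs_pos_eq (w z)), <- Cmod_R, <- HWw; trivial.
    apply HM. now replace (z - 0)%C with z by ring. apply Rlt_le. now apply Hpos. }
  assert (HM0 : 0 < M).
  { generalize (HwM 1 Cmod_1). lra. }
  destruct (circle_neighbourhood (fun z => U z /\ Cmod (1 - W z / RtoC M) < 1)) as [eta [Heta HV]].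
  { intros z Hz. apply filter_and. apply open_locally_C; auto.
    assert (Cv : Ccontinuous (T := C_UniformSpace) (fun z => 1 - W z / RtoC M)%C z).
    { apply Ccontinuous_minus. apply Ccontinuous_const. apply Ccontinuous_div.
      apply RtoC_neq_0. lra. now apply Cdiffable_continuous, DW, HU1. smooth. }
    assert (Hlt : Cmod (1 - W z / RtoC M) < 1).
    { rewrite HWw by trivial. rewrite <- RtoC_div by lra. rewrite <- RtoC_minus, Cmod_R.
      assert (0 < w z / M <= 1).
      { destruct (HwM z Hz). split. apply Rdiv_lt_0_compat; lra.
        apply Rmult_le_reg_r with M; trivial. unfold Rdiv. rewrite Rmult_assoc, Rinv_l; lra. }
      rewrite Rabs_pos_eq; lra. }
    assert (He : 0 < 1 - Cmod (1 - W z / RtoC M)) by lra.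
    generalize (Cv _ He). apply filter_imp. intros y Hy.
    generalize (Cmod_sub_ge (1 - W y / RtoC M) (1 - W z / RtoC M)). lra. }
  assert (Hd : 0 < Rmin eta 1) by (apply Rmin_glb_lt; lra).
  set (e := Rmin eta 1) in *.
  assert (He1 : e <= 1) by apply Rmin_r. assert (He2 : e <= eta) by apply Rmin_l.
  (* As [1 - e < 1 / (1 + e / 2)], the annulus [q < |z| < 1 / q] stays within distance [e] of the
     circle. *)
  exists (/ (1 + e / 2)), (fun z => RtoC (ln M) - log_series (1 - W z / RtoC M))%C.
  assert (Hq : 0 < / (1 + e / 2) < 1).
  { split. apply Rinv_0_lt_compat; lra. rewrite <- Rinv_1. apply Rinv_lt_contravar; lra. }
  split; [exact Hq|split].
  - intros z H1 H2.
    assert (H3 : Cmod z < 1 + e / 2).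
    { apply Rmult_lt_reg_l with (/ (1 + e / 2)). lra. rewrite Rinv_l; lra. }
    assert (H4 : 1 - e < / (1 + e / 2)).
    { apply Rmult_lt_reg_r with (1 + e / 2). lra. rewrite Rinv_l by lra. nra. }
    destruct (HV z) as [K1 K2]. { apply Rabs_def1; lra. }
    apply Cdiffable_minus. apply Cdiffable_const.
    apply (Cdiffable_comp log_series (fun z => 1 - W z / RtoC M)%C).
    + apply Cdiffable_CPSeries with 1 1. lra. apply log_series_coef_bound. lra.
    + apply Cdiffable_minus. apply Cdiffable_const. apply Cdiffable_div.
      apply RtoC_neq_0. lra. now apply DW. smooth.
  - intros z Hz. rewrite HWw by trivial. destruct (HwM z Hz) as [K1 K2].
    rewrite <- RtoC_div by lra. rewrite <- RtoC_minus, log_series_real.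
    + rewrite <- RtoC_minus. f_equal.
      replace (1 - (1 - w z / M)) with (w z / M) by ring. rewrite ln_div; lra.
    + assert (0 < w z / M <= 1); [|lra].
      split. apply Rdiv_lt_0_compat; lra.
      apply Rmult_le_reg_r with M; trivial. unfold Rdiv. rewrite Rmult_assoc, Rinv_l; lra.
Qed.

End WeightLogarithm.

(** * The exterior Szego function *)

Lemma fourier_coef_ext (f g : R -> C) (k : Z) : (forall t, f t = g t) ->
  fourier_coef f k = fourier_coef g k.
Proof.
  intros E. unfold fourier_coef. f_equal. apply CInt_ext. apply Rlt_le, two_PI_pos.
  intros t _. now rewrite E.
Qed.

Lemma holomorphic_on_Cdiffable (U : C -> Prop) (f : C -> C) :
  holomorphic_on U f <-> forall z, U z -> Cdiffable f z.
Proof.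
  split; intros H z Hz. now apply ex_derive_Cdiffable, H. now apply Cdiffable_ex_derive, H.
Qed.

Section SzegoFunction.
Context (w : C -> R) (q : R) (Lg : C -> C).
Context (Hq : 0 < q < 1).
Context (HLd : forall z, q < Cmod z -> q * Cmod z < 1 -> Cdiffable Lg z).
Context (HLw : forall z, Cmod z = 1 -> Lg z = RtoC (ln (w z))).

Let ell (t : R) : C := RtoC (ln (w (cis t))).
(** Index [- k], since [a k] multiplies [z^(-k) = u^k]. *)
Let a (k : nat) : C := fourier_coef ell (- Z.of_nat k).
(** A radius strictly between [q] and 1, hence inside the annulus on which [Lg] is holomorphic. *)
Let q1 : R := (1 + q) / 2.
Let HP : 0 <= 2 * PI := Rlt_le _ _ two_PI_pos.

Lemma Ccontinuous_ell (t : R) : Ccontinuous (T := R_UniformSpace) ell t.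
Proof.
  apply Ccontinuous_ext_loc with (fun t => Lg (cis t)).
  - apply filter_forall. intros s. apply HLw, Cmod_cis.
  - apply (Ccontinuous_comp Lg cis); [|apply Ccontinuous_cis].
    apply Cdiffable_continuous, HLd; rewrite Cmod_cis; lra.
Qed.

#[local] Hint Resolve Ccontinuous_ell : smooth.

(** The integral over the unit circle is moved inwards to radius [q1], where [|z^k| = q1^k]. *)
Lemma ell_coef_bound : exists M, forall k, Cmod (a k) <= M * q1 ^ k.
Proof.
  assert (Hc : forall z, q1 <= Cmod (z - 0) <= 1 -> Cdiffable Lg z).
  { intros z. replace (z - 0)%C with z by ring. unfold q1. intros Hz. apply HLd; nra. }
  destruct (circle_bounded Lg 0 q1) as [M HM].
  - unfold q1; lra.
  - intros z Hz. apply Cdiffable_continuous, Hc. unfold q1 in *. lra.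
  - exists M. intros k.
    assert (E : a k = circle_mean (fun z => Lg z * z ^ k)%C 0 q1).
    { rewrite (circle_mean_annulus _ 0 q1 1).
      - unfold a. rewrite (fourier_coef_ext ell (fun t => Lg (RtoC 1 * cis t)%C)).
        + rewrite fourier_coef_circle_neg, Cpow_1_l; try lra. field.
          intros z Hz. apply Cdiffable_continuous, Hc. replace (z - 0)%C with z by ring. unfold q1; lra.
        + intros t. rewrite Cmult_1_l. symmetry. apply HLw, Cmod_cis.
      - unfold q1; lra.
      - lra.
      - rewrite Rmin_left, Rmax_right by (unfold q1; lra). intros z Hz.
        apply Cdiffable_mult. now apply Hc. smooth. }
    rewrite E. apply circle_mean_bound. unfold q1; lra.
    + intros z Hz. apply Ccontinuous_mult. apply Cdiffable_continuous, Hc. unfold q1 in *; lra.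
      smooth.
    + intros z Hz. rewrite Cmod_mult, Cmod_pow.
      assert (Hz' : Cmod z = q1). { rewrite <- Hz. f_equal. ring. }
      rewrite Hz'. apply Rmult_le_compat_r; auto. apply pow_le. unfold q1; lra.
Qed.

Lemma ell_coef_0 : a O = RtoC (/ (2 * PI) * RInt (fun t => ln (w (cis t))) 0 (2 * PI)).
Proof.
  unfold a, fourier_coef. rewrite (CInt_ext _ _ HP _ ell).
  - unfold ell. rewrite CInt_RtoC.
    + unfold Cdiv. rewrite <- RtoC_inv, <- RtoC_mult by (generalize two_PI_pos; lra). f_equal. ring.
    + apply (ex_RInt_continuous (V := R_CompleteNormedModule)). intros t _.
      apply (Ccontinuous_Re (T := R_UniformSpace) ell), Ccontinuous_ell.
  - intros t _. simpl. rewrite Rmult_0_l, Ropp_0, cis_0. ring.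
Qed.

Lemma szego_tau_ell : RtoC (szego_tau w) = Cexp (- (a O / 2)).
Proof.
  rewrite ell_coef_0. unfold szego_tau. rewrite <- Cexp_RtoC. f_equal.
  assert (H := PI_RGT_0).
  rewrite RtoC_opp. f_equal. rewrite <- RtoC_div by lra. f_equal. field. lra.
Qed.

Lemma ell_coef_conj (k : nat) : fourier_coef ell (Z.of_nat k) = Cconj (a k).
Proof.
  unfold a, fourier_coef. rewrite Cdiv_conj by apply two_PI_neq_0.
  rewrite <- CInt_conj; trivial.
  - replace (Cconj (RtoC (2 * PI))) with (RtoC (2 * PI)).
    2: { apply injective_projections; simpl; ring. }
    f_equal. apply CInt_ext; trivial. intros t _.
    rewrite Cmult_conj, Cconj_cis, opp_IZR. f_equal.
    + apply injective_projections; simpl; ring.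
    + f_equal. ring.
  - smooth.
Qed.

Lemma q1_bounds : 0 < q1 < 1.
Proof. unfold q1; lra. Qed.

(** The Fourier series of a real function: coefficients of opposite index are conjugate, so the two
    halves are conjugate series, and the mean [a O], contained in both, is subtracted once. *)
Lemma ell_expansion (t : R) :
  ell t = (CPSeries a (cis (- t)) + Cconj (CPSeries a (cis (- t))) - a O)%C.
Proof.
  destruct ell_coef_bound as [M HM]. assert (Hq1 := q1_bounds).
  set (u := cis (- t)).
  assert (Hu : q1 * Cmod u < 1). { unfold u. rewrite Cmod_cis. lra. }
  assert (LP := Clim_CPSeries a M q1 ltac:(lra) HM u Hu).
  assert (K := fourier_series_converges Lg t
    ltac:(intros z Hz; apply Cdiffable_continuous, HLd; rewrite Hz; lra)
    ltac:(apply HLd; rewrite Cmod_cis; lra)).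
  cbv beta zeta in K. rewrite HLw in K by apply Cmod_cis.
  apply Clim_unique with (1 := K).
  assert (Ec : forall k, fourier_coef (fun t => Lg (cis t)) k = fourier_coef ell k).
  { intros k. apply fourier_coef_ext. intros s. apply HLw, Cmod_cis. }
  assert (Eu : forall k, (u ^ k)%C = cis (- (INR k * t))).
  { intros k. unfold u. rewrite cis_pow. f_equal. ring. }
  (* The half with negative indices starts at index 1, so its [n]-th partial sum is the partial sum
     of order [S n] of the series without [a O]. *)
  apply Clim_ext with (fun n => Cconj (Csum (fun k => a k * u ^ k)%C n)
    + (Csum (fun k => a k * u ^ k)%C (S n) - a O))%C.
  - intros n. f_equal.
    + induction n.
      * rewrite 2!Csum_O, Ec, ell_coef_conj. simpl. rewrite Rmult_0_l, cis_0.
        rewrite Cmult_conj. f_equal. apply injective_projections; simpl; ring.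
      * rewrite 2!Csum_S, Cplus_conj, IHn, Ec, ell_coef_conj. f_equal.
        rewrite Cmult_conj, Eu, Cconj_cis, Ropp_involutive, <- INR_IZR_INZ. reflexivity.
    + induction n.
      * rewrite Csum_S, 2!Csum_O, Ec, (Eu 1%nat). rewrite opp_IZR, <- INR_IZR_INZ.
        replace (- INR 1 * t) with (- (INR 1 * t)) by ring. unfold a. simpl (u ^ 0)%C. ring.
      * rewrite (Csum_S _ n), (Csum_S _ (S n)), <- IHn, Ec, (Eu (S (S n))). rewrite opp_IZR, <- INR_IZR_INZ.
        replace (- INR (S (S n)) * t) with (- (INR (S (S n)) * t)) by ring. unfold a. ring.
  - replace (CPSeries a u + Cconj (CPSeries a u) - a O)%C
      with (Cconj (CPSeries a u) + (CPSeries a u - a O))%C by ring.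
    apply Clim_plus. now apply Clim_conj. apply Clim_minus; [|apply Clim_const].
    intros eps He. destruct (LP eps He) as [N HN]. exists N. intros n Hn. apply HN. lia.
Qed.

(* [D_e / tau] in the variable [u = 1 / z]. *)
Let e (u : C) : C := Cexp (a O - CPSeries a u).

Lemma Cdiffable_e (u : C) : q1 * Cmod u < 1 -> Cdiffable e u.
Proof.
  intros Hu. destruct ell_coef_bound as [M HM].
  apply (Cdiffable_comp Cexp). apply Cdiffable_Cexp.
  apply Cdiffable_minus. apply Cdiffable_const.
  apply Cdiffable_CPSeries with M q1; trivial. apply Rlt_le, q1_bounds.
Qed.

Lemma e_0 : e 0 = RtoC 1.
Proof. unfold e. rewrite CPSeries_0. replace (a O - a O)%C with (RtoC 0) by ring. apply Cexp_0. Qed.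

(** In exponents: [(tau |e|)^2 = exp (a O - 2 Re P)], and by [ell_expansion] this exponent is minus
    [ln w]. *)
Lemma weight_eq_e (t : R) : 0 < w (cis t) ->
  w (cis t) * (szego_tau w * Cmod (e (cis (- t)))) ^ 2 = 1.
Proof.
  intros Hw.
  assert (Ht : szego_tau w = exp (- (Re (a O) / 2))).
  { assert (K := f_equal Cmod szego_tau_ell). rewrite Cmod_R, Cmod_Cexp in K.
    rewrite Rabs_pos_eq in K by (apply Rlt_le, exp_pos). rewrite K. f_equal.
    rewrite ell_coef_0. rewrite <- RtoC_div, <- RtoC_opp by lra. reflexivity. }
  unfold e. rewrite Cmod_Cexp, Ht, <- exp_plus.
  rewrite <- (exp_ln (w (cis t))) at 1 by trivial.
  assert (Ee := f_equal Re (ell_expansion t)).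
  change (Re (ell t)) with (ln (w (cis t))) in Ee.
  assert (Ex : forall x, exp x ^ 2 = exp (x + x)) by (intros x; simpl; rewrite exp_plus; ring).
  rewrite Ex, <- exp_plus, <- exp_0. f_equal. rewrite Ee.
  set (P := CPSeries a (cis (- t))).
  change (Re (P + Cconj P - a O)) with (Re P + Re P - Re (a O)).
  change (Re (a O - P)) with (Re (a O) - Re P). lra.
Qed.

(* [(cis t + z) / (cis t - z) = 1 - 2 / (1 - u cis t)] with [u = 1 / z]. *)
Lemma szego_ext_integral_e (z : C) : 1 < Cmod z ->
  szego_ext_integral w z = (RtoC (szego_tau w) * e (/ z))%C.
Proof.
  intros Hz. destruct ell_coef_bound as [M HM]. assert (Hq1 := q1_bounds).
  assert (Hz0 : z <> RtoC 0) by (apply Cmod_gt_0; lra).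
  set (u := (/ z)%C).
  assert (Hu : 0 < Cmod u < 1).
  { unfold u. rewrite Cmod_inv by trivial. split. apply Rinv_0_lt_compat; lra.
    rewrite <- Rinv_1. apply Rinv_lt_contravar; lra. }
  assert (Hu1 : q1 * Cmod u < 1) by nra.
  assert (Hn : forall t, (1 - u * cis t)%C <> RtoC 0).
  { intros t. apply Cmod_gt_0. generalize (Cmod_sub_ge 1 (u * cis t)).
    rewrite Cmod_1, Cmod_fourier_term. lra. }
  assert (Cg : forall t, Ccontinuous (T := R_UniformSpace) (fun t => ell t / (1 - u * cis t))%C t).
  { intros t. smooth. }
  set (J := (CInt (fun t => ell t / (1 - u * cis t)) 0 (2 * PI) / RtoC (2 * PI))%C).
  (* The geometric series of [1 / (1 - u cis t)] integrated term by term against [ell]. Its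
     truncation error is uniform in [t], since [|u| < 1]. *)
  assert (HJ : CPSeries a u = J).
  { apply Clim_unique with (Csum (fun k => a k * u ^ k)%C).
    - now apply Clim_CPSeries with M q1; trivial; lra.
    - destruct (circle_bounded Lg 0 1) as [B HB]. lra.
      { intros y. replace (y - 0)%C with y by ring. intros Hy. apply Cdiffable_continuous, HLd; rewrite Hy; lra. }
      assert (HB' : forall t, Cmod (ell t) <= B).
      { intros t. unfold ell. rewrite <- HLw by apply Cmod_cis. apply HB.
        replace (cis t - 0)%C with (cis t) by ring. apply Cmod_cis. }
      apply Clim_le_0 with (fun n => B / (1 - Cmod u) * Cmod u ^ S n).
      2: { replace (Finite 0) with (Rbar_mult (Finite (B / (1 - Cmod u))) (Finite 0)) by (simpl; f_equal; ring).
           apply is_lim_seq_scal_l. apply (is_lim_seq_incr_1 (fun n => Cmod u ^ n)).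
           apply is_lim_seq_geom. rewrite Rabs_pos_eq; lra. }
      intros n.
      assert (E : Csum (fun k => a k * u ^ k)%C n
        = (CInt (fun t => ell t * Csum (fun k => (u * cis t) ^ k) n) 0 (2 * PI) / RtoC (2 * PI))%C).
      { rewrite (CInt_ext _ _ HP _ (fun t => Csum (fun k => u ^ k * (ell t * cis (- (IZR (- Z.of_nat k) * t)))) n)%C).
        - rewrite (CInt_sum _ _ HP).
          + unfold Cdiv. rewrite Cmult_comm, <- Csum_scal. apply Csum_ext. intros k _.
            rewrite (CInt_scal _ _ HP). unfold a, fourier_coef. unfold Cdiv. ring.
            smooth.
          + intros k t _. smooth.
        - intros t _. rewrite <- Csum_scal. apply Csum_ext. intros k _.
          rewrite Cpow_mult_l, cis_pow, opp_IZR, <- INR_IZR_INZ.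
          replace (- (- INR k * t)) with (INR k * t) by ring. ring. }
      assert (Cs : forall t, Ccontinuous (T := R_UniformSpace) (fun t => ell t * Csum (fun k => (u * cis t) ^ k) n)%C t).
      { intros t. apply Ccontinuous_mult. apply Ccontinuous_ell.
        apply Ccontinuous_sum. intros k. smooth. }
      rewrite E. unfold J.
      replace (_ - _)%C with (CInt (fun t => ell t * Csum (fun k => (u * cis t) ^ k) n - ell t / (1 - u * cis t))%C 0 (2 * PI) / RtoC (2 * PI))%C.
      2: { rewrite (CInt_minus _ _ HP). unfold Cdiv. ring. intros t _. apply Cs. intros t _. apply Cg. }
      assert (HPI := two_PI_pos).
      rewrite Cmod_div, Cmod_R, (Rabs_pos_eq (2 * PI)) by (try apply two_PI_neq_0; lra).
      apply Rmult_le_reg_r with (2 * PI); trivial.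
      unfold Rdiv at 1. rewrite Rmult_assoc, Rinv_l, Rmult_1_r by lra.
      replace (2 * PI) with (2 * PI - 0) at 2 by ring.
      apply Cmod_CInt_le_const; trivial.
      + intros t _. apply Ccontinuous_minus. apply Cs. apply Cg.
      + intros t _.
        assert (Eg : (Csum (fun k => (u * cis t) ^ k) n * (1 - u * cis t))%C = (1 - (u * cis t) ^ S n)%C).
        { clear. set (x := (u * cis t)%C). induction n.
          - rewrite Csum_O. simpl. ring.
          - rewrite Csum_S, Cmult_plus_distr_r, IHn. simpl. ring. }
        replace (_ - _)%C with (- (ell t * (u * cis t) ^ S n / (1 - u * cis t)))%C.
        2: { replace (Csum (fun k => (u * cis t) ^ k)%C n) with ((1 - (u * cis t) ^ S n) / (1 - u * cis t))%C.
             field. apply Hn. rewrite <- Eg. field. apply Hn. }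
        rewrite Cmod_opp, Cmod_div, Cmod_mult, Cmod_pow, Cmod_fourier_term by apply Hn.
        unfold Rdiv. rewrite (Rmult_assoc B), (Rmult_comm (/ (1 - Cmod u))), <- (Rmult_assoc B).
        apply Rmult_le_compat.
        * apply Rmult_le_pos. apply Cmod_ge_0. apply pow_le. lra.
        * apply Rlt_le, Rinv_0_lt_compat, Cmod_gt_0, Hn.
        * apply Rmult_le_compat_r; trivial. apply pow_le. lra.
        * apply Rinv_le_contravar. lra.
          generalize (Cmod_sub_ge 1 (u * cis t)). rewrite Cmod_1, Cmod_fourier_term. lra. }
  assert (Ez : forall t, ((cis t + z) / (cis t - z))%C = (1 - 2 * / (1 - u * cis t))%C).
  { intros t. assert (Hn' := Hn t). unfold u in *.
    assert (Hn2 : (cis t - z)%C <> RtoC 0).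
    { intros E. apply (Hn t). apply Csub_eq_0 in E. rewrite E. unfold u. field. exact Hz0. }
    field. split; [exact Hz0|split; trivial].
    intros E. apply Hn2. apply Csub_eq_0 in E. rewrite E. ring. }
  assert (HPI := two_PI_pos).
  rewrite szego_tau_ell. unfold e. rewrite <- Cexp_add. unfold szego_ext_integral. f_equal.
  change (RInt (V := C_R_CompleteNormedModule) ?f 0 (2 * PI)) with (CInt f 0 (2 * PI)).
  rewrite (CInt_ext _ _ HP _ (fun t => ell t - 2 * (ell t / (1 - u * cis t)))%C).
  - rewrite (CInt_minus _ _ HP), (CInt_scal _ _ HP).
    + fold u. rewrite HJ. unfold J.
      assert (E0 : CInt ell 0 (2 * PI) = (RtoC (2 * PI) * a O)%C).
      { rewrite ell_coef_0. unfold ell. rewrite CInt_RtoC, <- RtoC_mult.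
        rewrite <- Rmult_assoc, Rinv_r, Rmult_1_l by lra. reflexivity.
        apply (ex_RInt_continuous (V := R_CompleteNormedModule)). intros t _.
        apply (Ccontinuous_Re (T := R_UniformSpace) ell), Ccontinuous_ell. }
      rewrite E0. rewrite RtoC_inv by (generalize PI_RGT_0; lra). rewrite !RtoC_mult.
      assert (H2 : RtoC 4 = (RtoC 2 * RtoC 2)%C). { apply injective_projections; simpl; ring. }
      rewrite H2. field. apply RtoC_neq_0. generalize PI_RGT_0; lra.
    + intros t _. apply Cg.
    + smooth.
    + intros t _. apply Ccontinuous_mult. smooth. apply Cg.
  - intros t _. rewrite Ez. unfold ell. field. apply Hn.
Qed.

Lemma szego_tau_pos : 0 < szego_tau w.
Proof. apply exp_pos. Qed.

(** The Taylor coefficients of [e]. The circle of radius [/ 2] lies in [0 < |u| < 1], that is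
    [|z| > 1], where every continuation is prescribed by the Szego integral. *)
Let c (k : nat) : C := circle_mean (fun u => e u / u ^ k)%C 0 (/ 2).

(** In the variable [u], [F / tau] is holomorphic for [0 < |u| < 1 / s] and coincides with [e] on
    the circle of radius [/ 2], hence has the same Laurent coefficients. This yields at once the
    decay of [c], which does not depend on [F], and the uniqueness of the continuation. *)
Lemma szego_continuation_e (s : R) (F : C -> C) : 0 <= s < 1 -> szego_continuation w s F ->
  coef_decay c s /\ forall z, s < Cmod z -> F z = (RtoC (szego_tau w) * CPSeries c (/ z))%C.
Proof.
  intros Hs [HF1 HF2]. assert (Ht := szego_tau_pos). assert (Ht0 := RtoC_neq_0 _ (Rgt_not_eq _ _ Ht)).
  assert (Hq1 := q1_bounds).
  set (f := fun u => (F (/ u) / RtoC (szego_tau w))%C).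
  assert (Ef : forall u, u <> RtoC 0 -> Cmod u < 1 -> f u = e u).
  { intros u Hu Hu1. unfold f. rewrite HF2, szego_ext_integral_e.
    - replace (/ / u)%C with u by (field; trivial). field. trivial.
    - apply interior_inv; lra || trivial.
    - apply interior_inv; lra || trivial. }
  assert (Df : forall u, u <> RtoC 0 -> s * Cmod u < 1 -> Cdiffable f u).
  { intros u Hu Hsu. apply Cdiffable_div; trivial. 2: apply Cdiffable_const.
    apply (Cdiffable_comp F (fun u => / u)%C).
    - now apply ex_derive_Cdiffable, HF1, interior_inv.
    - smooth. }
  assert (E12 : forall z, Cmod (z - 0) = / 2 -> z <> RtoC 0 /\ Cmod z < 1).
  { intros z. replace (z - 0)%C with z by ring. intros Hz. split; [apply Cmod_gt_0|]; lra. }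
  assert (Hpos : forall k, circle_mean (fun u => f u / u ^ k)%C 0 (/ 2) = c k).
  { intros k. unfold c. apply circle_mean_ext. lra. intros z Hz. destruct (E12 z Hz). now rewrite Ef. }
  assert (Hneg : forall k, circle_mean (fun u => f u * u ^ S k)%C 0 (/ 2) = RtoC 0).
  { intros k. rewrite (circle_mean_ext _ (fun u => e u * u ^ S k)%C).
    - rewrite mean_value_property. simpl. ring. lra.
      intros z. replace (z - 0)%C with z by ring. intros Hz.
      apply Cdiffable_mult. apply Cdiffable_e. nra. smooth.
    - lra.
    - intros z Hz. destruct (E12 z Hz). now rewrite Ef. }
  split.
  - apply (laurent_coef_decay f c s (/ 2)); trivial; lra.
  - intros z Hz.
    assert (Hz0 : z <> RtoC 0) by (apply Cmod_gt_0; lra).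
    destruct (exterior_inv s z) as [Hz1 Hz2]; trivial; try lra.
    rewrite <- (laurent_expansion f c s (/ 2)); trivial; try lra.
    unfold f. replace (/ / z)%C with z by (field; trivial). field. trivial.
Qed.

(** Makes the set in the definition of [szego_rho] nonempty, with an element below 1. *)
Lemma szego_continuation_q1 : szego_continuation w q1 (fun z => RtoC (szego_tau w) * e (/ z))%C.
Proof.
  assert (Hq1 := q1_bounds). split.
  - apply holomorphic_on_Cdiffable. intros z Hz.
    assert (Hz0 : z <> RtoC 0) by (apply Cmod_gt_0; lra).
    apply Cdiffable_mult. apply Cdiffable_const. apply (Cdiffable_comp e (fun z => / z)%C).
    + apply Cdiffable_e, exterior_inv; lra.
    + smooth.
  - intros z Hz. symmetry. now apply szego_ext_integral_e.
Qed.

Lemma e_CPSeries (u : C) : q1 * Cmod u < 1 -> e u = CPSeries c u.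
Proof.
  intros Hu. assert (Hq1 := q1_bounds).
  (* The point [u = 0] corresponds to [z] infinite and is outside the range of the Laurent
     expansion. *)
  destruct (Ceq_dec u 0) as [->|Hu0].
  - rewrite CPSeries_0. unfold c. rewrite (circle_mean_ext _ e); try lra.
    + rewrite mean_value_property; trivial. lra.
      intros z. replace (z - 0)%C with z by ring. intros Hz. apply Cdiffable_e. nra.
    + intros z _. simpl. field.
  - destruct (szego_continuation_e q1 _ ltac:(lra) szego_continuation_q1) as [_ K].
    specialize (K (/ u)%C (interior_inv q1 u Hu0 Hu)).
    replace (/ / u)%C with u in K by (field; trivial).
    assert (Ht0 := RtoC_neq_0 _ (Rgt_not_eq _ _ szego_tau_pos)).
    replace (e u) with (/ RtoC (szego_tau w) * (RtoC (szego_tau w) * e u))%C by (field; trivial).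
    rewrite K. field. trivial.
Qed.

(** An infimum need not be attained, so continuations are only obtained for some [s] below each
    [r > szego_rho w]; the case [szego_rho w = 0] is included. *)
Lemma szego_rho_spec : 0 <= szego_rho w < 1 /\
  forall r, szego_rho w < r -> exists s F, 0 < s < r /\ s < 1 /\ szego_continuation w s F.
Proof.
  set (Es := fun s => 0 < s < 1 /\ exists F, szego_continuation w s F).
  assert (Hin : Es q1).
  { split. apply q1_bounds. eexists. apply szego_continuation_q1. }
  destruct (Glb_Rbar_correct Es) as [H1 H2].
  unfold szego_rho. fold Es. change (Glb_Rbar (fun s => 0 < s < 1 /\ exists F, szego_continuation w s F)) with (Glb_Rbar Es).
  assert (K1 := H1 _ Hin).
  assert (K2 : Rbar_le 0 (Glb_Rbar Es)).
  { apply H2. intros s [Hs _]. simpl. lra. }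
  destruct (Glb_Rbar Es) as [g| |]; simpl in *; try easy.
  assert (Hq1 := q1_bounds). split. lra.
  intros r Hr. apply NNPP. intros Hno.
  assert (K : Rbar_le r g).
  { apply H2. intros s Hs. simpl. apply Rnot_lt_le. intros Hsr. apply Hno.
    destruct Hs as [Hs [F HF]]. exists s, F. repeat split; try lra; apply HF. }
  simpl in K. lra.
Qed.

Lemma szego_coef_decay : coef_decay c (szego_rho w).
Proof.
  intros q' Hq'. destruct (proj2 szego_rho_spec q' Hq') as [s [F [Hs [Hs1 HF]]]].
  apply (proj1 (szego_continuation_e s F ltac:(lra) HF)). lra.
Qed.

Lemma szego_expansion_aux : exists c : nat -> C,
  (0 <= szego_rho w < 1) /\ c O = RtoC 1 /\
  coef_decay c (szego_rho w) /\
  (forall s F, 0 <= s < 1 -> szego_continuation w s F -> forall z, s < Cmod z ->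
     F z = (RtoC (szego_tau w) * CPSeries c (/ z))%C) /\
  (forall z, 1 < Cmod z -> szego_ext_integral w z = (RtoC (szego_tau w) * CPSeries c (/ z))%C) /\
  (exists R0, 1 < R0 /\ forall u, Cmod u < R0 -> CPSeries c u <> RtoC 0) /\
  (forall t, 0 < w (cis t) -> w (cis t) * (szego_tau w * Cmod (CPSeries c (cis (- t)))) ^ 2 = 1).
Proof.
  assert (Hq1 := q1_bounds).
  exists c. split; [apply szego_rho_spec|]. split; [|split; [apply szego_coef_decay|]].
  - rewrite <- CPSeries_0, <- e_CPSeries. apply e_0. rewrite Cmod_0. lra.
  - split; [|split; [|split]].
    + intros s F Hs HF. now apply szego_continuation_e.
    + intros z Hz. rewrite szego_ext_integral_e by trivial. f_equal.
      apply e_CPSeries, exterior_inv; lra.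
    + exists (/ q1). split. rewrite <- Rinv_1. apply Rinv_lt_contravar; lra.
      intros u Hu. rewrite <- e_CPSeries. apply Cexp_neq_0.
      apply Rmult_lt_compat_l with (r := q1) in Hu; [|lra]. rewrite Rinv_r in Hu; lra.
    + intros t Ht. rewrite <- e_CPSeries. now apply weight_eq_e. rewrite Cmod_cis. lra.
Qed.

End SzegoFunction.

Theorem szego_expansion (w : C -> R) : positive_analytic_weight w -> exists c : nat -> C,
  (0 <= szego_rho w < 1) /\ c O = RtoC 1 /\
  coef_decay c (szego_rho w) /\
  szego_continuation w (szego_rho w) (szego_De w) /\
  (forall z, szego_rho w < Cmod z -> szego_De w z = (RtoC (szego_tau w) * CPSeries c (/ z))%C) /\
  (exists R0, 1 < R0 /\ forall u, Cmod u < R0 -> CPSeries c u <> RtoC 0) /\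
  (forall t, w (cis t) * (szego_tau w * Cmod (CPSeries c (cis (- t)))) ^ 2 = 1).
Proof.
  intros hw. destruct (weight_logarithm w hw) as [q [Lg [Hq [H1 H2]]]].
  destruct (szego_expansion_aux w q Lg Hq H1 H2) as [c [Hrho [Hc0 [Hdec [Hun [Hext [Hnz Hw]]]]]]].
  assert (HDe : szego_continuation w (szego_rho w) (szego_De w)).
  { unfold szego_De. apply epsilon_spec.
    exists (fun z => RtoC (szego_tau w) * CPSeries c (/ z))%C. split.
    - apply holomorphic_on_Cdiffable. intros z Hz.
      assert (Hz0 : z <> RtoC 0) by (apply Cmod_gt_0; lra).
      apply Cdiffable_mult. apply Cdiffable_const. apply (Cdiffable_comp (CPSeries c) (fun z => / z)%C).
      + apply (coef_decay_Cdiffable c (szego_rho w)); trivial; [|apply exterior_inv]; lra.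
      + smooth.
    - intros z Hz. symmetry. now apply Hext. }
  exists c. split; [trivial|]. split; [trivial|]. split; [trivial|]. split; [trivial|].
  split; [|split; trivial].
  - intros z Hz. now apply (Hun (szego_rho w)).
  - intros t. apply Hw. apply hw, Cmod_cis.
Qed.

(** * Convergence of the monic orthogonal polynomials *)

Lemma Csum_head (a : nat -> C) (n : nat) : Csum a (S n) = (a O + Csum (fun k => a (S k)) n)%C.
Proof. change (S n) with (1 + n)%nat. rewrite Csum_shift, Csum_O. reflexivity. Qed.

Lemma Csum_rev (a : nat -> C) (n : nat) : Csum a n = Csum (fun k => a (n - k)%nat) n.
Proof.
  revert a. induction n; intros a.
  - now rewrite 2!Csum_O.
  - rewrite Csum_head, (IHn (fun k => a (S k))), Csum_S, Nat.sub_diag, Cplus_comm. f_equal.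
    apply Csum_ext. intros k Hk. f_equal. lia.
Qed.

Lemma Csum_minus (a b : nat -> C) (n : nat) : Csum (fun k => a k - b k)%C n = (Csum a n - Csum b n)%C.
Proof.
  induction n.
  - now rewrite 3!Csum_O.
  - rewrite 3!Csum_S, IHn. ring.
Qed.

Lemma Csum_power_0 (a : nat -> C) (n : nat) : Csum (fun k => a k * 0 ^ k)%C n = a O.
Proof.
  induction n.
  - rewrite Csum_O. simpl. ring.
  - rewrite Csum_S, IHn. simpl. ring.
Qed.

Lemma polynomial_reversal (a : nat -> C) (n : nat) (z : C) : z <> RtoC 0 ->
  Csum (fun k => a k * z ^ k)%C n = (z ^ n * Csum (fun k => a (n - k)%nat * (/ z) ^ k) n)%C.
Proof.
  intros Hz. rewrite Csum_rev, <- Csum_scal. apply Csum_ext. intros k Hk.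
  replace n with ((n - k) + k)%nat at 3 by lia. rewrite Cpow_add_r, Cpow_inv by trivial.
  field. now apply Cpow_nz.
Qed.

Lemma Cdiffable_polynomial (a : nat -> C) (n : nat) (z : C) :
  Cdiffable (fun z => Csum (fun k => a k * z ^ k)%C n) z.
Proof.
  apply (Cdiffable_sum (fun k z => a k * z ^ k)%C). intros k.
  smooth.
Qed.

#[global] Hint Resolve Cdiffable_polynomial : smooth.

Lemma poly_with_leading_Cdiffable (f : C -> C) (n : nat) (a z : C) :
  poly_with_leading f n a -> Cdiffable f z.
Proof.
  intros [b [_ Hb]]. apply Cdiffable_ext with (fun z => Csum (fun k => b k * z ^ k)%C n).
  intros y. symmetry. apply Hb. smooth.
Qed.

Lemma poly_with_leading_reduce (f g : C -> C) (n : nat) (a b : C) : b <> RtoC 0 ->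
  poly_with_leading f (S n) a -> poly_with_leading g (S n) b ->
  exists a', poly_with_leading (fun z => f z - a / b * g z)%C n a'.
Proof.
  intros Hb [cf [Hf1 Hf2]] [cg [Hg1 Hg2]].
  eexists. exists (fun k => cf k - a / b * cg k)%C. split; [reflexivity|].
  intros z. rewrite Hf2, Hg2. fold_Csum.
  rewrite 2!Csum_S, Hf1, Hg1.
  rewrite (Csum_ext (fun k => (cf k - a / b * cg k) * z ^ k)%C
    (fun k => cf k * z ^ k - a / b * (cg k * z ^ k))%C) by (intros; ring).
  rewrite Csum_minus, Csum_scal. field. trivial.
Qed.

Lemma fourier_coef_trig_polynomial (d : nat -> C) (n k : nat) : (k <= n)%nat ->
  fourier_coef (fun t => Csum (fun i => d i * cis t ^ i)%C n) (Z.of_nat k) = d k.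
Proof.
  intros Hk. unfold fourier_coef. assert (HP := Rlt_le _ _ two_PI_pos).
  rewrite (CInt_ext _ _ HP _ (fun t => Csum (fun i => d i * cis (IZR (Z.of_nat i - Z.of_nat k) * t))%C n)).
  - rewrite (CInt_sum _ _ HP).
    + rewrite (Csum_ext _ (fun i => RtoC (2 * PI) * (if Nat.eq_dec i k then d i else RtoC 0))%C).
      * rewrite Csum_scal.
        assert (Es : Csum (fun i => if Nat.eq_dec i k then d i else RtoC 0) n = d k).
        { clear - Hk. assert (H : forall m, Csum (fun i => if Nat.eq_dec i k then d i else RtoC 0) m
            = if le_dec k m then d k else RtoC 0).
          { induction m.
            - rewrite Csum_O. destruct (Nat.eq_dec 0 k); destruct (le_dec k 0); try lia; subst; reflexivity.
            - rewrite Csum_S, IHm. destruct (Nat.eq_dec (S m) k); destruct (le_dec k m); destruct (le_dec k (S m));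
              try lia; subst; ring. }
          rewrite H. destruct (le_dec k n); [reflexivity|lia]. }
        rewrite Es. field. apply two_PI_neq_0.
      * intros i _. rewrite (CInt_scal _ _ HP) by (intros t _; apply Ccontinuous_cis_lin).
        rewrite CInt_cis_Z.
        destruct (Z.eq_dec (Z.of_nat i - Z.of_nat k) 0); destruct (Nat.eq_dec i k); try lia; ring.
    + intros i t _. smooth.
  - intros t _. rewrite Cmult_comm, <- Csum_scal. apply Csum_ext. intros i _.
    rewrite cis_pow, minus_IZR, <- 2!INR_IZR_INZ.
    replace ((INR i - INR k) * t) with (INR i * t + - (INR k * t)) by ring. rewrite cis_add. ring.
Qed.

(** Passes from [cis t] to its inverse [cis (- t)], that is from [z] to [u] on the circle. *)
Lemma CInt_reflect (f : R -> C) : Ccontinuous_on f 0 (2 * PI) ->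
  CInt (fun t => f (2 * PI - t)) 0 (2 * PI) = CInt f 0 (2 * PI).
Proof.
  intros Hf. assert (HP := Rlt_le _ _ two_PI_pos).
  assert (K := is_RInt_CInt _ _ HP f Hf). apply CInt_unique.
  assert (K1 := is_RInt_swap _ _ _ _ K).
  assert (K2 := is_RInt_comp_lin (V := C_R_NormedModule) f (-1) (2 * PI) 0 (2 * PI) (opp (CInt f 0 (2 * PI)))).
  replace (-1 * 0 + 2 * PI) with (2 * PI) in K2 by ring.
  replace (-1 * (2 * PI) + 2 * PI) with 0 in K2 by ring. specialize (K2 K1).
  apply is_RInt_opp in K2.
  replace (CInt f 0 (2 * PI)) with (opp (opp (CInt f 0 (2 * PI)) : C_R_NormedModule)).
  2: apply (opp_opp (G := C_R_NormedModule)).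
  apply (is_RInt_ext (V := C_R_NormedModule)) with (2 := K2).
  intros t _. replace (-1 * t + 2 * PI) with (2 * PI - t) by ring.
  apply injective_projections; simpl; unfold scal, opp; simpl; unfold mult; simpl; ring.
Qed.

Section Extremal.
Context (w : C -> R) (kappa : nat -> R) (phi : nat -> C -> C).
Context (hphi : orthonormal_polynomials w kappa phi).
Context (c : nat -> C) (rho tau : R).
Context (Hrho : 0 <= rho < 1) (Hc0 : c O = RtoC 1).
Context (Hc : coef_decay c rho).
Context (Htau : 0 < tau).
Context (Hnz : exists R0, 1 < R0 /\ forall u, Cmod u < R0 -> CPSeries c u <> RtoC 0).
Context (Hw : forall t, w (cis t) * (tau * Cmod (CPSeries c (cis (- t)))) ^ 2 = 1).

Let HP : 0 <= 2 * PI := Rlt_le _ _ two_PI_pos.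
Let e := CPSeries c.

Lemma Cdiffable_e_disc (u : C) : rho * Cmod u < 1 -> Cdiffable e u.
Proof. apply coef_decay_Cdiffable; trivial. lra. Qed.

Lemma e_cis_neq_0 (t : R) : e (cis t) <> RtoC 0.
Proof. destruct Hnz as [R0 [H1 H2]]. apply H2. rewrite Cmod_cis. lra. Qed.

Lemma weight_e (t : R) : RtoC (w (cis t)) = (/ (RtoC tau ^ 2 * (e (cis (- t)) * Cconj (e (cis (- t))))))%C.
Proof.
  assert (Hn := e_cis_neq_0 (- t)).
  assert (Hm := proj1 (Cmod_gt_0 _) Hn).
  assert (E : w (cis t) = / (tau ^ 2 * Cmod (e (cis (- t))) ^ 2)).
  { assert (Hp : 0 < tau ^ 2 * Cmod (e (cis (- t))) ^ 2).
    { apply Rmult_lt_0_compat; apply pow_lt; trivial. }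
    apply Rmult_eq_reg_r with (tau ^ 2 * Cmod (e (cis (- t))) ^ 2); [|lra].
    rewrite Rinv_l, <- Rpow_mult_distr by lra. apply Hw. }
  rewrite E, RtoC_inv, RtoC_mult, Cmod2_conj, RtoC_pow. reflexivity.
  apply Rgt_not_eq, Rmult_lt_0_compat; apply pow_lt; trivial.
Qed.

Lemma Ccontinuous_e_cis_opp (t : R) : Ccontinuous (T := R_UniformSpace) (fun t => e (cis (- t))) t.
Proof.
  apply (Ccontinuous_comp e (fun t => cis (- t))).
  - apply Cdiffable_continuous, Cdiffable_e_disc. rewrite Cmod_cis. lra.
  - apply Ccontinuous_ext_loc with (fun t => cis (-1 * t)).
    + apply filter_forall. intros s. f_equal. ring.
    + smooth.
Qed.

Lemma Ccontinuous_weight (t : R) : Ccontinuous (T := R_UniformSpace) (fun t => RtoC (w (cis t))) t.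
Proof.
  apply Ccontinuous_ext_loc with (fun t => / (RtoC tau ^ 2 * (e (cis (- t)) * Cconj (e (cis (- t))))))%C.
  - apply filter_forall. intros s. symmetry. apply weight_e.
  - assert (Hn := e_cis_neq_0 (- t)). apply Ccontinuous_inv.
    + apply Cmult_neq_0. apply Cpow_nz, RtoC_neq_0. lra. apply Cmult_neq_0; trivial.
      apply Cmod_gt_0. rewrite Cmod_conj. now apply Cmod_gt_0.
    + apply Ccontinuous_mult. apply Ccontinuous_const. apply Ccontinuous_mult.
      apply Ccontinuous_e_cis_opp. apply Ccontinuous_conj, Ccontinuous_e_cis_opp.
Qed.

#[local] Hint Resolve e_cis_neq_0 Ccontinuous_e_cis_opp Ccontinuous_weight : smooth.

(** [w] is the inverse of [(tau |e|)^2], and [e] is bounded on the circle. *)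
Lemma weight_lower_bound : exists m, 0 < m /\ forall t, m <= w (cis t).
Proof.
  destruct (circle_bounded e 0 1) as [B HB]. lra.
  { intros z. replace (z - 0)%C with z by ring. intros Hz.
    apply Cdiffable_continuous, Cdiffable_e_disc. rewrite Hz; lra. }
  assert (HB' : forall t, Cmod (e (cis t)) <= B).
  { intros t. apply HB. replace (cis t - 0)%C with (cis t) by ring. apply Cmod_cis. }
  assert (HB0 : 0 < B).
  { apply Rlt_le_trans with (2 := HB' 0). apply Cmod_gt_0, e_cis_neq_0. }
  exists (/ (tau * B) ^ 2). split.
  - apply Rinv_0_lt_compat, pow_lt. now apply Rmult_lt_0_compat.
  - intros t. assert (K := Hw t). set (x := tau * Cmod (e (cis (- t)))) in *.
    change (w (cis t) * x ^ 2 = 1) in K.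
    assert (Hx : 0 < x). { apply Rmult_lt_0_compat; trivial. apply Cmod_gt_0, e_cis_neq_0. }
    replace (w (cis t)) with (/ x ^ 2).
    + apply Rinv_le_contravar. now apply pow_lt. apply pow_incr. split. lra.
      apply Rmult_le_compat_l. lra. apply HB'.
    + assert (Hx2 : 0 < x ^ 2) by now apply pow_lt.
      apply Rmult_eq_reg_r with (x ^ 2); [|lra]. rewrite Rinv_l; lra.
Qed.

Lemma kappa_neq_0 (n : nat) : RtoC (kappa n) <> RtoC 0.
Proof. apply RtoC_neq_0. apply Rgt_not_eq, hphi. Qed.

Lemma Ccontinuous_poly_cis (f : C -> C) (n : nat) (a : C) (t : R) : poly_with_leading f n a ->
  Ccontinuous (T := R_UniformSpace) (fun t => f (cis t)) t.
Proof.
  intros Hf. apply (Ccontinuous_comp f cis); [|apply Ccontinuous_cis].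
  apply Cdiffable_continuous. now apply poly_with_leading_Cdiffable with n a.
Qed.

Let inner (f g : C -> C) : C := CInt (fun t => f (cis t) * Cconj (g (cis t)) * RtoC (w (cis t)))%C 0 (2 * PI).

Lemma inner_phi (n m : nat) : inner (phi n) (phi m) = if Nat.eqb n m then RtoC 1 else RtoC 0.
Proof.
  unfold inner. rewrite (CInt_unique 0 (2 * PI) _ _ (proj2 hphi n m)). now destruct (Nat.eqb n m).
Qed.

Lemma Ccontinuous_inner (f : C -> C) (n : nat) (t : R) :
  Ccontinuous (T := R_UniformSpace) (fun t => f (cis t)) t ->
  Ccontinuous (T := R_UniformSpace) (fun t => f (cis t) * Cconj (phi n (cis t)) * RtoC (w (cis t)))%C t.
Proof.
  intros Hf. apply Ccontinuous_mult; [|apply Ccontinuous_weight]. apply Ccontinuous_mult; trivial.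
  apply Ccontinuous_conj, (Ccontinuous_poly_cis _ _ _ t (proj2 (proj1 hphi n))).
Qed.

(** Induction on the degree bound: a multiple of [phi (S m)] removes the top coefficient. *)
Lemma phi_orthogonal (n m : nat) (f : C -> C) (a : C) : (m < n)%nat -> poly_with_leading f m a ->
  inner f (phi n) = RtoC 0.
Proof.
  assert (Cphi := fun m t => Ccontinuous_inner (phi m) n t (Ccontinuous_poly_cis _ _ _ t (proj2 (proj1 hphi m)))).
  revert f a. induction m; intros f a Hmn Hf.
  - destruct (proj1 hphi O) as [_ [b [Hb1 Hb2]]]. destruct Hf as [d [Hd1 Hd2]].
    assert (E : inner f (phi n) = (a / RtoC (kappa 0) * inner (phi O) (phi n))%C).
    { unfold inner. rewrite <- (CInt_scal _ _ HP) by (intros t _; apply Cphi).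
      apply CInt_ext; trivial. intros t _. rewrite Hd2, Hb2, 2!sum_O, Hd1, Hb1. simpl. field. apply kappa_neq_0. }
    rewrite E, inner_phi. destruct n; [lia|]. simpl. ring.
  - destruct (poly_with_leading_reduce _ _ _ _ _ (kappa_neq_0 (S m)) Hf (proj2 (proj1 hphi (S m)))) as [a' Ha'].
    assert (E : inner f (phi n) = (inner (fun z => f z - a / RtoC (kappa (S m)) * phi (S m) z)%C (phi n)
       + a / RtoC (kappa (S m)) * inner (phi (S m)) (phi n))%C).
    { unfold inner. rewrite <- (CInt_scal _ _ HP) by (intros t _; apply Cphi).
      rewrite <- (CInt_plus _ _ HP).
      - apply CInt_ext; trivial. intros t _. field. apply kappa_neq_0.
      - intros t _. exact (Ccontinuous_inner _ n t (Ccontinuous_poly_cis _ _ _ t Ha')).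
      - intros t _. apply Ccontinuous_mult. apply Ccontinuous_const. apply Cphi. }
    rewrite E, inner_phi, (IHm _ a'); trivial; [|lia].
    destruct (Nat.eqb_spec (S m) n); [lia|]. ring.
Qed.

Lemma monic_poly_leading (n : nat) : poly_with_leading (monic_poly kappa phi n) n (RtoC 1).
Proof.
  destruct (proj1 hphi n) as [_ [b [Hb1 Hb2]]].
  exists (fun k => / RtoC (kappa n) * b k)%C. split.
  - rewrite Hb1. field. apply kappa_neq_0.
  - intros z. unfold monic_poly. rewrite Hb2.
    fold_Csum.
    rewrite (Csum_ext (fun k => / RtoC (kappa n) * b k * z ^ k)%C (fun k => / RtoC (kappa n) * (b k * z ^ k))%C) by (intros; ring).
    rewrite Csum_scal. unfold Cdiv. ring.
Qed.

Section Difference.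
Context (n : nat) (b : nat -> C) (Hb1 : b n = RtoC 1).
Context (Hb2 : forall z, monic_poly kappa phi n z = Csum (fun k => b k * z ^ k)%C n).

(* [X = Q_n - Phi_n] with [Q_n z = z^n * sum_(k <= n) c k / z^k], and [V u = u^n * X (1 / u)]. *)
Let d (k : nat) : C := (c (n - k)%nat - b k)%C.
Let X (z : C) : C := Csum (fun k => d k * z ^ k)%C n.
Let V (u : C) : C := Csum (fun k => d (n - k)%nat * u ^ k)%C n.
Let tail (u : C) : C := (e u - Csum (fun k => c k * u ^ k)%C n)%C.

Lemma X_cis_V (t : R) : (X (cis t) * cis (- t) ^ n)%C = V (cis (- t)).
Proof.
  unfold X, V. rewrite polynomial_reversal by apply cis_neq_0.
  rewrite cis_opp, Cpow_inv by apply cis_neq_0.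
  field. apply Cpow_nz, cis_neq_0.
Qed.

(** [V 0] is the coefficient of [z^n] in [X], which cancels because [c 0 = 1] makes [Q_n] monic like
    [Phi_n]. *)
Lemma V_0 : V 0 = RtoC 0.
Proof.
  unfold V. rewrite (Csum_power_0 (fun k => d (n - k)%nat)).
  unfold d. rewrite Nat.sub_0_r, Nat.sub_diag, Hc0, Hb1. ring.
Qed.

Lemma Ccontinuous_X_cis (t : R) : Ccontinuous (T := R_UniformSpace) (fun t => X (cis t)) t.
Proof.
  apply (Ccontinuous_comp X cis); [|apply Ccontinuous_cis].
  apply Cdiffable_continuous, Cdiffable_polynomial.
Qed.

#[local] Hint Resolve Ccontinuous_X_cis : smooth.

Lemma X_orthogonal_monic :
  CInt (fun t => X (cis t) * Cconj (monic_poly kappa phi n (cis t)) * RtoC (w (cis t)))%C 0 (2 * PI) = RtoC 0.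
Proof.
  (* For [n = 0] there is no lower degree and [X] is zero; otherwise its degree is at most
     [n - 1]. *)
  assert (HX : (forall z, X z = RtoC 0) \/ exists m a, (m < n)%nat /\ poly_with_leading X m a).
  { assert (En : d n = RtoC 0). { unfold d. rewrite Nat.sub_diag, Hc0, Hb1. ring. }
    unfold X. clear - En. destruct n as [|m].
    - left. intros z. rewrite Csum_O, En. ring.
    - right. exists m, (d m). split; [lia|]. exists d. split; trivial.
      intros z. rewrite Csum_S, En. fold_Csum. ring. }
  destruct HX as [HX|[m [a [Hm HX]]]].
  - rewrite (CInt_ext _ _ HP _ (fun _ => RtoC 0)) by (intros t _; rewrite HX; ring). rewrite CInt_const. ring.
  - assert (K := phi_orthogonal n m X a Hm HX). unfold inner in K.
    rewrite (CInt_ext _ _ HP _ (fun t => / RtoC (kappa n) * (X (cis t) * Cconj (phi n (cis t)) * RtoC (w (cis t))))%C).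
    + rewrite (CInt_scal _ _ HP), K. ring.
      intros t _. apply Ccontinuous_mult; [|apply Ccontinuous_weight]. apply Ccontinuous_mult.
      apply Ccontinuous_X_cis. apply Ccontinuous_conj, (Ccontinuous_poly_cis _ _ _ t (proj2 (proj1 hphi n))).
    + intros t _. unfold monic_poly. rewrite Cdiv_conj by apply kappa_neq_0.
      replace (Cconj (RtoC (kappa n))) with (RtoC (kappa n)).
      2: { apply injective_projections; simpl; ring. }
      field. apply kappa_neq_0.
Qed.

(** Mean value property of [V / e] on the closed unit disc, where [e] has no zeros. *)
Lemma V_over_e_mean_zero : CInt (fun t => V (cis (- t)) / e (cis (- t)))%C 0 (2 * PI) = RtoC 0.
Proof.
  destruct Hnz as [R0 [HR0 Hn]].
  assert (K := mean_value_property (fun u => V u / e u)%C 0 1 ltac:(lra)).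
  assert (K' : circle_mean (fun u => V u / e u)%C 0 1 = (V 0 / e 0)%C).
  { apply K. intros z. replace (z - 0)%C with z by ring. intros Hz. smooth.
    - apply Hn. lra.
    - apply (Cdiffable_polynomial (fun k => d (n - k)%nat)).
    - apply Cdiffable_e_disc. generalize (Cmod_ge_0 z). nra. }
  assert (Cf : forall t, Ccontinuous (T := R_UniformSpace) (fun t => V (cis t) / e (cis t))%C t).
  { intros t. apply (Ccontinuous_comp (fun u => V u / e u)%C cis); [|apply Ccontinuous_cis].
    apply Cdiffable_continuous, Cdiffable_div. apply e_cis_neq_0.
    - apply (Cdiffable_polynomial (fun k => d (n - k)%nat)).
    - apply Cdiffable_e_disc. rewrite Cmod_cis. lra. }
  rewrite V_0 in K'. unfold Cdiv in K' at 2. rewrite Cmult_0_l in K'. unfold circle_mean in K'.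
  rewrite (CInt_ext _ _ HP _ (fun t => (fun s => V (cis s) / e (cis s))%C (2 * PI - t))).
  - rewrite (CInt_reflect (fun s => V (cis s) / e (cis s))%C) by (intros t _; apply Cf).
    rewrite (CInt_ext _ _ HP _ (fun t => V (cis t) / e (cis t))%C) in K'.
    + set (I := CInt (fun t => V (cis t) / e (cis t))%C 0 (2 * PI)) in *.
      replace I with (I / RtoC (2 * PI) * RtoC (2 * PI))%C by (field; apply two_PI_neq_0).
      rewrite K'. ring.
    + intros t _. now replace (0 + 1 * cis t)%C with (cis t) by ring.
  - intros t _. replace (2 * PI - t) with (- t + 2 * PI) by ring. now rewrite cis_2PI.
Qed.

Let N2 : R := RInt (fun t => Cmod (X (cis t)) ^ 2 * w (cis t)) 0 (2 * PI).

Lemma continuous_weight (t : R) : continuous (fun t => w (cis t)) t.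
Proof. apply (Ccontinuous_Re (T := R_UniformSpace) (fun t => RtoC (w (cis t)))), Ccontinuous_weight. Qed.

Lemma continuous_X_mod (t : R) : continuous (fun t => Cmod (X (cis t))) t.
Proof.
  apply (Ccontinuous_Re (T := R_UniformSpace) (fun t => RtoC (Cmod (X (cis t))))).
  apply Ccontinuous_mod, Ccontinuous_X_cis.
Qed.

Lemma ex_RInt_cont (f : R -> R) : (forall t, continuous f t) -> ex_RInt f 0 (2 * PI).
Proof. intros Hf. apply (ex_RInt_continuous (V := R_CompleteNormedModule)). intros t _. apply Hf. Qed.

Lemma continuous_N2 (t : R) : continuous (fun t => Cmod (X (cis t)) ^ 2 * w (cis t)) t.
Proof.
  apply (continuous_mult (fun t => Cmod (X (cis t)) ^ 2)); [|apply continuous_weight].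
  apply (continuous_mult (fun t => Cmod (X (cis t)))); [apply continuous_X_mod|].
  apply (continuous_mult (fun t => Cmod (X (cis t)))); [apply continuous_X_mod|]. apply continuous_const.
Qed.

(* Pythagoras, combined with [w = 1 / (tau^2 |e|^2)] and the mean value property of
   the holomorphic function [V / e], which vanishes at [0]. *)
Lemma N2_tail : RtoC N2
  = (- CInt (fun t => X (cis t) * Cconj (cis t ^ n * tail (cis (- t))) * RtoC (w (cis t))) 0 (2 * PI))%C.
Proof.
  unfold N2. rewrite <- CInt_RtoC by (apply ex_RInt_cont, continuous_N2).
  set (g1 := fun t => (X (cis t) * Cconj (monic_poly kappa phi n (cis t)) * RtoC (w (cis t)))%C).
  set (g2 := fun t => (V (cis (- t)) / e (cis (- t)))%C).
  set (g3 := fun t => (X (cis t) * Cconj (cis t ^ n * tail (cis (- t))) * RtoC (w (cis t)))%C).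
  assert (C1 : Ccontinuous_on g1 0 (2 * PI)).
  { intros t _. apply Ccontinuous_mult; [|apply Ccontinuous_weight]. apply Ccontinuous_mult.
    apply Ccontinuous_X_cis. apply Ccontinuous_conj, (Ccontinuous_poly_cis _ _ _ t (monic_poly_leading n)). }
  assert (Co : forall f : C -> C, (forall z, Cdiffable f z) -> forall t, Ccontinuous (T := R_UniformSpace) (fun t => f (cis (- t))) t).
  { intros f Hf t. apply (Ccontinuous_comp f (fun t => cis (- t))). now apply Cdiffable_continuous.
    apply Ccontinuous_ext_loc with (fun t => cis (-1 * t)).
    + apply filter_forall. intros s. f_equal. ring.
    + smooth. }
  assert (C2 : Ccontinuous_on g2 0 (2 * PI)).
  { intros t _. apply Ccontinuous_div. apply e_cis_neq_0. 
    apply (Co V). intros z. apply (Cdiffable_polynomial (fun k => d (n - k)%nat)).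
    smooth. }
  assert (C3 : Ccontinuous_on g3 0 (2 * PI)).
  { intros t _. apply Ccontinuous_mult; [|apply Ccontinuous_weight]. apply Ccontinuous_mult.
    apply Ccontinuous_X_cis. apply Ccontinuous_conj, Ccontinuous_mult.
    apply Ccontinuous_pow, Ccontinuous_cis. apply Ccontinuous_minus. apply Ccontinuous_e_cis_opp.
    apply (Co (fun u => Csum (fun k => c k * u ^ k)%C n)). intros z. smooth. }
  assert (Ht2 : (RtoC tau ^ 2)%C <> RtoC 0) by (apply Cpow_nz, RtoC_neq_0; lra).
  rewrite (CInt_ext _ _ HP _ (fun t => (/ RtoC tau ^ 2 * g2 t - g3 t) - g1 t)%C).
  - assert (C2' : Ccontinuous_on (fun t => / RtoC tau ^ 2 * g2 t)%C 0 (2 * PI)).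
    { intros t Ht. apply Ccontinuous_mult. smooth. now apply C2. }
    assert (C23 : Ccontinuous_on (fun t => / RtoC tau ^ 2 * g2 t - g3 t)%C 0 (2 * PI)).
    { intros t Ht. apply Ccontinuous_minus. now apply C2'. now apply C3. }
    rewrite (CInt_minus _ _ HP _ _ C23 C1), (CInt_minus _ _ HP _ _ C2' C3), (CInt_scal _ _ HP _ _ C2).
    unfold g1, g2. rewrite V_over_e_mean_zero, X_orthogonal_monic. fold g3. ring.
  - intros t _. unfold g1, g2, g3.
    assert (EX : X (cis t) = (cis t ^ n * (e (cis (- t)) - tail (cis (- t))) - monic_poly kappa phi n (cis t))%C).
    { unfold tail. rewrite Hb2. unfold X, d.
      rewrite (Csum_ext _ (fun k => c (n - k)%nat * cis t ^ k - b k * cis t ^ k)%C) by (intros; ring).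
      rewrite Csum_minus. f_equal. rewrite (polynomial_reversal (fun k => c (n - k)%nat)) by apply cis_neq_0.
      replace (e (cis (- t)) - (e (cis (- t)) - Csum (fun k => c k * cis (- t) ^ k) n))%C
        with (Csum (fun k => c k * cis (- t) ^ k)%C n) by ring. f_equal.
      apply Csum_ext. intros k Hk. rewrite cis_opp. f_equal. f_equal. lia. }
    rewrite <- X_cis_V. rewrite RtoC_mult, Cmod2_conj.
    rewrite EX at 2. rewrite Cminus_conj, Cmult_conj, Cminus_conj, (Cmult_conj (cis t ^ n)).
    assert (Ec : Cconj (cis t ^ n) = (cis (- t) ^ n)%C) by now rewrite Cpow_conj, Cconj_cis.
    rewrite Ec.
    (* The weight cancels the conjugate of [e] and leaves [1 / e], which is holomorphic in [u]. *)
    assert (Ew : (RtoC (w (cis t)) * Cconj (e (cis (- t))))%C = (/ RtoC tau ^ 2 / e (cis (- t)))%C).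
    { assert (Hn := e_cis_neq_0 (- t)). rewrite weight_e.
      assert (Hn' : Cconj (e (cis (- t))) <> RtoC 0).
      { apply Cmod_gt_0. rewrite Cmod_conj. now apply Cmod_gt_0. }
      field. split; [|split]; trivial. apply RtoC_neq_0. lra. }
    transitivity (X (cis t) * cis (- t) ^ n * (RtoC (w (cis t)) * Cconj (e (cis (- t))))
       - X (cis t) * (cis (- t) ^ n * Cconj (tail (cis (- t)))) * RtoC (w (cis t))
       - X (cis t) * Cconj (monic_poly kappa phi n (cis t)) * RtoC (w (cis t)))%C.
    ring. rewrite Ew. unfold Cdiv. ring.
Qed.

Lemma weight_pos (t : R) : 0 < w (cis t).
Proof. destruct weight_lower_bound as [m [Hm H]]. generalize (H t). lra. Qed.

(** Apply [x * T <= x^2 / 2 + T^2 / 2] under the integral in [N2_tail]; half of [N2] is absorbed on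
    the left. *)
Lemma N2_bound (T : R) : 0 <= T -> (forall t, Cmod (tail (cis t)) <= T) ->
  N2 <= T ^ 2 * RInt (fun t => w (cis t)) 0 (2 * PI).
Proof.
  intros HT0 HT.
  set (W := RInt (fun t => w (cis t)) 0 (2 * PI)).
  assert (EW : ex_RInt (fun t => w (cis t)) 0 (2 * PI)) by (apply ex_RInt_cont, continuous_weight).
  assert (EN : ex_RInt (fun t => Cmod (X (cis t)) ^ 2 * w (cis t)) 0 (2 * PI)) by (apply ex_RInt_cont, continuous_N2).
  assert (K : N2 <= RInt (fun t => plus (scal (/ 2) (Cmod (X (cis t)) ^ 2 * w (cis t))) (scal (T ^ 2 / 2) (w (cis t)))) 0 (2 * PI)).
  { apply Rle_trans with (Cmod (RtoC N2)). { rewrite Cmod_R. apply Rle_abs. }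
    rewrite N2_tail, Cmod_opp.
    assert (C3 : Ccontinuous_on (fun t => X (cis t) * Cconj (cis t ^ n * tail (cis (- t))) * RtoC (w (cis t)))%C 0 (2 * PI)).
    { intros t _. apply Ccontinuous_mult; [|apply Ccontinuous_weight]. apply Ccontinuous_mult.
      apply Ccontinuous_X_cis. apply Ccontinuous_conj, Ccontinuous_mult.
      apply Ccontinuous_pow, Ccontinuous_cis. apply Ccontinuous_minus. apply Ccontinuous_e_cis_opp.
      apply (Ccontinuous_comp (fun u => Csum (fun k => c k * u ^ k)%C n) (fun t => cis (- t))).
      apply Cdiffable_continuous, Cdiffable_polynomial.
      apply Ccontinuous_ext_loc with (fun t => cis (-1 * t)).
      apply filter_forall. intros s. f_equal. ring. smooth. }
    eapply Rle_trans. { apply (Cmod_CInt_le _ _ HP _ C3). }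
    apply RInt_le; trivial.
    - now apply (ex_RInt_Cmod _ _ HP).
    - apply (ex_RInt_plus (V := R_NormedModule)); now apply (ex_RInt_scal (V := R_NormedModule)).
    - intros t _. unfold plus, scal; simpl; unfold mult; simpl.
      rewrite 2!Cmod_mult, Cmod_conj, Cmod_mult, Cmod_pow, Cmod_cis, pow1, Rmult_1_l, Cmod_R.
      assert (Hwt := weight_pos t). rewrite (Rabs_pos_eq (w (cis t))) by lra.
      specialize (HT (- t)). assert (H1 := Cmod_ge_0 (tail (cis (- t)))). assert (H2 := Cmod_ge_0 (X (cis t))).
      set (x := Cmod (X (cis t))) in *. set (y := Cmod (tail (cis (- t)))) in *.
      assert (Hyy : y * y <= T * T) by (apply Rmult_le_compat; trivial).
      assert (Hsq : 0 <= (x - y) * (x - y)) by apply Rle_0_sqr.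
      assert (Hxy : x * y <= / 2 * (x * x) + T * T / 2) by lra.
      apply Rmult_le_compat_r with (r := w (cis t)) in Hxy; [|lra]. lra. }
  rewrite (RInt_plus (V := R_CompleteNormedModule)), 2!(RInt_scal (V := R_CompleteNormedModule)) in K; trivial.
  - change (N2 <= / 2 * N2 + T ^ 2 / 2 * W) in K. lra.
  - now apply (ex_RInt_scal (V := R_NormedModule)).
  - now apply (ex_RInt_scal (V := R_NormedModule)).
Qed.

(** Integrates [x <= y / 2 + x^2 / (2 y)] with [x = |X|], using [m <= w]. The parameter [y] is free:
    with [y = q^n] and [N2] of order [q^(2n)], both terms are of order [q^n]. *)
Lemma coef_L2_bound (m y : R) (k : nat) : 0 < m -> (forall t, m <= w (cis t)) -> 0 < y -> (k <= n)%nat ->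
  2 * PI * Cmod (d k) <= PI * y + N2 / (2 * m * y).
Proof.
  intros Hm Hmw Hy Hk.
  assert (HPI := two_PI_pos).
  rewrite <- (fourier_coef_trig_polynomial d n k Hk). unfold fourier_coef.
  rewrite Cmod_div, Cmod_R, (Rabs_pos_eq (2 * PI)) by (try apply two_PI_neq_0; lra).
  unfold Rdiv at 1. rewrite (Rmult_comm (Cmod _)), <- Rmult_assoc, Rinv_r, Rmult_1_l by lra.
  change (CInt _ 0 (2 * PI)) with (CInt (fun t => X (cis t) * cis (- (IZR (Z.of_nat k) * t)))%C 0 (2 * PI)).
  assert (C1 : Ccontinuous_on (fun t => X (cis t) * cis (- (IZR (Z.of_nat k) * t)))%C 0 (2 * PI)).
  { smooth. }
  eapply Rle_trans. { apply (Cmod_CInt_le _ _ HP _ C1). }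
  assert (EN : ex_RInt (fun t => Cmod (X (cis t)) ^ 2 * w (cis t)) 0 (2 * PI)) by (apply ex_RInt_cont, continuous_N2).
  apply Rle_trans with (RInt (fun t => plus (y / 2) (scal (/ (2 * m * y)) (Cmod (X (cis t)) ^ 2 * w (cis t)))) 0 (2 * PI)).
  - apply RInt_le; trivial.
    + now apply (ex_RInt_Cmod _ _ HP).
    + apply (ex_RInt_plus (V := R_NormedModule)). apply ex_RInt_const. now apply (ex_RInt_scal (V := R_NormedModule)).
    + intros t _. unfold plus, scal; simpl; unfold mult; simpl.
      rewrite Cmod_fourier_term. set (x := Cmod (X (cis t))). rewrite Rmult_1_r.
      assert (Hx : m * (x * x) <= x * x * w (cis t)).
      { rewrite Rmult_comm. apply Rmult_le_compat_l; trivial. nra. }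
      assert (H0 : 0 <= m * ((y - x) * (y - x))) by (apply Rmult_le_pos; [lra|apply Rle_0_sqr]).
      set (Z := x * x * w (cis t)) in *.
      apply Rle_trans with (/ (2 * m * y) * (m * y * y + Z)).
      * apply Rmult_le_reg_l with (2 * m * y). { repeat apply Rmult_lt_0_compat; lra. }
        replace (2 * m * y * (/ (2 * m * y) * (m * y * y + Z))) with (m * y * y + Z) by (field; split; lra).
        lra.
      * right. field. split; lra.
  - rewrite (RInt_plus (V := R_CompleteNormedModule)), (RInt_scal (V := R_CompleteNormedModule)), RInt_const; trivial.
    + apply Req_le. change ((2 * PI - 0) * (y / 2) + / (2 * m * y) * N2 = PI * y + N2 / (2 * m * y)).
      field. split; lra.
    + apply ex_RInt_const.
    + now apply (ex_RInt_scal (V := R_NormedModule)).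
Qed.

End Difference.

Lemma monic_coef_approximation (q : R) : rho < q < 1 -> exists B, 0 <= B /\
  forall n b, b n = RtoC 1 ->
    (forall z, monic_poly kappa phi n z = Csum (fun k => b k * z ^ k)%C n) ->
    forall k, (k <= n)%nat -> Cmod (c (n - k)%nat - b k) <= B * q ^ n.
Proof.
  intros Hq. destruct (Hc q (proj1 Hq)) as [M HM].
  assert (HM0 := geometric_bound_nonneg c M q HM).
  destruct weight_lower_bound as [m [Hm Hmw]].
  set (W := RInt (fun t => w (cis t)) 0 (2 * PI)).
  assert (HW : 0 <= W).
  { apply RInt_ge_0; trivial. apply ex_RInt_cont, continuous_weight.
    intros t _. generalize (Hmw t). lra. }
  set (T0 := M / (1 - q)).
  assert (HT0 : 0 <= T0). { apply Rmult_le_pos; trivial. apply Rlt_le, Rinv_0_lt_compat. lra. }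
  assert (HPI := PI_RGT_0).
  assert (HD : 0 <= T0 ^ 2 * W / (2 * m)).
  { apply Rmult_le_pos. apply Rmult_le_pos; trivial. apply pow2_ge_0. apply Rlt_le, Rinv_0_lt_compat. lra. }
  exists ((PI + T0 ^ 2 * W / (2 * m)) / (2 * PI)). split.
  { apply Rmult_le_pos. lra. apply Rlt_le, Rinv_0_lt_compat. lra. }
  intros n b Hb1 Hb2 k Hk.
  assert (Hqn : 0 < q ^ n) by (apply pow_lt; lra).
  assert (Htail : forall t, Cmod (e (cis t) - Csum (fun k => c k * cis t ^ k)%C n) <= T0 * q ^ n).
  { intros t. eapply Rle_trans.
    - apply (CPSeries_tail c M q ltac:(lra) HM (cis t) q n). rewrite Cmod_cis. lra. lra.
    - unfold T0. replace (M * q ^ S n / (1 - q)) with (M / (1 - q) * (q * q ^ n)) by (simpl; field; lra).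
      apply Rmult_le_compat_l; trivial. nra. }
  assert (K1 := N2_bound n b Hb1 Hb2 (T0 * q ^ n) ltac:(apply Rmult_le_pos; lra) Htail).
  assert (K2 := coef_L2_bound n b m (q ^ n) k Hm Hmw Hqn Hk).
  fold W in K1.
  set (N2 := RInt _ 0 (2 * PI)) in K1. change (RInt _ 0 (2 * PI)) with N2 in K2.
  apply Rmult_le_reg_l with (2 * PI); [lra|].
  replace (2 * PI * ((PI + T0 ^ 2 * W / (2 * m)) / (2 * PI) * q ^ n))
    with (PI * q ^ n + (T0 * q ^ n) ^ 2 * W / (2 * m * q ^ n)) by (field; lra).
  apply Rle_trans with (1 := K2). apply Rplus_le_compat_l.
  apply Rmult_le_compat_r; trivial.
  apply Rlt_le, Rinv_0_lt_compat. repeat apply Rmult_lt_0_compat; lra.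
Qed.

(** Two errors for [|u| <= U]: the tail of [e], of order [(q U)^n], and the coefficient errors
    [B q^n] against the powers of [u], of order [(q V)^n] with [V] slightly above [U]. *)
Theorem monic_ratio_estimate (r : R) : rho < r -> exists B s, 0 < s < 1 /\
  forall n z, r <= Cmod z ->
    Cmod (monic_poly kappa phi n z / z ^ n - CPSeries c (/ z)) <= B * s ^ n.
Proof.
  intros Hr.
  (* The maximum with 1 ensures [q < 1], as [monic_coef_approximation] demands, and [V > 1] in the
     geometric sum. *)
  set (U := Rmax 1 (/ r)).
  assert (Hr0 : 0 < r) by lra.
  assert (HU1 : 1 <= U) by apply Rmax_l.
  assert (HUr : / r <= U) by apply Rmax_r.
  assert (HrU : rho * U < 1).
  { unfold U, Rmax. destruct (Rle_dec 1 (/ r)); [|lra].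
    apply Rmult_lt_reg_r with r; trivial. rewrite Rmult_assoc, Rinv_l; lra. }
  set (q := (rho + / U) / 2).
  assert (HiU : rho < / U).
  { apply Rmult_lt_reg_r with U; [lra|]. rewrite Rinv_l; lra. }
  assert (HiU1 : / U <= 1). { rewrite <- Rinv_1. apply Rinv_le_contravar; lra. }
  assert (Hq : rho < q < 1) by (unfold q; lra).
  assert (Hq0 : 0 < q) by (unfold q; generalize (Rinv_0_lt_compat U); lra).
  assert (HqU : q * U < 1).
  { apply Rmult_lt_reg_r with (/ U). apply Rinv_0_lt_compat; lra.
    rewrite Rmult_assoc, Rinv_r by lra. unfold q; lra. }
  set (s := (q * U + 1) / 2).
  assert (Hs : 0 < s < 1). { assert (0 < q * U) by (apply Rmult_lt_0_compat; lra). unfold s; lra. }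
  (* Lies above [U] with [q * V = s < 1]; the sum of [B * q^n * V^k] over [k <= n] is then at most
     [B * (V / (V - 1)) * s^n]. *)
  set (V := s / q).
  assert (HVs : q * V = s) by (unfold V; field; lra).
  assert (HVU : U < V). { apply Rmult_lt_reg_l with q; trivial. rewrite HVs. unfold s. lra. }
  destruct (Hc q (proj1 Hq)) as [M HM].
  destruct (monic_coef_approximation q Hq) as [B [HB0 HB]].
  exists (M / (1 - s) + B * (V / (V - 1))), s. split; trivial.
  intros n z Hz.
  assert (Hz0 : z <> RtoC 0) by (apply Cmod_gt_0; lra).
  set (u := (/ z)%C).
  assert (Hu : Cmod u <= U).
  { unfold u. rewrite Cmod_inv by trivial. apply Rle_trans with (2 := HUr).
    apply Rinv_le_contravar; lra. }
  destruct (monic_poly_leading n) as [b [Hb1 Hb2]].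
  specialize (HB n b Hb1 Hb2).
  assert (E : (monic_poly kappa phi n z / z ^ n)%C = Csum (fun k => b (n - k)%nat * u ^ k)%C n).
  { rewrite Hb2. fold_Csum.
    rewrite polynomial_reversal by trivial. unfold u. field. now apply Cpow_nz. }
  rewrite E.
  apply Rle_trans with (Cmod (CPSeries c u - Csum (fun k => c k * u ^ k)%C n)
    + Cmod (Csum (fun k => (c k - b (n - k)%nat) * u ^ k)%C n)).
  { rewrite (Csum_ext (fun k => (c k - b (n - k)%nat) * u ^ k)%C
      (fun k => c k * u ^ k - b (n - k)%nat * u ^ k)%C) by (intros; ring).
    rewrite Csum_minus, Cmod_sub_sym. 
    replace (CPSeries c u - Csum (fun k => b (n - k)%nat * u ^ k) n)%C
      with ((CPSeries c u - Csum (fun k => c k * u ^ k) n)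
        + (Csum (fun k => c k * u ^ k) n - Csum (fun k => b (n - k)%nat * u ^ k) n))%C by ring.
    apply Cmod_triangle. }
  assert (HM0 := geometric_bound_nonneg c M q HM).
  assert (Hsn : 0 < s ^ n) by (apply pow_lt; lra).
  rewrite Rmult_plus_distr_r. apply Rplus_le_compat.
  - eapply Rle_trans.
    + apply (CPSeries_tail c M q ltac:(lra) HM u s n); [|lra].
      apply Rle_trans with (q * U). apply Rmult_le_compat_l; lra. unfold s. lra.
    + replace (M * s ^ S n / (1 - s)) with (M / (1 - s) * (s * s ^ n)) by (simpl; field; lra).
      apply Rmult_le_compat_l; [|nra]. apply Rmult_le_pos; trivial. apply Rlt_le, Rinv_0_lt_compat. lra.
  - assert (Hk : forall m, (m <= n)%nat -> Cmod (Csum (fun k => (c k - b (n - k)%nat) * u ^ k)%C m)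
      <= B * q ^ n * ((V ^ S m - 1) / (V - 1))).
    { assert (Ht : forall k, (k <= n)%nat -> Cmod ((c k - b (n - k)%nat) * u ^ k) <= B * q ^ n * V ^ k).
      { intros k Hk. rewrite Cmod_mult, Cmod_pow. apply Rmult_le_compat; try apply Cmod_ge_0.
        - apply pow_le, Cmod_ge_0.
        - replace (c k) with (c (n - (n - k))%nat) by (f_equal; lia). apply HB. lia.
        - apply pow_incr. split. apply Cmod_ge_0. lra. }
      induction m; intros Hm.
      - rewrite Csum_O. replace ((V ^ 1 - 1) / (V - 1)) with (V ^ 0) by (simpl; field; lra). now apply Ht.
      - rewrite Csum_S. eapply Rle_trans; [apply Cmod_triangle|].
        replace (B * q ^ n * ((V ^ S (S m) - 1) / (V - 1)))
          with (B * q ^ n * ((V ^ S m - 1) / (V - 1)) + B * q ^ n * V ^ S m) by (simpl; field; lra).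
        apply Rplus_le_compat. apply IHm; lia. now apply Ht. }
    apply Rle_trans with (1 := Hk n (le_n n)).
    rewrite <- HVs, Rpow_mult_distr.
    replace (B * (V / (V - 1)) * (q ^ n * V ^ n)) with (B * q ^ n * (V ^ S n / (V - 1))) by (simpl; field; lra).
    apply Rmult_le_compat_l. apply Rmult_le_pos; trivial. apply pow_le; lra.
    apply Rmult_le_compat_r; [|lra]. apply Rlt_le, Rinv_0_lt_compat. lra.
Qed.

End Extremal.

(** * Polynomial roots and their limits *)

Lemma Csum_growth (b : nat -> C) (n : nat) : exists S, 0 <= S /\
  forall z, 1 <= Cmod z -> Cmod (Csum (fun k => b k * z ^ k)%C n) <= S * Cmod z ^ n.
Proof.
  induction n as [|n [S [HS IH]]].
  - exists (Cmod (b O)). split. apply Cmod_ge_0. intros z _. rewrite Csum_O. simpl.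
    right. rewrite Rmult_1_r. f_equal. ring.
  - exists (S + Cmod (b (Datatypes.S n))). split. generalize (Cmod_ge_0 (b (Datatypes.S n))). lra.
    intros z Hz. rewrite Csum_S. eapply Rle_trans; [apply Cmod_triangle|].
    rewrite Rmult_plus_distr_r, Cmod_mult, Cmod_pow. apply Rplus_le_compat_r.
    apply Rle_trans with (1 := IH z Hz). apply Rmult_le_compat_l; trivial.
    apply Rle_pow; trivial. lia.
Qed.

(** If [f] had no zero, the mean value property of [1 / f] on a circle where [|f| >= |f 0| + 1]
    would give [1 / |f 0| <= 1 / (|f 0| + 1)]. *)
Theorem fundamental_theorem_of_algebra (f : C -> C) (n : nat) (a : C) : a <> RtoC 0 ->
  poly_with_leading f (S n) a -> exists z, f z = RtoC 0.
Proof.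
  intros Ha Hf. apply NNPP. intros Hno.
  assert (Hnz : forall z, f z <> RtoC 0). { intros z Hz. apply Hno. now exists z. }
  assert (Df : forall z, Cdiffable f z). { intros z. now apply poly_with_leading_Cdiffable with (S n) a. }
  destruct Hf as [b [Hb1 Hb2]].
  destruct (Csum_growth b n) as [s [Hs Hg]].
  assert (Ha0 := proj1 (Cmod_gt_0 a) Ha). assert (Hf0 := proj1 (Cmod_gt_0 _) (Hnz 0)).
  set (K := Cmod (f 0) + 1).
  (* Makes [|a| * R - s >= K]; as [R > 1], the leading term exceeds the remaining ones by at least
     [K] on the circle. *)
  set (R := 1 + (s + K) / Cmod a).
  assert (HR : 1 < R).
  { assert (0 < (s + K) / Cmod a) by (apply Rdiv_lt_0_compat; unfold K; lra). unfold R. lra. }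
  assert (HaR : K <= Cmod a * R - s).
  { unfold R. replace (Cmod a * (1 + (s + K) / Cmod a) - s) with (Cmod a + K) by (field; lra). lra. }
  assert (Hlow : forall z, Cmod z = R -> K <= Cmod (f z)).
  { intros z Hz. rewrite Hb2. fold_Csum.
    rewrite Csum_S, Hb1.
    generalize (Cmod_sub_ge (a * z ^ S n) (- Csum (fun k => b k * z ^ k)%C n)).
    replace (a * z ^ S n - - Csum (fun k => b k * z ^ k) n)%C
      with (Csum (fun k => b k * z ^ k) n + a * z ^ S n)%C by ring.
    rewrite Cmod_opp, Cmod_mult, Cmod_pow, Hz. intros H1.
    specialize (Hg z ltac:(lra)). rewrite Hz in Hg. change (R ^ S n) with (R * R ^ n) in H1.
    assert (Hp : 1 <= R ^ n) by (apply pow_R1_Rle; lra).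
    assert (K <= (Cmod a * R - s) * R ^ n).
    { apply Rle_trans with (Cmod a * R - s); trivial.
      rewrite <- (Rmult_1_r (Cmod a * R - s)) at 1. apply Rmult_le_compat_l; trivial. unfold K in HaR. lra. }
    lra. }
  assert (Dinv : forall z, Cdiffable (fun z => / f z)%C z).
  { intros z. now apply Cdiffable_inv. }
  assert (Hm := mean_value_property (fun z => / f z)%C 0 R ltac:(lra) (fun z _ => Dinv z)).
  assert (Hb := circle_mean_bound (fun z => / f z)%C 0 R (/ K) ltac:(lra)
    (fun z _ => Cdiffable_continuous _ _ (Dinv z))).
  rewrite Hm in Hb. rewrite Cmod_inv in Hb by trivial.
  assert (Hb' : / Cmod (f 0) <= / K).
  { apply Hb. intros z. replace (z - 0)%C with z by ring. intros Hz.
    rewrite Cmod_inv by trivial. apply Rinv_le_contravar. unfold K; lra. now apply Hlow. }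
  assert (/ K < / Cmod (f 0)); [|lra].
  apply Rinv_lt_contravar; [|unfold K; lra]. apply Rmult_lt_0_compat; unfold K; lra.
Qed.

Lemma poly_with_leading_horner (g : C -> C) (n : nat) (a b : C) :
  poly_with_leading g n a -> poly_with_leading (fun z => b + z * g z)%C (S n) a.
Proof.
  intros [d [Hd1 Hd2]]. exists (fun k => match k with O => b | S k => d k end). split; trivial.
  intros z. rewrite Hd2. fold_Csum.
  rewrite Csum_head, <- Csum_scal. simpl (z ^ 0)%C. rewrite Cmult_1_r. f_equal.
  apply Csum_ext. intros k _. simpl. ring.
Qed.

Lemma poly_with_leading_division (f : C -> C) (n : nat) (a b : C) :
  poly_with_leading f (S n) a ->
  exists g, poly_with_leading g n a /\ forall z, f z = (f b + (z - b) * g z)%C.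
Proof.
  revert f. induction n; intros f [d [Hd1 Hd2]].
  - exists (fun _ => a). split.
    + exists (fun _ => a). split; trivial. intros z. rewrite sum_O. simpl. ring.
    + intros z. rewrite 2!Hd2. fold_Csum.
      rewrite 2!Csum_S, 2!Csum_O, Hd1. simpl. ring.
  - set (h := fun z => Csum (fun k => d (S k) * z ^ k)%C (S n)).
    assert (Hh : poly_with_leading h (S n) a). { now exists (fun k => d (S k)). }
    assert (Ef : forall z, f z = (d O + z * h z)%C).
    { intros z. rewrite Hd2. fold_Csum.
      rewrite Csum_head. unfold h. rewrite <- Csum_scal. simpl (z ^ 0)%C. rewrite Cmult_1_r. f_equal.
      apply Csum_ext. intros k _. simpl. ring. }
    destruct (IHn h Hh) as [g [Hg1 Hg2]].
    exists (fun z => h b + z * g z)%C. split.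
    + now apply poly_with_leading_horner.
    + intros z. rewrite 2!Ef, (Hg2 z). ring.
Qed.

Definition root_product (L : list C) (z : C) : C := fold_right (fun b p => (z - b) * p)%C (RtoC 1) L.

Lemma root_product_app (L1 L2 : list C) (z : C) :
  root_product (L1 ++ L2) z = (root_product L1 z * root_product L2 z)%C.
Proof. induction L1; simpl. ring. rewrite IHL1. ring. Qed.

Lemma root_product_eq_0 (L : list C) (z : C) : root_product L z = RtoC 0 <-> In z L.
Proof.
  induction L; simpl.
  - split; [|easy]. intros E. apply RtoC_inj in E. lra.
  - rewrite <- IHL. split.
    + intros H. apply Cmult_eq_0 in H. destruct H as [H|H]; [left|now right]. symmetry. now apply Csub_eq_0.
    + intros [->|H]; [|rewrite H]; ring.
Qed.

Lemma Cdiffable_root_product (L : list C) (z : C) : Cdiffable (root_product L) z.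
Proof.
  induction L; simpl. apply Cdiffable_const.
  apply (Cdiffable_mult (fun z => z - a)%C); trivial.
  apply Cdiffable_minus. apply Cdiffable_id. apply Cdiffable_const.
Qed.

#[global] Hint Resolve Cdiffable_root_product : smooth.

Lemma root_product_upper (L : list C) (zeta z : C) (rho : R) :
  (forall b, In b L -> Cmod (b - zeta) <= rho) ->
  Cmod (root_product L z) <= (Cmod (z - zeta) + rho) ^ length L.
Proof.
  induction L; intros H; simpl.
  - rewrite Cmod_1. lra.
  - rewrite Cmod_mult. apply Rmult_le_compat; try apply Cmod_ge_0.
    + generalize (Cmod_sub_triangle z zeta a) (H a (or_introl eq_refl)).
      rewrite (Cmod_sub_sym zeta). lra.
    + apply IHL. intros b Hb. apply H. now right.
Qed.

Lemma root_product_lower (L : list C) (zeta z : C) (rho : R) : rho <= Cmod (z - zeta) ->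
  (forall b, In b L -> Cmod (b - zeta) <= rho) ->
  (Cmod (z - zeta) - rho) ^ length L <= Cmod (root_product L z).
Proof.
  intros Hz. induction L; intros H; simpl.
  - rewrite Cmod_1. lra.
  - rewrite Cmod_mult. apply Rmult_le_compat; try lra.
    + apply pow_le. lra.
    + generalize (Cmod_sub_triangle z a zeta) (H a (or_introl eq_refl)). lra.
    + apply IHL. intros b Hb. apply H. now right.
Qed.

Theorem monic_polynomial_factorization (f : C -> C) (n : nat) : poly_with_leading f n (RtoC 1) ->
  exists L, length L = n /\ forall z, f z = root_product L z.
Proof.
  revert f. induction n; intros f Hf.
  - exists nil. split; trivial. destruct Hf as [d [Hd1 Hd2]]. intros z. rewrite Hd2, sum_O, Hd1. simpl. ring.
  - destruct (fundamental_theorem_of_algebra f n 1) as [b Hb]; trivial.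
    { intros E. apply RtoC_inj in E. lra. }
    destruct (poly_with_leading_division f n 1 b Hf) as [g [Hg1 Hg2]].
    destruct (IHn g Hg1) as [L [HL1 HL2]].
    exists (b :: L). split. simpl. now f_equal.
    intros z. rewrite Hg2, Hb, HL2. simpl. ring.
Qed.

Lemma root_product_order (L : list C) (z y : C) :
  root_product L y = ((y - z) ^ count_occ Ceq_dec L z * root_product (remove Ceq_dec z L) y)%C.
Proof.
  induction L as [|b L IH]; simpl.
  - ring.
  - destruct (Ceq_dec b z) as [->|Hb].
    + destruct (Ceq_dec z z) as [_|E]; [|now elim E]. simpl. rewrite IH. ring.
    + destruct (Ceq_dec z b) as [E|_]; [now elim Hb|]. simpl. rewrite IH. ring.
Qed.

(** At a point of [D], the cofactor of the power of [y - z] is the product over the other roots in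
    [Lin] and over [Lout], none of which is [z]. *)
Lemma root_product_zeros_in (f : C -> C) (Lin Lout : list C) (D : C -> Prop) :
  (forall z, f z = (root_product Lin z * root_product Lout z)%C) ->
  (forall b, In b Lin -> D b) -> (forall b, In b Lout -> ~ D b) -> zeros_in f D Lin.
Proof.
  intros Hf Hin Hout. split; trivial. intros z Hz.
  exists (fun _ => True), (fun y => root_product (remove Ceq_dec z Lin) y * root_product Lout y)%C.
  split; [apply open_true|]. split; trivial. split; [|split].
  - apply holomorphic_on_Cdiffable. intros y _. apply Cdiffable_mult; apply Cdiffable_root_product.
  - apply Cmult_neq_0; intros E; apply root_product_eq_0 in E.
    + now apply remove_In in E.
    + now apply (Hout z).
  - intros y _. rewrite Hf, (root_product_order Lin z). ring.
Qed.

Lemma eventually_and (P Q : nat -> Prop) :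
  (exists N : nat, forall n, (N <= n)%nat -> P n) -> (exists N : nat, forall n, (N <= n)%nat -> Q n) ->
  exists N : nat, forall n, (N <= n)%nat -> P n /\ Q n.
Proof.
  intros [N1 H1] [N2 H2]. exists (N1 + N2)%nat. intros n Hn. split. apply H1; lia. apply H2; lia.
Qed.

(** The rate becomes the [k]-th root of [q]. Taking [M' = max 1 M] gives [M <= M'^k] for every sign
    of [M]. *)
Lemma geometric_root (k : nat) (M q : R) : (0 < k)%nat -> 0 < q < 1 ->
  exists M' q', 0 < M' /\ 0 < q' < 1 /\ forall n x, 0 <= x -> x ^ k <= M * q ^ n -> x <= M' * q' ^ n.
Proof.
  intros Hk Hq.
  assert (Hk' : 0 < / INR k) by (apply Rinv_0_lt_compat, lt_0_INR; trivial).
  set (q' := Rpower q (/ INR k)).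
  assert (Hq'k : q' ^ k = q).
  { unfold q'. rewrite <- Rpower_pow by apply exp_pos. rewrite Rpower_mult, Rinv_l, Rpower_1; trivial; try lra.
    apply not_0_INR. lia. }
  assert (Hq'0 : 0 < q') by apply exp_pos.
  assert (Hq'1 : q' < 1).
  { apply Rnot_le_lt. intros H. assert (1 <= q' ^ k) by now apply pow_R1_Rle. lra. }
  set (M' := Rmax 1 M).
  assert (HM'1 : 1 <= M') by apply Rmax_l. assert (HM' : M <= M') by apply Rmax_r.
  exists M', q'. split; [lra|split; [lra|]]. intros n x Hx H.
  apply Rnot_lt_le. intros Hlt.
  assert (Hp : 0 < q' ^ n) by now apply pow_lt.
  assert (H1 : (M' * q' ^ n) ^ k < x ^ k).
  { assert (H0 : 0 <= M' * q' ^ n) by (apply Rmult_le_pos; lra).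
    revert H0 Hlt. generalize (M' * q' ^ n). intros y Hy Hyx. destruct k; [lia|]. clear - Hy Hyx.
    induction k. simpl; lra. change (y * y ^ S k < x * x ^ S k).
    apply Rmult_le_0_lt_compat; trivial. apply pow_le; trivial. }
  assert (H2 : M * q ^ n <= (M' * q' ^ n) ^ k).
  { rewrite Rpow_mult_distr, <- pow_mult, Nat.mul_comm, pow_mult, Hq'k.
    apply Rmult_le_compat_r. apply pow_le; lra.
    apply Rle_trans with (1 := HM'). rewrite <- (pow_1 M') at 1. apply Rle_pow; trivial. }
  lra.
Qed.

(** Only the centre of the disc is bounded, which the mean value property gives directly; the discs
    below are therefore centred at the point of interest. *)
Lemma maximum_principle (h : C -> C) (z : C) (r B : R) : 0 < r ->
  (forall y, Cmod (y - z) <= r -> Cdiffable h y) ->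
  (forall y, Cmod (y - z) = r -> Cmod (h y) <= B) -> Cmod (h z) <= B.
Proof.
  intros Hr Hd Hb. rewrite <- (mean_value_property h z r Hr Hd).
  apply circle_mean_bound; trivial. lra. intros y Hy. apply Cdiffable_continuous, Hd. lra.
Qed.

(** * A quantitative Hurwitz theorem *)

Section Hurwitz.
Context (f H : nat -> C -> C) (g G : C -> C) (L : nat -> list C) (zeta : C) (R0 c0 C0 M q : R) (k : nat).
Context (Hk : (0 < k)%nat) (HR0 : 0 < R0) (Hc0 : 0 < c0) (Hq : 0 < q < 1).
Context (Hg : forall z, Cmod (z - zeta) < R0 -> g z = ((z - zeta) ^ k * G z)%C /\ c0 <= Cmod (G z) <= C0).
Context (Hfg : forall n z, Cmod (z - zeta) < R0 -> Cmod (f n z - g z) <= M * q ^ n).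
Context (HL : forall n b, In b (L n) -> Cmod (b - zeta) < R0).
Context (HfL : forall n z, Cmod (z - zeta) < R0 -> f n z = (root_product (L n) z * H n z)%C).
Context (HHd : forall n z, Cmod (z - zeta) < R0 -> Cdiffable (H n) z).
Context (HHnz : forall n z, Cmod (z - zeta) < R0 -> H n z <> RtoC 0).

Lemma g_lower (z : C) : Cmod (z - zeta) < R0 -> c0 * Cmod (z - zeta) ^ k <= Cmod (g z).
Proof.
  intros Hz. destruct (Hg z Hz) as [E HG]. rewrite E, Cmod_mult, Cmod_pow, Rmult_comm.
  apply Rmult_le_compat_l; [|lra]. apply pow_le, Cmod_ge_0.
Qed.

Lemma g_upper (z : C) : Cmod (z - zeta) < R0 -> Cmod (g z) <= C0 * Cmod (z - zeta) ^ k.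
Proof.
  intros Hz. destruct (Hg z Hz) as [E HG]. rewrite E, Cmod_mult, Cmod_pow, Rmult_comm.
  apply Rmult_le_compat_r; [|lra]. apply pow_le, Cmod_ge_0.
Qed.

(** At a zero [b] of [f n] one has [c0 * |b - zeta|^k <= |g b| <= M * q^n]. *)
Lemma hurwitz_rate : exists M' q', 0 < M' /\ 0 < q' < 1 /\
  forall n b, In b (L n) -> Cmod (b - zeta) <= M' * q' ^ n.
Proof.
  destruct (geometric_root k (M / c0) q Hk Hq) as [M' [q' [HM' [Hq' K]]]].
  exists M', q'. split; trivial. split; trivial. intros n b Hb. apply K. apply Cmod_ge_0.
  assert (Hz := HL n b Hb).
  assert (E : f n b = RtoC 0).
  { rewrite HfL by trivial. replace (root_product (L n) b) with (RtoC 0). ring.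
    symmetry. now apply root_product_eq_0. }
  assert (H1 := Hfg n b Hz). rewrite E, Cmod_sub_sym in H1.
  replace (g b - 0)%C with (g b) in H1 by ring.
  assert (H2 := g_lower b Hz).
  apply Rmult_le_reg_l with c0; trivial.
  replace (c0 * (M / c0 * q ^ n)) with (M * q ^ n) by (field; lra). lra.
Qed.

(* Too few zeros would keep [1 / H], hence [f], from being as small near [zeta] as
   [(z - zeta)^k]; the circle has radius [R0 / 2] and its centre [zeta + s] is close
   to [zeta]. *)
Lemma hurwitz_lower : exists m, forall n, (m <= n)%nat -> (k <= length (L n))%nat.
Proof.
  destruct hurwitz_rate as [M' [q' [HM' [Hq' Hrate]]]].
  assert (HC0 : c0 <= C0).
  { assert (Hzz : Cmod (zeta - zeta) < R0).
    { replace (zeta - zeta)%C with (RtoC 0) by ring. now rewrite Cmod_0. }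
    destruct (Hg zeta Hzz) as [_ HG]. lra. }
  (* A lower bound of [|g|] on the circle of radius [R0 / 2] about [z], since
     [|z - zeta| = s <= R0 / 8] keeps it at distance at least [3 * R0 / 8] from [zeta]. For large
     [n], [|f n|] is then at least [A / 2], whence the bound [B1] of [1 / H]. *)
  set (A := c0 * (3 * R0 / 8) ^ k).
  assert (HA : 0 < A). { apply Rmult_lt_0_compat; trivial. apply pow_lt. lra. }
  set (B1 := (R0 + 1) ^ k * (2 / A)).
  assert (HB1 : 0 < B1).
  { apply Rmult_lt_0_compat. apply pow_lt; lra. apply Rdiv_lt_0_compat; lra. }
  (* Collects the constants of the final inequality [(s / 2)^(k-1) <= T * s * (s / 2)^(k-1)], which
     [T * s < 1] refutes. *)
  set (T := 2 ^ k * B1 * C0).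
  assert (HT : 0 < T).
  { apply Rmult_lt_0_compat; [apply Rmult_lt_0_compat; [apply pow_lt|]|]; lra. }
  set (s := Rmin (Rmin 1 (R0 / 8)) (/ (2 * T))).
  assert (Hs0 : 0 < s). { repeat apply Rmin_glb_lt; try lra. apply Rinv_0_lt_compat; lra. }
  assert (Hs1 : s <= 1) by (eapply Rle_trans; apply Rmin_l).
  assert (Hs2 : s <= R0 / 8) by (eapply Rle_trans; [apply Rmin_l|apply Rmin_r]).
  assert (Hs3 : T * s < 1).
  { apply Rle_lt_trans with (T * / (2 * T)). apply Rmult_le_compat_l; [lra|apply Rmin_r].
    replace (T * / (2 * T)) with (/ 2) by (field; lra). lra. }
  assert (Hsk : 0 < s ^ k) by now apply pow_lt.
  destruct (eventually_and _ _ (geometric_small M q (A / 2) Hq ltac:(lra))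
    (eventually_and _ _ (geometric_small M q (C0 * s ^ k) Hq ltac:(apply Rmult_lt_0_compat; lra))
      (geometric_small M' q' (s / 2) Hq' ltac:(lra)))) as [m Hm].
  exists m. intros n Hn. destruct (Hm n Hn) as [H1 [H2 H3]].
  apply Nat.nlt_ge. intros Hlen.
  (* At distance [s] from [zeta], while the roots are within [s / 2]: fewer than [k] root factors
     have a product of modulus at least [(s / 2)^(k-1)], whereas [|f n z| <= 2 * C0 * s^k]. *)
  set (z := (zeta + RtoC s)%C).
  assert (Hz : Cmod (z - zeta) = s).
  { unfold z. replace (zeta + RtoC s - zeta)%C with (RtoC s) by ring. rewrite Cmod_R, Rabs_pos_eq; lra. }
  assert (Hdisc : forall y, Cmod (y - z) <= R0 / 2 -> Cmod (y - zeta) <= 5 * R0 / 8).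
  { intros y Hy. generalize (Cmod_sub_triangle y z zeta). lra. }
  assert (Hcirc : forall y, Cmod (y - z) = R0 / 2 -> 3 * R0 / 8 <= Cmod (y - zeta)).
  { intros y Hy. generalize (Cmod_sub_triangle y zeta z). rewrite (Cmod_sub_sym zeta z). lra. }
  assert (Hbd : forall b, In b (L n) -> Cmod (b - zeta) <= s / 2).
  { intros b Hb. generalize (Hrate n b Hb). lra. }
  assert (K : Cmod (/ H n z) <= B1).
  { apply (maximum_principle (fun y => / H n y)%C z (R0 / 2)). lra.
    - intros y Hy. specialize (Hdisc y Hy). apply Cdiffable_inv. apply HHnz; lra. apply HHd; lra.
    - intros y Hy. assert (Hy1 := Hdisc y ltac:(lra)). specialize (Hcirc y Hy).
      assert (Hy2 : Cmod (y - zeta) < R0) by lra.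
      assert (Hfy : A / 2 <= Cmod (f n y)).
      { assert (K1 := Hfg n y Hy2). assert (K2 := g_lower y Hy2).
        assert (K3 : A <= c0 * Cmod (y - zeta) ^ k).
        { apply Rmult_le_compat_l. lra. apply pow_incr. lra. }
        generalize (Cmod_sub_ge (g y) (f n y)). rewrite Cmod_sub_sym. lra. }
      assert (Hfy0 : f n y <> RtoC 0) by (apply Cmod_gt_0; lra).
      assert (E : (/ H n y)%C = (root_product (L n) y / f n y)%C).
      { rewrite HfL in Hfy0 |- * by trivial. field. split. now apply HHnz.
        intros E0. apply Hfy0. rewrite E0. ring. }
      rewrite E, Cmod_div by trivial. unfold B1.
      apply Rmult_le_compat. apply Cmod_ge_0. apply Rlt_le, Rinv_0_lt_compat; lra.
      + eapply Rle_trans. apply (root_product_upper (L n) zeta y (s / 2) Hbd).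
        apply Rle_trans with ((R0 + 1) ^ length (L n)).
        * apply pow_incr. split; [|lra]. generalize (Cmod_ge_0 (y - zeta)). lra.
        * apply Rle_pow. lra. lia.
      + unfold Rdiv. rewrite <- (Rinv_inv 2), <- Rinv_mult. apply Rinv_le_contravar; lra. }
  assert (HHz := HHnz n z ltac:(lra)). assert (HHz' := proj1 (Cmod_gt_0 _) HHz).
  rewrite Cmod_inv in K by trivial.
  assert (F1 : Cmod (f n z) <= 2 * C0 * s ^ k).
  { assert (K1 := Hfg n z ltac:(lra)). assert (K2 := g_upper z ltac:(lra)). rewrite Hz in K2.
    generalize (Cmod_sub_ge (f n z) (g z)). lra. }
  assert (F2 : (s / 2) ^ pred k <= B1 * Cmod (f n z)).
  { rewrite HfL, Cmod_mult by lra.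
    assert (K1 := root_product_lower (L n) zeta z (s / 2) ltac:(lra) Hbd). rewrite Hz in K1.
    replace (s - s / 2) with (s / 2) in K1 by field.
    assert (K2 : (s / 2) ^ pred k <= (s / 2) ^ length (L n)).
    { replace (pred k) with (length (L n) + (pred k - length (L n)))%nat by lia. rewrite pow_add.
      rewrite <- (Rmult_1_r ((s / 2) ^ length (L n))) at 2. apply Rmult_le_compat_l. apply pow_le; lra.
      rewrite <- (pow1 (pred k - length (L n))). apply pow_incr. lra. }
    assert (K3 : 1 <= B1 * Cmod (H n z)).
    { apply Rmult_le_compat_r with (r := Cmod (H n z)) in K; [|lra]. rewrite Rinv_l in K; lra. }
    set (x := Cmod (root_product (L n) z)) in *. set (h := Cmod (H n z)) in *.
    replace (B1 * (x * h)) with (x * (B1 * h)) by ring.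
    assert (Hx : 0 <= x) by apply Cmod_ge_0. nra. }
  assert (F3 : (s / 2) ^ pred k <= T * s * (s / 2) ^ pred k).
  { apply Rle_trans with (1 := F2). apply Rle_trans with (B1 * (2 * C0 * s ^ k)).
    - apply Rmult_le_compat_l; lra.
    - right. assert (E1 : s ^ k = s * s ^ pred k).
      { change (s ^ k = s ^ S (pred k)). f_equal. lia. }
      assert (E2 : 2 ^ k = 2 * 2 ^ pred k).
      { change (2 ^ k = 2 ^ S (pred k)). f_equal. lia. }
      unfold T. rewrite E1, E2. unfold Rdiv. rewrite Rpow_mult_distr, pow_inv. field.
      apply pow_nonzero. lra. }
  assert (F4 : 0 < (s / 2) ^ pred k) by (apply pow_lt; lra). nra.
Qed.

(* Dividing [f n] by [k + 1] of its root factors would make [f n], hence [g], of order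
   [(z - zeta)^(k + 1)] near [zeta]. *)
Lemma hurwitz_upper : exists m, forall n, (m <= n)%nat -> (length (L n) <= k)%nat.
Proof.
  destruct hurwitz_rate as [M' [q' [HM' [Hq' Hrate]]]].
  assert (HC0 : c0 <= C0).
  { assert (Hzz : Cmod (zeta - zeta) < R0).
    { replace (zeta - zeta)%C with (RtoC 0) by ring. now rewrite Cmod_0. }
    destruct (Hg zeta Hzz) as [_ HG]. lra. }
  (* Bounds the quotient [h] on the circle: [|f n|] is at most [C0 * R0^k + 1] there, and each of
     the [k + 1] removed factors is at least [3 * R0 / 8 - s >= R0 / 4]. *)
  set (B2 := (C0 * R0 ^ k + 1) * (/ (R0 / 4) ^ S k)).
  assert (HB2 : 0 < B2).
  { apply Rmult_lt_0_compat. assert (0 <= C0 * R0 ^ k) by (apply Rmult_le_pos; [lra|apply pow_le; lra]). lra.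
    apply Rinv_0_lt_compat, pow_lt. lra. }
  (* At [z] the [k + 1] factors are at most [2 * s] each, so [c0 / 2 * s^k <= |f n z| <= (2 *
     s)^(k+1) * B2], which equals [T * s * (c0 / 2 * s^k)]. *)
  set (T := B2 * 2 ^ S k * (2 / c0)).
  assert (HT : 0 < T).
  { apply Rmult_lt_0_compat; [apply Rmult_lt_0_compat; [|apply pow_lt]|apply Rdiv_lt_0_compat]; lra. }
  set (s := Rmin (R0 / 8) (/ (2 * T))).
  assert (Hs0 : 0 < s). { repeat apply Rmin_glb_lt; try lra. apply Rinv_0_lt_compat; lra. }
  assert (Hs2 : s <= R0 / 8) by apply Rmin_l.
  assert (Hs3 : T * s < 1).
  { apply Rle_lt_trans with (T * / (2 * T)). apply Rmult_le_compat_l; [lra|apply Rmin_r].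
    replace (T * / (2 * T)) with (/ 2) by (field; lra). lra. }
  assert (Hsk : 0 < s ^ k) by now apply pow_lt.
  destruct (eventually_and _ _ (geometric_small M q 1 Hq ltac:(lra))
    (eventually_and _ _ (geometric_small M q (c0 / 2 * s ^ k) Hq ltac:(apply Rmult_lt_0_compat; lra))
      (geometric_small M' q' s Hq' ltac:(lra)))) as [m Hm].
  exists m. intros n Hn. destruct (Hm n Hn) as [H1 [H2 H3]].
  apply Nat.nlt_ge. intros Hlen.
  set (L1 := firstn (S k) (L n)). set (L2 := skipn (S k) (L n)).
  assert (HL1 : length L1 = S k) by (apply firstn_length_le; lia).
  assert (EL : L n = L1 ++ L2) by (symmetry; apply firstn_skipn).
  set (z := (zeta + RtoC s)%C).
  assert (Hz : Cmod (z - zeta) = s).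
  { unfold z. replace (zeta + RtoC s - zeta)%C with (RtoC s) by ring. rewrite Cmod_R, Rabs_pos_eq; lra. }
  assert (Hdisc : forall y, Cmod (y - z) <= R0 / 2 -> Cmod (y - zeta) <= 5 * R0 / 8).
  { intros y Hy. generalize (Cmod_sub_triangle y z zeta). lra. }
  assert (Hcirc : forall y, Cmod (y - z) = R0 / 2 -> 3 * R0 / 8 <= Cmod (y - zeta)).
  { intros y Hy. generalize (Cmod_sub_triangle y zeta z). rewrite (Cmod_sub_sym zeta z). lra. }
  assert (Hbd : forall b, In b L1 -> Cmod (b - zeta) <= s).
  { intros b Hb. assert (Hb' : In b (L n)) by (rewrite EL; apply in_or_app; now left).
    generalize (Hrate n b Hb'). lra. }
  set (h := fun y => (root_product L2 y * H n y)%C).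
  assert (Hfh : forall y, Cmod (y - zeta) < R0 -> f n y = (root_product L1 y * h y)%C).
  { intros y Hy. rewrite HfL, EL, root_product_app by trivial. unfold h. ring. }
  assert (K : Cmod (h z) <= B2).
  { apply (maximum_principle h z (R0 / 2)). lra.
    - intros y Hy. specialize (Hdisc y Hy). apply Cdiffable_mult. apply Cdiffable_root_product. apply HHd; lra.
    - intros y Hy. assert (Hy1 := Hdisc y ltac:(lra)). specialize (Hcirc y Hy).
      assert (Hy2 : Cmod (y - zeta) < R0) by lra.
      assert (Hfy : Cmod (f n y) <= C0 * R0 ^ k + 1).
      { assert (K1 := Hfg n y Hy2). assert (K2 := g_upper y Hy2).
        assert (K3 : C0 * Cmod (y - zeta) ^ k <= C0 * R0 ^ k).
        { apply Rmult_le_compat_l. lra. apply pow_incr. split. apply Cmod_ge_0. lra. }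
        generalize (Cmod_sub_ge (f n y) (g y)). lra. }
      assert (Hp : (R0 / 4) ^ S k <= Cmod (root_product L1 y)).
      { rewrite <- HL1. eapply Rle_trans; [|apply (root_product_lower L1 zeta y s ltac:(lra) Hbd)].
        apply pow_incr. lra. }
      assert (Hp0 : 0 < (R0 / 4) ^ S k) by (apply pow_lt; lra).
      assert (Hpn : root_product L1 y <> RtoC 0) by (apply Cmod_gt_0; lra).
      replace (h y) with (f n y / root_product L1 y)%C by (rewrite Hfh by trivial; field; trivial).
      rewrite Cmod_div by trivial. apply Rmult_le_compat; trivial. apply Cmod_ge_0.
      apply Rlt_le, Rinv_0_lt_compat; lra. now apply Rinv_le_contravar. }
  assert (F1 : c0 / 2 * s ^ k <= Cmod (f n z)).
  { assert (K1 := Hfg n z ltac:(lra)). assert (K2 := g_lower z ltac:(lra)). rewrite Hz in K2.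
    generalize (Cmod_sub_ge (g z) (f n z)). rewrite Cmod_sub_sym. lra. }
  assert (F2 : Cmod (f n z) <= (2 * s) ^ S k * B2).
  { rewrite Hfh, Cmod_mult by lra. apply Rmult_le_compat; try apply Cmod_ge_0; trivial.
    rewrite <- HL1. eapply Rle_trans. apply (root_product_upper L1 zeta z s Hbd). rewrite Hz.
    apply pow_incr. lra. }
  assert (F3 : c0 / 2 * s ^ k <= T * s * (c0 / 2 * s ^ k)).
  { apply Rle_trans with (1 := F1). apply Rle_trans with (1 := F2). right. unfold T.
    rewrite Rpow_mult_distr. simpl. field. lra. }
  assert (F4 : 0 < c0 / 2 * s ^ k) by (apply Rmult_lt_0_compat; lra). nra.
Qed.

End Hurwitz.

(** * Zeros of the exterior Szego function *)

(* On [|u| = s] the factor [(s^2 - conj u0 u) / s] has the same modulus as [u - u0];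
   substituting it for the zeros at [u0] bounds their number by the mean value property. *)
Lemma power_series_zero_order (a : nat -> C) (rho : R) (u0 : C) : 0 <= rho -> coef_decay a rho ->
  a O <> RtoC 0 -> u0 <> RtoC 0 -> rho * Cmod u0 < 1 ->
  exists (k : nat) (b : nat -> C), coef_decay b rho /\ CPSeries b u0 <> RtoC 0 /\
    forall u, rho * Cmod u < 1 -> CPSeries a u = ((u - u0) ^ k * CPSeries b u)%C.
Proof.
  intros Hrho Ha Ha0 Hu0 Hru0.
  (* Repeated division by [u - u0]. If it never ended with a nonzero value at [u0], the zero would
     have infinite order. *)
  set (b := fun k => Nat.iter k (fun a => power_series_quotient a u0) a).
  assert (Hb : forall k, coef_decay (b k) rho).
  { induction k; trivial. now apply coef_decay_quotient. }
  apply NNPP. intros Hno.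
  assert (Hz : forall k, forall u, rho * Cmod u < 1 -> CPSeries a u = ((u - u0) ^ k * CPSeries (b k) u)%C).
  { induction k.
    - intros u _. simpl. ring.
    - assert (Hbk : CPSeries (b k) u0 = RtoC 0).
      { apply NNPP. intros Hnz. apply Hno. now exists k, (b k). }
      intros u Hu. rewrite IHk by trivial.
      rewrite (coef_decay_division (b k) rho u0 u Hrho (Hb k) Hru0 Hu), Hbk.
      change (b (S k)) with (power_series_quotient (b k) u0). simpl. ring. }
  assert (Hm0 := proj1 (Cmod_gt_0 u0) Hu0). assert (Hma := proj1 (Cmod_gt_0 _) Ha0).
  destruct (radius_between rho (Cmod u0) (Cmod_ge_0 u0) Hru0) as [q [Hq1 Hq2]].
  assert (Hq0 : 0 < q) by lra.
  (* A radius with [|u0| < s < 1 / rho]: the circle surrounds [u0] and lies in the disc of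
     convergence. *)
  set (s := / q).
  assert (Hs : Cmod u0 < s).
  { unfold s. apply Rmult_lt_reg_l with q; trivial. rewrite Rinv_r; lra. }
  assert (Hrs : rho * s < 1).
  { unfold s. apply Rmult_lt_reg_r with q; trivial. rewrite Rmult_assoc, Rinv_l; lra. }
  assert (Hdisc : forall u, Cmod (u - 0) <= s -> rho * Cmod u < 1).
  { intros u. replace (u - 0)%C with u by ring. intros Hu.
    apply Rle_lt_trans with (2 := Hrs). now apply Rmult_le_compat_l. }
  destruct (circle_bounded (CPSeries a) 0 s) as [B HB]. lra.
  { intros u Hu. apply Cdiffable_continuous, (coef_decay_Cdiffable a rho); trivial. apply Hdisc. lra. }
  assert (K : forall k, Cmod (a O) * (s / Cmod u0) ^ k <= B).
  { intros k.
    set (h := fun u => (CPSeries (b k) u * ((RtoC s ^ 2 - Cconj u0 * u) / RtoC s) ^ k)%C).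
    assert (Hs0 : RtoC s <> RtoC 0) by (apply RtoC_neq_0; lra).
    assert (Hh : Cmod (h 0) <= B).
    { apply (maximum_principle h 0 s B). lra.
      - intros u Hu. apply Cdiffable_mult. apply (coef_decay_Cdiffable _ rho); auto.
        apply Cdiffable_pow, Cdiffable_div; trivial. 2: apply Cdiffable_const.
        smooth.
      - intros u Hu. apply Rle_trans with (2 := HB u Hu). right. unfold h.
        rewrite (Hz k) by (apply Hdisc; lra).
        rewrite 2!Cmod_mult, 2!Cmod_pow, Rmult_comm. f_equal. f_equal.
        assert (Hus : Cmod u = s). { rewrite <- Hu. f_equal. ring. }
        rewrite Cmod_div by trivial.
        replace (RtoC s ^ 2 - Cconj u0 * u)%C with (u * Cconj (u - u0))%C.
        + rewrite Cmod_mult, Cmod_conj, Hus, Cmod_R, Rabs_pos_eq by lra. field. lra.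
        + rewrite <- RtoC_pow, <- Hus, Cmod2_conj, Cminus_conj. ring. }
    assert (E : Cmod (a O) * (s / Cmod u0) ^ k = Cmod (h 0)).
    { unfold h. replace ((RtoC s ^ 2 - Cconj u0 * 0) / RtoC s)%C with (RtoC s) by (field; trivial).
      rewrite Cmod_mult, Cmod_pow, Cmod_R, Rabs_pos_eq by lra.
      rewrite <- (CPSeries_0 a), (Hz k 0).
      - rewrite Cmod_mult, Cmod_pow. replace (0 - u0)%C with (- u0)%C by ring. rewrite Cmod_opp.
        unfold Rdiv. rewrite Rpow_mult_distr, pow_inv. field. apply pow_nonzero. lra.
      - rewrite Cmod_0. lra. }
    now rewrite E. }
  (* The bound [|a O| * (1 + x)^k <= B] for all [k] is refuted by Bernoulli's inequality. *)
  set (x := s / Cmod u0 - 1).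
  assert (Hx : 0 < x).
  { unfold x. assert (1 < s / Cmod u0); [|lra].
    apply Rmult_lt_reg_r with (Cmod u0); trivial. unfold Rdiv. rewrite Rmult_assoc, Rinv_l; lra. }
  destruct (INR_unbounded (B / (Cmod (a O) * x))) as [n Hn].
  assert (Hp := poly n x Hx). specialize (K n).
  replace (s / Cmod u0) with (1 + x) in K by (unfold x; ring).
  assert (Hax : 0 < Cmod (a O) * x) by now apply Rmult_lt_0_compat.
  assert (H1 : B < INR n * (Cmod (a O) * x)).
  { apply Rmult_lt_compat_r with (r := Cmod (a O) * x) in Hn; trivial.
    replace (B / (Cmod (a O) * x) * (Cmod (a O) * x)) with B in Hn; trivial. field. split; lra. }
  assert (H2 : Cmod (a O) * (1 + INR n * x) <= B).
  { apply Rle_trans with (2 := K). apply Rmult_le_compat_l; lra. }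
  nra.
Qed.

(** A finite subcover by members of an increasing sequence has a largest one. In the main theorem
    this supplies the distance of [K] from [|z| = rho] and the minimum of [|De|] on [K]. *)
Lemma Ccompact_increasing_cover (K : C -> Prop) (V : nat -> C -> Prop) : Ccompact K ->
  (forall j z, V j z -> locally (T := C_UniformSpace) z (V j)) ->
  (forall i j z, (i <= j)%nat -> V i z -> V j z) ->
  (forall z, K z -> exists j, V j z) -> exists j, forall z, K z -> V j z.
Proof.
  intros HK Hopen Hmono Hcov.
  destruct (HK (fun U => exists j, U = V j)) as [l [Hl Hl2]].
  - intros U [j ->] z Hz. now apply Hopen.
  - intros z Hz. destruct (Hcov z Hz) as [j Hj]. exists (V j). split; trivial. now exists j.
  - assert (HJ : exists J, forall z, List.Exists (fun U => U z) l -> V J z).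
    { clear Hl2. induction Hl as [|U l [j ->] Hl [J IH]].
      - exists O. intros z Hz. inversion Hz.
      - exists (j + J)%nat. intros z Hz. inversion Hz; subst.
        + apply Hmono with j; trivial. lia.
        + apply Hmono with J; [lia|]. now apply IH. }
    destruct HJ as [J HJ]. exists J. auto.
Qed.

Lemma inv_INR_small (x : R) : 0 < x -> exists j, / INR (S j) < x.
Proof.
  intros Hx. destruct (INR_unbounded (/ x)) as [j Hj]. exists j.
  assert (Hj' : / x < INR (S j)) by (rewrite S_INR; lra).
  rewrite <- (Rinv_inv x). apply Rinv_lt_contravar; trivial.
  apply Rmult_lt_0_compat. now apply Rinv_0_lt_compat. apply lt_0_INR; lia.
Qed.

Lemma inv_INR_antitone (i j : nat) : (i <= j)%nat -> / INR (S j) <= / INR (S i).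
Proof.
  intros Hij. apply Rinv_le_contravar. apply lt_0_INR; lia. apply le_INR. lia.
Qed.

Lemma Cmod_gt_locally (f : C -> C) (z : C) (x : R) : Ccontinuous (T := C_UniformSpace) f z -> x < Cmod (f z) ->
  locally (T := C_UniformSpace) z (fun y => x < Cmod (f y)).
Proof.
  intros Hf Hx. assert (He : 0 < Cmod (f z) - x) by lra.
  generalize (Hf _ He). apply filter_imp. intros y Hy.
  generalize (Cmod_sub_ge (f z) (f y)). rewrite Cmod_sub_sym. lra.
Qed.

Theorem proposition1 (w : C -> R) (kappa : nat -> R) (phi : nat -> C -> C)
    (hw : positive_analytic_weight w)
    (hphi : orthonormal_polynomials w kappa phi) :
  let rho := szego_rho w in
  let De := szego_De w in
  let tau := szego_tau w in
  let Phi := monic_poly kappa phi in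
  let ratio := fun (n : nat) (z : C) => (Phi n z / z ^ n)%C in
  let limit := fun z : C => (De z / RtoC tau)%C in
  (0 <= rho < 1 /\ szego_continuation w rho De) /\
  locally_uniform_limit (fun z => rho < Cmod z) ratio limit /\
  (forall K : C -> Prop, Ccompact K -> (forall z, K z -> rho < Cmod z) ->
     geometric_limit_on K ratio limit) /\
  (forall K : C -> Prop, Ccompact K ->
     (forall z, K z -> rho < Cmod z /\ De z <> RtoC 0) ->
     exists m : nat, forall n, (m <= n)%nat ->
       forall z, K z -> Phi n z <> RtoC 0) /\
  (forall zeta : C, rho < Cmod zeta < 1 -> De zeta = RtoC 0 ->
     exists k : nat, (0 < k)%nat /\ zero_of_order De zeta k /\
       exists (r M q : R) (m : nat), 0 < r /\ 0 < q < 1 /\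
         forall n, (m <= n)%nat ->
           exists l : list C,
             zeros_in (Phi n) (fun z => Cmod (z - zeta) < r) l /\
             length l = k /\
             forall z, In z l -> Cmod (z - zeta) <= M * q ^ n).
Proof.
  intros rho De tau Phi ratio limit.
  destruct (szego_expansion w hw) as [c [Hrho [Hc0 [Hdec [Hcont [HDe [Hnz Hwt]]]]]]].
  fold rho in Hrho, Hdec, Hcont, HDe. fold De in Hcont, HDe. fold tau in HDe, Hwt.
  assert (Htau : 0 < tau) by apply exp_pos.
  assert (Htau0 : RtoC tau <> RtoC 0) by (apply RtoC_neq_0; lra).
  assert (Hlim : forall z, rho < Cmod z -> limit z = CPSeries c (/ z)).
  { intros z Hz. unfold limit. rewrite HDe by trivial. field. trivial. }
  (* The one estimate from which all the convergence and zero statements are drawn. *)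
  assert (Hest : forall r, rho < r -> exists B s, 0 < s < 1 /\
    forall n z, r <= Cmod z -> Cmod (ratio n z - limit z) <= B * s ^ n).
  { intros r Hr.
    destruct (monic_ratio_estimate w kappa phi hphi c rho tau Hrho Hc0 Hdec Htau Hnz Hwt r Hr) as [B [s [Hs H]]].
    exists B, s. split; trivial. intros n z Hz. rewrite Hlim by lra. now apply H. }
  assert (HDc : forall z, rho < Cmod z -> Ccontinuous (T := C_UniformSpace) De z).
  { intros z Hz. apply Cdiffable_continuous, ex_derive_Cdiffable, Hcont, Hz. }
  split; [now split|]. split; [|split; [|split]].
  - intros z0 Hz0. exists (fun z => (rho + Cmod z0) / 2 < Cmod z). split; [|split].
    + intros z Hz. apply (Cmod_gt_locally (fun z => z)); smooth.
    + lra.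
    + intros eps He. destruct (Hest ((rho + Cmod z0) / 2)) as [B [s [Hs H]]]; [lra|].
      destruct (geometric_small B s eps Hs He) as [N HN]. exists N. intros n Hn z Hz _.
      apply Rle_lt_trans with (2 := HN n Hn). apply H. lra.
  - intros K HK HKr.
    destruct (Ccompact_increasing_cover K (fun j z => rho + / INR (S j) < Cmod z) HK) as [j Hj].
    + intros j z Hz. apply (Cmod_gt_locally (fun z => z)); smooth.
    + intros i j z Hij Hz. generalize (inv_INR_antitone i j Hij). lra.
    + intros z Hz. destruct (inv_INR_small (Cmod z - rho)) as [j Hj]. specialize (HKr z Hz). lra.
      exists j. lra.
    + assert (Hj0 : 0 < / INR (S j)) by (apply Rinv_0_lt_compat, lt_0_INR; lia).
      destruct (Hest (rho + / INR (S j))) as [B [s [Hs H]]]; [lra|].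
      exists B, s. split; trivial. intros n z Hz. apply H. apply Rlt_le. now apply Hj.
  - intros K HK HKr.
    (* One index [j] bounds both [|z| - rho] and [|De z|] from below on [K]; a zero of [Phi n] in
       [K] would then contradict [|limit| > / INR (S j) / tau] for large [n]. *)
    destruct (Ccompact_increasing_cover K
      (fun j z => rho + / INR (S j) < Cmod z /\ / INR (S j) < Cmod (De z)) HK) as [j Hj].
    + intros j z [Hz1 Hz2].
      assert (Hj0 : 0 < / INR (S j)) by (apply Rinv_0_lt_compat, lt_0_INR; lia).
      apply filter_and.
      * apply (Cmod_gt_locally (fun z => z)); smooth.
      * apply Cmod_gt_locally; trivial. apply HDc. lra.
    + intros i j z Hij Hz. generalize (inv_INR_antitone i j Hij). lra.
    + intros z Hz. destruct (HKr z Hz) as [Hz1 Hz2]. apply Cmod_gt_0 in Hz2.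
      destruct (inv_INR_small (Rmin (Cmod z - rho) (Cmod (De z)))) as [j Hj].
      { apply Rmin_glb_lt; lra. }
      exists j. generalize (Rmin_l (Cmod z - rho) (Cmod (De z))) (Rmin_r (Cmod z - rho) (Cmod (De z))). lra.
    + assert (Hj0 : 0 < / INR (S j)) by (apply Rinv_0_lt_compat, lt_0_INR; lia).
      destruct (Hest (rho + / INR (S j))) as [B [s [Hs H]]]; [lra|].
      assert (Heps : 0 < / INR (S j) / tau) by now apply Rdiv_lt_0_compat.
      destruct (geometric_small B s _ Hs Heps) as [N HN].
      exists N. intros n Hn z Hz HPhi. destruct (Hj z Hz) as [Hz1 Hz2].
      specialize (H n z ltac:(lra)). specialize (HN n Hn).
      assert (E : ratio n z = RtoC 0).
      { unfold ratio. rewrite HPhi. unfold Cdiv. ring. }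
      rewrite E, Cmod_sub_sym in H. replace (limit z - 0)%C with (limit z) in H by ring.
      unfold limit in H. rewrite Cmod_div, Cmod_R, (Rabs_pos_eq tau) in H by (trivial; lra).
      assert (/ INR (S j) / tau < Cmod (De z) / tau).
      { apply Rmult_lt_compat_r; trivial. now apply Rinv_0_lt_compat. }
      lra.
  - intros zeta Hzeta HDz.
    assert (Hz0 : zeta <> RtoC 0) by (apply Cmod_gt_0; lra).
    assert (Hn0 : forall z, rho < Cmod z -> z <> RtoC 0) by (intros z Hz; apply Cmod_gt_0; lra).
    assert (Hinv : forall z, rho < Cmod z -> rho * Cmod (/ z) < 1).
    { intros z Hz. rewrite Cmod_inv by auto. apply Rmult_lt_reg_r with (Cmod z). lra.
      rewrite Rmult_assoc, Rinv_l; lra. }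
    set (u0 := (/ zeta)%C).
    assert (Hu0 : u0 <> RtoC 0).
    { apply Cmod_gt_0. unfold u0. rewrite Cmod_inv by trivial. apply Rinv_0_lt_compat. lra. }
    destruct (power_series_zero_order c rho u0) as [k [b [Hb1 [Hb2 Hb3]]]]; trivial; try lra.
    { rewrite Hc0. intros E. apply RtoC_inj in E. lra. }
    { apply Hinv. lra. }
    (* From [1 / z - 1 / zeta = - (z - zeta) / (z * zeta)]: the order of the zero at [u0] in the
       variable [u] is the order at [zeta] in the variable [z]. *)
    set (G := fun z => ((- / (z * zeta)) ^ k * CPSeries b (/ z))%C).
    assert (HG : forall z, rho < Cmod z -> limit z = ((z - zeta) ^ k * G z)%C).
    { intros z Hz. rewrite Hlim, Hb3 by auto. unfold G, u0. rewrite Cmult_assoc, <- Cpow_mult_l.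
      f_equal. f_equal. field. split; auto. }
    assert (DG : forall z, rho < Cmod z -> Cdiffable G z).
    { intros z Hz. apply Cdiffable_mult.
      - apply Cdiffable_pow, Cdiffable_opp, Cdiffable_inv. apply Cmult_neq_0; auto.
        smooth.
      - apply (Cdiffable_comp (CPSeries b) (fun z => / z)%C).
        apply (coef_decay_Cdiffable b rho); auto. lra.
        smooth. }
    assert (HGz : G zeta <> RtoC 0).
    { apply Cmult_neq_0; trivial. apply Cpow_nz. intros E.
      apply (f_equal Copp) in E. replace (- - / (zeta * zeta))%C with (/ (zeta * zeta))%C in E by ring.
      assert (E' : (zeta * zeta * / (zeta * zeta))%C = RtoC 0) by (rewrite E; ring).
      rewrite Cinv_r in E' by now apply Cmult_neq_0. apply RtoC_inj in E'. lra. }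
    assert (Hk : (0 < k)%nat).
    { destruct k; [|lia]. exfalso. apply HGz.
      assert (E := HG zeta ltac:(lra)). unfold limit in E. rewrite HDz in E. simpl (_ ^ 0)%C in E at 1.
      rewrite Cmult_1_l in E. rewrite <- E. unfold Cdiv. ring. }
    exists k. split; trivial. split.
    { exists (fun z => rho < Cmod z), (fun z => RtoC tau * G z)%C. split; [|split; [|split; [|split]]].
      - intros z Hz. apply (Cmod_gt_locally (fun z => z)); smooth.
      - lra.
      - apply holomorphic_on_Cdiffable. intros z Hz. apply Cdiffable_mult. smooth. now apply DG.
      - now apply Cmult_neq_0.
      - intros z Hz. replace (De z) with (RtoC tau * limit z)%C by (unfold limit; field; trivial).
        rewrite HG by trivial. ring. }
    assert (HmG := proj1 (Cmod_gt_0 _) HGz).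
    assert (CG := Cdiffable_continuous _ _ (DG zeta ltac:(lra))).
    assert (He : 0 < Cmod (G zeta) / 2) by lra.
    generalize (CG _ He). intros KG. apply locally_Cmod in KG. destruct KG as [d [Hd KG]].
    (* [d] keeps [|G|] between [1/2] and [3/2] times [|G zeta|]; the other bound keeps the disc
       inside [|z| >= (rho + |zeta|) / 2], where the estimate of [ratio] is uniform. *)
    set (R0 := Rmin d ((Cmod zeta - rho) / 2)).
    assert (HR0 : 0 < R0) by (apply Rmin_glb_lt; lra).
    assert (HR0d : R0 <= d) by apply Rmin_l.
    assert (HR0r : R0 <= (Cmod zeta - rho) / 2) by apply Rmin_r.
    assert (Hdisc : forall z, Cmod (z - zeta) < R0 -> (rho + Cmod zeta) / 2 <= Cmod z).
    { intros z Hz. generalize (Cmod_sub_ge zeta z). rewrite Cmod_sub_sym. lra. }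
    destruct (Hest ((rho + Cmod zeta) / 2)) as [M [q [Hq H]]]; [lra|].
    assert (Hfac : forall n, exists L, forall z, Phi n z = root_product L z).
    { intros n. destruct (monic_polynomial_factorization (Phi n) n) as [L [_ HL]].
      apply (monic_poly_leading w kappa phi hphi). now exists L. }
    set (L := fun n => proj1_sig (constructive_indefinite_description _ (Hfac n))).
    assert (HL : forall n z, Phi n z = root_product (L n) z).
    { intros n. exact (proj2_sig (constructive_indefinite_description _ (Hfac n))). }
    (* The roots of [Phi n] are sorted by membership in the disc; those outside, together with
       [1 / z^n], form the zero-free cofactor [Hf n]. *)
    set (inD := fun b => if Rlt_dec (Cmod (b - zeta)) R0 then true else false).
    set (Lin := fun n => filter inD (L n)).
    set (Lout := fun n => filter (fun b => negb (inD b)) (L n)).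
    assert (HLin : forall n b, In b (Lin n) -> Cmod (b - zeta) < R0).
    { intros n b0 Hb0. apply filter_In in Hb0. destruct Hb0 as [_ Hb0]. unfold inD in Hb0.
      now destruct (Rlt_dec (Cmod (b0 - zeta)) R0). }
    assert (HLout : forall n b, In b (Lout n) -> ~ Cmod (b - zeta) < R0).
    { intros n b0 Hb0. apply filter_In in Hb0. destruct Hb0 as [_ Hb0]. unfold inD in Hb0.
      now destruct (Rlt_dec (Cmod (b0 - zeta)) R0). }
    assert (Hsplit : forall n z, Phi n z = (root_product (Lin n) z * root_product (Lout n) z)%C).
    { intros n z. rewrite HL. unfold Lin, Lout. induction (L n) as [|b0 l IH]; simpl.
      - ring.
      - rewrite IH. destruct (inD b0); simpl; ring. }
    set (Hf := fun n z => (root_product (Lout n) z / z ^ n)%C).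
    assert (Pg : forall z, Cmod (z - zeta) < R0 ->
      limit z = ((z - zeta) ^ k * G z)%C /\ Cmod (G zeta) / 2 <= Cmod (G z) <= 3 / 2 * Cmod (G zeta)).
    { intros z Hz. split. apply HG. specialize (Hdisc z Hz). lra.
      specialize (KG z ltac:(lra)). generalize (Cmod_sub_ge (G z) (G zeta)) (Cmod_sub_ge (G zeta) (G z)).
      rewrite (Cmod_sub_sym (G zeta)). lra. }
    assert (Pf : forall n z, Cmod (z - zeta) < R0 -> Cmod (ratio n z - limit z) <= M * q ^ n).
    { intros n z Hz. apply H. now apply Hdisc. }
    assert (PfL : forall n z, Cmod (z - zeta) < R0 -> ratio n z = (root_product (Lin n) z * Hf n z)%C).
    { intros n z Hz. unfold ratio, Hf. rewrite Hsplit. unfold Cdiv. ring. }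
    assert (PHd : forall n z, Cmod (z - zeta) < R0 -> Cdiffable (Hf n) z).
    { intros n z Hz. specialize (Hdisc z Hz). apply Cdiffable_div.
      - apply Cpow_nz, Hn0. lra.
      - smooth.
      - smooth. }
    assert (PHn : forall n z, Cmod (z - zeta) < R0 -> Hf n z <> RtoC 0).
    { intros n z Hz. assert (Hz1 := Hdisc z Hz).
      assert (Hzn : (z ^ n)%C <> RtoC 0) by (apply Cpow_nz, Hn0; lra).
      apply Cmod_gt_0. unfold Hf. rewrite Cmod_div by trivial. apply Rdiv_lt_0_compat.
      - apply Cmod_gt_0. intros E. apply root_product_eq_0 in E. now apply (HLout n z E).
      - now apply Cmod_gt_0. }
    destruct (hurwitz_rate ratio Hf limit G Lin zeta R0 _ _ M q k Hk He Hq Pg Pf HLin PfL)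
      as [M' [q' [HM' [Hq' Hrate]]]].
    destruct (hurwitz_lower ratio Hf limit G Lin zeta R0 _ _ M q k Hk HR0 He Hq Pg Pf HLin PfL PHd PHn) as [m1 Hm1].
    destruct (hurwitz_upper ratio Hf limit G Lin zeta R0 _ _ M q k Hk HR0 He Hq Pg Pf HLin PfL PHd) as [m2 Hm2].
    exists R0, M', q', (m1 + m2)%nat. split; trivial. split; trivial.
    intros n Hn. exists (Lin n). split; [|split].
    + exact (root_product_zeros_in _ _ _ _ (Hsplit n) (HLin n) (HLout n)).
    + apply Nat.le_antisymm. apply Hm2; lia. apply Hm1; lia.
    + apply Hrate.
Qed.
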